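(* Let $\theta\in[0,2\pi)$ satisfy $\cos\theta\in\mathbb{Q}\setminus\frac12\mathbb{Z}$, and let $\mu$ be a probability measure on $\mathrm{Isom}(\mathbb{R}^2)$ of one of the following two types: (1) (Littlewood polynomial) $\mu$ is uniform on $\{\tau_1\rho_\theta,\tau_{-1}\rho_\theta\}$; (2) (asymmetric wreath product) $\operatorname{supp}\mu=\{\rho_\theta,\rho_{-\theta},\tau_1,\tau_{-1}\}$ with $\mu(\{\tau_1\})=\mu(\{\tau_{-1}\})$ but $\mu(\{\rho_\theta\})\ne\mu(\{\rho_{-\theta}\})$. Let $g_1,g_2,\dots$ be independent with law $\mu$, $Y_N:=(g_1g_2\cdots g_N)(0)$, and $\sigma^2:=\frac12\mathbb{E}|g_1(0)|^2$. Then there are constants $c,C>0$ (independent of $N,x_0,r$) such that for every $N\ge 2$, every $x_0\in\mathbb{R}^2$ and every $r>\exp(-c\sqrt N/\log N)$, $$|\mathbb{P}(Y_N\in B_r(x_0))-\mathbb{P}(\sigma\sqrt{N}Z_1\in B_r(x_0))|\le CN^{-3/2}r^2,$$ where $Z_1$ is the standard Gaussian on $\mathbb{R}^2$.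
   Context: Identify $\mathbb{R}^2$ with $\mathbb{C}$. $\tau_v$ denotes translation by $v$, $\tau_v(x)=x+v$, and $\rho_\theta$ denotes rotation about the origin, $\rho_\theta(x)=e^{i\theta}x$. $B_r(x_0)$ is the ball of radius $r$ about $x_0$. The standard Gaussian on $\mathbb{R}^2$ has mean zero and identity covariance. *)

(* Defs.v *)
From HB Require Import structures.
From mathcomp Require Import all_boot all_order all_algebra.
From mathcomp Require Import finmap ring.
From mathcomp Require Import all_classical all_reals all_analysis.

Set Implicit Arguments.
Unset Strict Implicit.
Unset Printing Implicit Defensive.

Import Order.TTheory GRing.Theory Num.Theory.
Import numFieldNormedType.Exports.

Local Open Scope classical_set_scope.
Local Open Scope ring_scope.

(* The point x + iy of C = R^2 is the pair (x, y).  The library norm of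
   [R * R] is the sup norm, so the Euclidean norm is defined separately; the
   product topology and the product sigma-algebra of [R * R] are the usual
   topology and Borel sigma-algebra of the plane. *)
Notation plane R := (R * R)%type.

(* the complex number 1 *)
Definition plane_one {R : realType} : plane R := (1, 0).

Definition enorm {R : realType} (x : plane R) : R :=
  Num.sqrt (x.1 ^+ 2 + x.2 ^+ 2).

Definition eball {R : realType} (x0 : plane R) (r : R) : set (plane R) :=
  [set x | enorm (x - x0) < r].

Definition dilation {R : realType} (a : R) (x : plane R) : plane R :=
  (a * x.1, a * x.2).

Lemma enorm_sqr {R : realType} (x : plane R) :
  enorm x ^+ 2 = x.1 ^+ 2 + x.2 ^+ 2.
Proof. by rewrite /enorm sqr_sqrtr// addr_ge0 ?sqr_ge0. Qed.

Lemma enorm_eq0 {R : realType} (x : plane R) : enorm x = 0 -> x = 0.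
Proof.
move=> x0; have := enorm_sqr x; rewrite x0 expr0n/= => /esym/eqP.
rewrite paddr_eq0 ?sqr_ge0// !sqrf_eq0.
by case: x {x0} => a b /= /andP[/eqP-> /eqP->].
Qed.

Record Isom (R : realType) := MkIsom {
  isom_fun :> plane R -> plane R;
  isom_dist : forall x y, enorm (isom_fun x - isom_fun y) = enorm (x - y);
  isom_surj : forall y, exists x, isom_fun x = y }.

Lemma isomP (R : realType) (f g : Isom R) : (forall x, f x = g x) -> f = g.
Proof.
case: f g => [f fd fs] [g gd gs] /= /funext fg.
by case: g / fg gd gs => gd gs; congr MkIsom; exact: Prop_irrelevance.
Qed.

HB.instance Definition _ (R : realType) := gen_eqMixin (Isom R).
HB.instance Definition _ (R : realType) := gen_choiceMixin (Isom R).

Section isom_group.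
Variable R : realType.
Implicit Types f g : Isom R.

Definition isom_one : Isom R.
Proof. by exists id => // y; exists y. Defined.

Definition isom_mul f g : Isom R.
Proof.
exists (f \o g) => [x y|z] /=; first by rewrite !isom_dist.
have [y <-] := isom_surj f z; have [x <-] := isom_surj g y.
by exists x.
Defined.

Let invfun f y := projT1 (cid (isom_surj f y)).

Let invfunK f : cancel (invfun f) f.
Proof. by move=> y; rewrite /invfun; case: cid. Qed.

Let funK f : cancel f (invfun f).
Proof.
move=> x; apply/subr0_eq/enorm_eq0.
rewrite -(isom_dist f) invfunK subrr.
by rewrite /enorm /= expr0n addr0 sqrtr0.
Qed.

Definition isom_inv f : Isom R.
Proof.
exists (invfun f) => [x y|x]; last by exists (f x); rewrite funK.
by rewrite -(isom_dist f) !invfunK.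
Defined.

Let isom_mulA : associative isom_mul.
Proof. by move=> f g h; apply: isomP. Qed.

Let isom_mul1 : left_id isom_one isom_mul.
Proof. by move=> f; apply: isomP. Qed.

Let isom_mulr1 : right_id isom_one isom_mul.
Proof. by move=> f; apply: isomP. Qed.

Let isom_mulV : left_inverse isom_one isom_inv isom_mul.
Proof. by move=> f; apply: isomP => x /=; rewrite funK. Qed.

Let isom_mulrV : right_inverse isom_one isom_inv isom_mul.
Proof. by move=> f; apply: isomP => x /=; rewrite invfunK. Qed.

HB.instance Definition _ := isGroup.Build (Isom R)
  isom_mulA isom_mul1 isom_mulr1 isom_mulV isom_mulrV.

End isom_group.

(* Isom(R^2) carries the topology of pointwise convergence, which on isometries
   coincides with the compact-open (Lie group) topology, and its Borel
   sigma-algebra. *)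
HB.instance Definition _ (R : realType) := isPointed.Build (Isom R) 1%g.
HB.instance Definition _ (R : realType) := Topological.copy (Isom R)
  (initial_topology (@isom_fun R : Isom R -> {ptws plane R -> plane R})).
HB.instance Definition _ (R : realType) := Measurable.copy (Isom R)
  (g_sigma_algebraType (@open (Isom R))).

Definition tau {R : realType} (v : plane R) : Isom R.
Proof.
exists (fun x => x + v) => [x y|y] /=.
  by rewrite opprD addrACA subrr addr0.
by exists (y - v); rewrite subrK.
Defined.

(* e^(i theta) (x + iy), separated into real and imaginary parts *)
Definition rho {R : realType} (theta : R) : Isom R.
Proof.
exists (fun x => (cos theta * x.1 - sin theta * x.2,
                  sin theta * x.1 + cos theta * x.2)).
  move=> [a b] [a' b']; rewrite /enorm /=; congr Num.sqrt.
  rewrite -[RHS]mul1r -(cos2Dsin2 theta).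
  by rewrite !(expr2, mulrDl, mulrDr, mulrN, mulNr, opprD, opprK); ring.
move=> [a b]; exists (cos theta * a + sin theta * b,
                      cos theta * b - sin theta * a) => /=.
by congr pair; [rewrite -[RHS]mul1r|rewrite -[RHS]mul1r];
  rewrite -(cos2Dsin2 theta); ring.
Defined.

Definition topological_support {R : realType}
    (mu : {measure set (Isom R) -> \bar R}) : set (Isom R) :=
  [set g | forall U, open U -> U g -> (0 < mu U)%E].

Definition littlewood_polynomial {R : realType} (theta : R)
    (mu : probability (Isom R) R) : Prop :=
  forall A, measurable A ->
    mu A = ((2^-1)%:E * (dirac (tau plane_one * rho theta)%g A +
                         dirac (tau (- plane_one)%R * rho theta)%g A))%E.

Definition asymmetric_wreath_product {R : realType} (theta : R)
    (mu : probability (Isom R) R) : Prop :=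
  [/\ topological_support mu =
        [set rho theta; rho (- theta); tau plane_one; tau (- plane_one)],
      mu [set tau plane_one] = mu [set tau (- plane_one)] &
      mu [set rho theta] <> mu [set rho (- theta)]].

Definition mutually_independent {R : realType} d d' (T : measurableType d)
    (T' : measurableType d') (P : probability T R)
    (X : nat -> {RV P >-> T'}) : Prop :=
  forall (J : {fset nat}) (A : nat -> set T'),
    (forall j, measurable (A j)) ->
    P (\bigcap_(j in [set` J]) (X j @^-1` A j)) =
      (\prod_(j <- J) P (X j @^-1` A j))%E.

Section walk.
Context {R : realType} d (T : measurableType d) (P : probability T R).
Variable g : nat -> {RV P >-> Isom R}.

(* The increments are indexed from 0: [g 0] is the first one, g_1. *)
Definition walk (N : nat) (w : T) : plane R :=
  (\prod_(i < N) (g i w : Isom R))%g 0.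

Definition walk_sigma : R :=
  Num.sqrt (2^-1 * fine 'E_P[fun w => enorm (g 0%N w 0) ^+ 2]).

End walk.

Definition standard_gaussian_plane (R : realType) : set (plane R) -> \bar R :=
  (normal_prob 0 1 \x normal_prob 0 1)%E.

(* Main.v *)
(** The characteristic function [phi n] of the walk satisfies a recursion
    [phi (n + 1) = T (phi n)] in which [T] averages, with cosine weights, over
    the frequency and its rotations by [theta] and [- theta].  At low
    frequencies a quadratic corrector makes [phi n] Gaussian up to a relative
    error [O(1 / n)].  At higher frequencies [phi n] decays geometrically as
    soon as a bounded number [L] of rotations brings every frequency to one
    whose first coordinate is away from the multiples of [pi].  Since
    [2 cos theta] is a rational number with denominator at least 2, a descent
    argument gives [L = O(log |xi|)] at the frequency [xi], so that [phi N xi]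
    is of size [exp(- c N / log |xi|)].  Frequencies up to [N ^ 3 / r] suffice
    to compare the masses of a ball of radius [r] after Gaussian smoothing, and
    for these [log |xi|] is at most a small multiple of [sqrt N]. *)

From HB Require Import structures.
Require Import Defs.
From mathcomp Require Import all_boot all_order all_algebra.
From mathcomp Require Import finmap ring lra zify.
From mathcomp Require Import all_classical all_reals all_analysis.
From mathcomp Require Import measurable_realfun.

Set Implicit Arguments.
Unset Strict Implicit.
Unset Printing Implicit Defensive.

Import Order.TTheory GRing.Theory Num.Theory.
Import numFieldNormedType.Exports.

Local Open Scope classical_set_scope.
Local Open Scope ring_scope.

(** * Decay of the characteristic function *)

Section transfer_operator.
Variable R : realType.
Implicit Types (z : plane R) (f h : plane R -> R).

(** Every error is then [O(r ^ 2 / N ^ 2)], better than the stated power. The annulus between the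
    two radii has area [O(r ^ 2 / N)] and meets a Gaussian density [O(1 / N)]; the relative error
    [1 / N] at low frequencies is integrated against a Gaussian of total mass [O(1 / N)]. The origin
    of [sqrt N]: near the frequency [N ^ 3 / r] the decay [exp(- c N / log |xi|)] has to beat
    [r ^ 2 / N ^ 6], so that [log(1 / r) ^ 2] may be at most a small multiple of [N]. This reaches
    [r = exp(- c sqrt N)], a range which contains that of the theorem once [c] is adjusted. One step
    damps the first coordinate of the frequency only, and a corrector is what makes this isotropic.
    In the wreath product the rotation can be undone by its inverse; the asymmetry gives the number
    of rotations still missing a negative drift, so that about [L] steps suffice where an unbiased
    walk would need [L ^ 2]. *)

Definition sqnorm z : R := z.1 ^+ 2 + z.2 ^+ 2.

Lemma sqnorm_ge0 z : 0 <= sqnorm z.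
Proof. by rewrite addr_ge0 ?sqr_ge0. Qed.

(* multiplication by [c - i s] *)
Definition rot (c s : R) z : plane R :=
  (c * z.1 + s * z.2, c * z.2 - s * z.1).

Lemma rotK (c s : R) : c ^+ 2 + s ^+ 2 = 1 -> cancel (rot c s) (rot c (- s)).
Proof.
move=> cs [x y]; rewrite /rot /=; congr pair.
  by rewrite -[RHS]mul1r -cs; ring.
by rewrite -[RHS]mul1r -cs; ring.
Qed.

Lemma rotVK (c s : R) : c ^+ 2 + s ^+ 2 = 1 -> cancel (rot c (- s)) (rot c s).
Proof. by move=> cs; have := @rotK c (- s); rewrite opprK sqrrN; apply. Qed.

Lemma sqnorm_rot (c s : R) z : c ^+ 2 + s ^+ 2 = 1 ->
  sqnorm (rot c s z) = sqnorm z.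
Proof. by move=> cs; rewrite -[RHS]mul1r -cs /sqnorm /rot /=; ring. Qed.

(* [p] is the mass of the translations by 1 and -1, [q] that of the rotation
   followed by a translation by 1 or -1, [a] and [b] those of the rotation and
   of its inverse.  The Littlewood walk is [q = 1]; the wreath product has
   [q = 0]. *)
Definition transfer (p q a b c s : R) f z : R :=
  p * cos z.1 * f z + (a + q * cos z.1) * f (rot c s z) +
  b * f (rot c (- s) z).

Definition char_walk (p q a b c s : R) n : plane R -> R :=
  iter n (transfer p q a b c s) (fun=> 1).

Section weights.
Variables p q a b c s : R.
Hypotheses (p0 : 0 <= p) (q0 : 0 <= q) (a0 : 0 <= a) (b0 : 0 <= b).
Hypothesis pqab : p + q + a + b = 1.
Hypothesis cs : c ^+ 2 + s ^+ 2 = 1.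

Let cs' : c ^+ 2 + (- s) ^+ 2 = 1.
Proof. by rewrite sqrrN. Qed.

Notation T := (transfer p q a b c s).
Notation phi := (char_walk p q a b c s).

Lemma transfer_norm_le f h z :
  `|f z| <= h z -> `|f (rot c s z)| <= h (rot c s z) ->
  `|f (rot c (- s) z)| <= h (rot c (- s) z) ->
  `|T f z| <= p * `|cos z.1| * h z + (a + q * `|cos z.1|) * h (rot c s z) +
             b * h (rot c (- s) z).
Proof.
move=> h1 h2 h3; rewrite /transfer.
apply: (le_trans (ler_normD _ _)); apply: lerD; last first.
  by rewrite normrM ger0_norm// ler_wpM2l.
apply: (le_trans (ler_normD _ _)); apply: lerD.
  rewrite !normrM (ger0_norm p0).
  by rewrite ler_wpM2l// mulr_ge0.
rewrite normrM; apply: ler_pM => //.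
by rewrite (le_trans (ler_normD _ _))// normrM (ger0_norm a0) (ger0_norm q0).
Qed.

(** Comparison principle: the weights are nonnegative, so a majorant passes through the operator
    once the cosines are replaced by their absolute values. Rotations preserve [sqnorm], which
    confines everything to one circle. *)
Lemma char_walk_le_supersolution (rho lam : R) h :
  (forall z, sqnorm z = rho -> 1 <= h z) ->
  (forall z, sqnorm z = rho ->
    p * `|cos z.1| * h z + (a + q * `|cos z.1|) * h (rot c s z) +
    b * h (rot c (- s) z) <= lam * h z) ->
  0 <= lam ->
  forall n z, sqnorm z = rho -> `|phi n z| <= lam ^+ n * h z.
Proof.
move=> h1 hT lam0; elim=> [|n IH] z zr.
  by rewrite /= normr1 expr0 mul1r h1.
rewrite [phi _]/=.
apply: (le_trans (transfer_norm_le (h := fun z => lam ^+ n * h z) _ _ _)).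
- exact: IH.
- by apply: IH; rewrite sqnorm_rot.
- by apply: IH; rewrite sqnorm_rot.
rewrite [leRHS](_ : _ = lam ^+ n * (lam * h z)); last by rewrite exprSr mulrA.
apply: le_trans (ler_wpM2l (exprn_ge0 n lam0) (hT z zr)).
by rewrite le_eqVlt; apply/orP; left; apply/eqP; ring.
Qed.

(* Supersolution: [1 + gamma d / L], where [d] is the number of rotations
   needed to reach a frequency at which the cosine is small.  The drift
   [a + q - b] makes it decrease on average away from those frequencies. *)
Lemma char_walk_decay (rho eps : R) (L : nat) :
  b < a + q -> 0 < eps -> eps <= 1 ->
  (forall z, sqnorm z = rho ->
     exists m, (m < L)%N /\ `|cos (iter m (rot c s) z).1| <= 1 - eps) ->
  forall n z, sqnorm z = rho ->
    `|phi n z| <= 2 * expR (- ((a + q - b) * ((p + q) * eps) / 4 * n%:R / L%:R)).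
Proof.
move=> ba e0 e1 hL.
(* By minimality, away from its zeros [d] drops by at least one under the rotation, and it grows by
   at most one under the inverse rotation. *)
have [d dP] : {d : plane R -> nat & forall z, sqnorm z = rho ->
    [/\ (d z < L)%N, `|cos (iter (d z) (rot c s) z).1| <= 1 - eps &
       forall k, `|cos (iter k (rot c s) z).1| <= 1 - eps -> (d z <= k)%N]}.
  apply: (@choice _ _ (fun z m => sqnorm z = rho ->
    [/\ (m < L)%N, `|cos (iter m (rot c s) z).1| <= 1 - eps &
       forall k, `|cos (iter k (rot c s) z).1| <= 1 - eps -> (m <= k)%N])).
  move=> z; have [zr|zr] := pselect (sqnorm z = rho); last by exists 0%N.
  have [m0 [m0L m0P]] := hL z zr.
  pose P m := `|cos (iter m (rot c s) z).1| <= 1 - eps.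
  have exP : exists m, P m by exists m0.
  case: (ex_minnP exP) => m Pm mmin; exists m => _; split => //.
  by apply: leq_ltn_trans m0L; exact: mmin.
(* Where the cosine is small, a step loses [(p + q) * eps], twice [gam], while [h] is at most
   [1 + gam] on the circle: a net loss of [gam] remains. *)
pose gam := (p + q) * eps / 2.
have gam0 : 0 <= gam by rewrite divr_ge0// mulr_ge0// ?addr_ge0// ltW.
have pq1 : p + q <= 1 by rewrite -pqab -addrA lerDl addr_ge0.
have gam1 : gam <= 2^-1.
  rewrite /gam -[leRHS]mul1r ler_wpM2r ?invr_ge0// -[leRHS]mul1r.
  by rewrite ler_pM ?addr_ge0// ltW.
case: L => [|L] in hL dP *.
  by move=> n z zr; have [m []] := hL z zr.
pose l : R := L.+1%:R.
have l0 : 0 < l by rewrite ltr0n.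
have l1 : 1 <= l by rewrite ler1n.
pose h z : R := 1 + gam * (d z)%:R / l.
have hE x : gam * x / l = gam / l * x by rewrite mulrAC.
have h1 z : 1 <= h z by rewrite /h lerDl; apply: divr_ge0; [exact: mulr_ge0|exact: ltW].
have h2 z : sqnorm z = rho -> h z <= 1 + gam.
  move=> zr; rewrite lerD2l -mulrA ler_piMr// ler_pdivrMr// mul1r ler_nat.
  by have [/ltnW] := dP z zr.
(* Elsewhere the drift lowers [h] by [2 * kap], which is at least [kap * h] because [h <= 2]. *)
pose kap := (a + q - b) * gam / (2 * l).
have kap0 : 0 <= kap.
  by apply: divr_ge0; apply: mulr_ge0 => //; lra.
have aqb1 : a + q - b <= 1 by move: p0 q0 a0 b0 pqab; lra.
have aqb0 : 0 <= a + q - b by lra.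
have kapg : kap <= gam.
  rewrite /kap ler_pdivrMr ?mulr_gt0// mulrC.
  rewrite ler_wpM2l//; lra.
have hT z : sqnorm z = rho ->
    p * `|cos z.1| * h z + (a + q * `|cos z.1|) * h (rot c s z) +
    b * h (rot c (- s) z) <= (1 - kap) * h z.
  move=> zr; have [dL dz dmin] := dP z zr.
  have zr1 : sqnorm (rot c s z) = rho by rewrite sqnorm_rot.
  have zr2 : sqnorm (rot c (- s) z) = rho by rewrite sqnorm_rot.
  have [d1L d1z d1min] := dP _ zr1; have [d2L d2z d2min] := dP _ zr2.
  have cos1 := cos_max z.1; have cosge := normr_ge0 (cos z.1).
  have hz1 := h1 z.
  have hr1 := h1 (rot c s z).
  have hr2 := h1 (rot c (- s) z).
  have [bad|good] := leP `|cos z.1| (1 - eps).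
    have dz0 : d z = 0%N by apply/eqP; rewrite -leqn0; exact: dmin.
    have hz : h z = 1 by rewrite /h dz0 mulr0 mul0r addr0.
    have hr1' := h2 _ zr1; have hr2' := h2 _ zr2.
    rewrite hz mulr1.
    have -> : (1 - kap) * 1 = 1 - kap by rewrite mulr1.
    apply: (@le_trans _ _ (p * (1 - eps) + (a + q * (1 - eps)) * (1 + gam) +
      b * (1 + gam))).
      apply: lerD; last exact: ler_wpM2l.
      apply: lerD; first exact: ler_wpM2l.
      apply: ler_pM => //; first by rewrite addr_ge0// mulr_ge0.
        by apply: le_trans hr1.
      by rewrite lerD2l ler_wpM2l.
    have -> : p * (1 - eps) + (a + q * (1 - eps)) * (1 + gam) + b * (1 + gam) =
       (p + q + a + b) + (p + q + a + b) * gam - (p + q) * eps - (p + q * eps) * gam.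
      by ring.
    rewrite pqab !mul1r.
    have -> : (p + q) * eps = gam + gam by rewrite /gam; field.
    have : 0 <= (p + q * eps) * gam.
      by rewrite mulr_ge0// addr_ge0// mulr_ge0// ltW.
    lra.
  have dz0 : (0 < d z)%N.
  by rewrite lt0n; apply/eqP => d0; move: dz; rewrite d0 /= leNgt good.
  have e1z : h (rot c s z) <= h z - gam / l.
    have : (d (rot c s z)).+1%:R <= (d z)%:R :> R.
      rewrite ler_nat -(prednK dz0) ltnS; apply: d1min.
      by rewrite -iterSr prednK.
    rewrite -natr1 => dd.
    have := ler_wpM2l (divr_ge0 gam0 (ltW l0)) dd.
    rewrite /h !hE; move: (gam / l) => u; lra.
  have e2z : h (rot c (- s) z) <= h z + gam / l.
    have : (d (rot c (-s) z))%:R <= (d z).+1%:R :> R.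
      rewrite ler_nat; apply: d2min.
      by rewrite iterSr rotVK.
    rewrite -natr1 => dd.
    have := ler_wpM2l (divr_ge0 gam0 (ltW l0)) dd.
    rewrite /h !hE; move: (gam / l) => u; lra.
  apply: (@le_trans _ _ (p * h z + (a + q) * (h z - gam / l) +
      b * (h z + gam / l))).
    apply: lerD; last exact: ler_wpM2l.
    apply: lerD.
      by rewrite -mulrA ler_wpM2l// ler_piMl// (le_trans _ hz1).
    apply: ler_pM => //; first by rewrite addr_ge0// mulr_ge0.
      by apply: le_trans hr1.
    by rewrite lerD2l ler_piMr.
  have -> : p * h z + (a + q) * (h z - gam / l) + b * (h z + gam / l) =
    (p + q + a + b) * h z - 2 * kap.
    by rewrite /kap; field; rewrite gt_eqF.
  rewrite pqab mulrBl lerD2l lerN2 mulrC ler_wpM2r//.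
  have := h2 _ zr; lra.
have kap1 : 0 <= 1 - kap by lra.
move=> n z zr.
apply: (le_trans (char_walk_le_supersolution (fun z _ => h1 z) hT kap1 n zr)).
rewrite mulrC; apply: ler_pM; rewrite ?exprn_ge0 ?(le_trans ler01 (h1 z))//.
  by have := h2 _ zr; lra.
have := expR_ge1Dx (- kap) => ek.
apply: (@le_trans _ _ (expR (- kap) ^+ n)).
  by rewrite lerXn2r ?nnegrE ?expR_ge0.
rewrite -expRM_natl ler_expR mulrN lerN2 /kap /gam.
rewrite le_eqVlt; apply/orP; left; apply/eqP; field; by rewrite gt_eqF.
Qed.

End weights.
End transfer_operator.

(** * Elementary inequalities for sine, cosine and exponential *)

Section trigonometric_bounds.
Variable R : realType.
Implicit Types x y : R.

Lemma ge0_derive (f df : R -> R) : (forall x, is_derive x 1 f (df x)) ->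
  f 0 = 0 -> (forall x, 0 <= x -> 0 <= df x) -> forall x, 0 <= x -> 0 <= f x.
Proof.
move=> fdf f0 df0 x x0.
have cf : {within `[0, x], continuous f}.
  apply: continuous_subspaceT => y.
  by apply/differentiable_continuous/derivable1_diffP; apply: ex_derive.
have [y] := MVT_segment x0 (fun y _ => fdf y) cf.
rewrite in_itv /= => /andP[y0 _]; rewrite f0 subr0 => ->.
by rewrite subr0 mulr_ge0// df0.
Qed.

Lemma sin_le_id x : 0 <= x -> sin x <= x.
Proof.
move=> x0; rewrite -subr_ge0.
apply: (@ge0_derive (fun x => x - sin x) (fun x => 1 - cos x)) => //.
by rewrite sin0 subr0.
Qed.

Lemma norm_sin_le x : `|sin x| <= `|x|.
Proof.
wlog x0 : x / 0 <= x.
  move=> H; have [/H//|/ltW x0] := leP 0 x.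
  by rewrite -normrN -sinN -(normrN x) H// oppr_ge0.
rewrite (ger0_norm x0) ler_norml sin_le_id// andbT.
have [x1|x1] := leP x 1; last by have := sin_geN1 x; lra.
have : 0 <= sin x by apply: sin_ge0_pi; rewrite x0/=; have := pi_ge2 R; lra.
lra.
Qed.

Lemma cos_ge_quadratic x : 1 - x ^+ 2 / 2 <= cos x.
Proof.
have -> : cos x = 1 - 2 * sin (x / 2) ^+ 2.
  rewrite {1}(_ : x = x / 2 + x / 2); last by field.
  by rewrite cosD -!expr2 cos2sin2; ring.
have : sin (x / 2) ^+ 2 <= (x / 2) ^+ 2.
  by rewrite -(real_normK (num_real (sin _))) -(real_normK (num_real (x / 2))) lerXn2r ?nnegrE// norm_sin_le.
lra.
Qed.

Lemma sin_ge_cubic x : 0 <= x -> x - x ^+ 3 / 6 <= sin x.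
Proof.
move=> x0; rewrite -subr_ge0.
have df y : is_derive y 1 (fun x => sin x - (x - x ^+ 3 / 6)) (cos y - (1 - y ^+ 2 / 2)).
  apply: is_derive_eq.
  by rewrite /GRing.scale /=; field.
apply: (ge0_derive df) => //; first by rewrite sin0 expr0n/=; ring.
by move=> y _; rewrite subr_ge0 cos_ge_quadratic.
Qed.

(** Half-angle formula and the square of the cubic lower bound for the sine; [|x| <= 1] keeps that
    bound nonnegative, so that it can be squared. *)
Lemma cos_le_quartic x : `|x| <= 1 -> cos x <= 1 - x ^+ 2 / 2 + x ^+ 4.
Proof.
wlog x0 : x / 0 <= x.
  move=> H; have [/H//|/ltW x0] := leP 0 x.
  rewrite -normrN => x1; have := H (- x).
  have -> : (- x) ^+ 4 = x ^+ 4 by ring.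
  by rewrite cosN sqrrN; apply; rewrite ?oppr_ge0.
rewrite (ger0_norm x0) => x1.
have -> : cos x = 1 - 2 * sin (x / 2) ^+ 2.
  rewrite {1}(_ : x = x / 2 + x / 2); last by field.
  by rewrite cosD -!expr2 cos2sin2; ring.
have y0 : 0 <= x / 2 by lra.
have := sin_ge_cubic y0; set s := sin _; set y := x / 2 => hs.
have -> : x = 2 * y by rewrite /y; field.
have y1 : y <= 2^-1 by rewrite /y; lra.
have h0 : 0 <= y - y ^+ 3 / 6.
  have -> : y - y ^+ 3 / 6 = y * (1 - y ^+ 2 / 6) by field.
  rewrite mulr_ge0//.
  have : y ^+ 2 <= 1 by rewrite expr_le1//; lra.
  lra.
have : (y - y ^+ 3 / 6) ^+ 2 <= s ^+ 2 by rewrite lerXn2r ?nnegrE// (le_trans h0).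
have : 0 <= y ^+ 4 by rewrite exprn_ge0.
have : 0 <= y ^+ 6 by rewrite exprn_ge0.
have -> : (y - y ^+ 3 / 6) ^+ 2 = y ^+ 2 - y ^+ 4 / 3 + y ^+ 6 / 36 by field.
have -> : (2 * y) ^+ 2 / 2 = 2 * y ^+ 2 by field.
have -> : (2 * y) ^+ 4 = 16 * y ^+ 4 by ring.
lra.
Qed.

(** The upper bound follows from [exp u >= 1 + u] and [(1 - u + u ^ 2) (1 + u) = 1 + u ^ 3]. *)
Lemma expRN_quadratic (u : R) : 0 <= u ->
  0 <= expR (- u) - (1 - u) /\ expR (- u) - (1 - u) <= u ^+ 2.
Proof.
move=> u0; split; first by rewrite subr_ge0 expR_ge1Dx.
suff : expR (- u) <= 1 - u + u ^+ 2 by lra.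
rewrite expRN -div1r ler_pdivrMr ?expR_gt0//.
have q0 : 0 <= 1 - u + u ^+ 2.
  have : 0 <= (u - 2^-1) ^+ 2 by rewrite sqr_ge0.
  have -> : (u - 2^-1) ^+ 2 = u ^+ 2 - u + 4^-1 by field.
  lra.
apply: le_trans (ler_wpM2l q0 (expR_ge1Dx u)).
have -> : (1 - u + u ^+ 2) * (1 + u) = 1 + u ^+ 3 by ring.
by rewrite lerDl exprn_ge0.
Qed.

Lemma mulr_expRN_le (u k : R) : 0 <= u -> 0 < k -> u * expR (- (k * u)) <= k^-1.
Proof.
move=> u0 k0; rewrite expRN -ler_pdivlMr ?invr_gt0 ?expR_gt0// invrK.
rewrite mulrC ler_pdivlMr//.
by have := expR_ge1Dx (k * u); lra.
Qed.

End trigonometric_bounds.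

(** * Low frequencies *)

Section low_frequency.
Variable R : realType.
Variables p q a b c s : R.
Hypotheses (p0 : 0 <= p) (q0 : 0 <= q) (a0 : 0 <= a) (b0 : 0 <= b).
Hypothesis pqab : p + q + a + b = 1.
Hypothesis cs : c ^+ 2 + s ^+ 2 = 1.
Hypothesis s0 : s != 0.
Hypothesis pq0 : 0 < p + q.
Hypothesis qab0 : 0 < a + q + b.

Notation T := (transfer p q a b c s).
Notation phi := (char_walk p q a b c s).
Implicit Types (z : plane R) (f h : plane R -> R).

(** One step damps by about [1 - (p + q) * x ^ 2 / 2], and rotations average [x ^ 2] to half of
    [sqnorm]. *)
Let w := (p + q) / 4.

Lemma w_bounds : 0 < w /\ w <= 4^-1.
Proof. by split; move: p0 q0 a0 b0 pqab pq0; rewrite /w; lra. Qed.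

(* [Q] solves [T0 Q - Q = (p + q) / 4 * (x^2 - y^2)], where [T0] is the
   transfer operator without the cosines; then [1 + Q] is an eigenfunction of
   [T] up to fourth order in the frequency. *)
Lemma exists_corrector : exists A B : R,
  let Q z := A * (z.1 ^+ 2 - z.2 ^+ 2) + B * (2 * z.1 * z.2) in
  forall z, p * Q z + (a + q) * Q (rot c s z) + b * Q (rot c (- s) z) =
            Q z + w * (z.1 ^+ 2 - z.2 ^+ 2).
Proof.
(* Identify [(A, B)] with [A + i B]: on the forms [x ^ 2 - y ^ 2] and [2 x y], [T0 - 1] is
   multiplication by [G + i F], and the equation reads [(A + i B) (G + i F) = w]. Here [G] is
   nonzero because [s != 0] and [a + q + b > 0]. *)
pose G := - 2 * (a + q + b) * s ^+ 2; pose F := 2 * (a + q - b) * s * c.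
have D0 : G ^+ 2 + F ^+ 2 != 0.
  rewrite gt_eqF// ltr_pwDl ?sqr_ge0// exprn_even_gt0//=.
  by rewrite /G mulf_neq0 ?sqrf_eq0// mulf_neq0 ?oppr_eq0 ?pnatr_eq0// gt_eqF.
exists (G * w / (G ^+ 2 + F ^+ 2)), (- (F * w / (G ^+ 2 + F ^+ 2))).
set A := G * w / _; set B := - _.
have e1 : A * G - F * B = w.
  by rewrite /A /B; field; rewrite D0.
have e2 : B * G + F * A = 0.
  by rewrite /A /B; field; rewrite D0.
move=> Q z; rewrite /Q -e1 /rot /=.
have pE : p = 1 - q - a - b by move: pqab; lra.
have c2E : c ^+ 2 = 1 - s ^+ 2 by move: cs; lra.
apply/eqP; rewrite -subr_eq0.
have H : 2 * z.1 * z.2 * (B * G + F * A) = 0 by rewrite e2 mulr0.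
apply/eqP; rewrite -H /G /F pE.
move: (z.1) (z.2) => x y; clear - c2E.
have -> : A * ((c * x + s * y) ^+ 2 - (c * y - s * x) ^+ 2) =
  A * ((c ^+ 2 - s ^+ 2) * (x ^+ 2 - y ^+ 2) + 4 * s * c * x * y) by ring.
have -> : A * ((c * x + - s * y) ^+ 2 - (c * y - - s * x) ^+ 2) =
  A * ((c ^+ 2 - s ^+ 2) * (x ^+ 2 - y ^+ 2) - 4 * s * c * x * y) by ring.
have -> : B * (2 * (c * x + s * y) * (c * y - s * x)) =
  B * (2 * (c ^+ 2 - s ^+ 2) * x * y - 2 * s * c * (x ^+ 2 - y ^+ 2)) by ring.
have -> : B * (2 * (c * x + - s * y) * (c * y - - s * x)) =
  B * (2 * (c ^+ 2 - s ^+ 2) * x * y + 2 * s * c * (x ^+ 2 - y ^+ 2)) by ring.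
by rewrite c2E; ring.
Qed.

Section approximate_eigenfunction.
Variables A B : R.
Let Q z := A * (z.1 ^+ 2 - z.2 ^+ 2) + B * (2 * z.1 * z.2).
Hypothesis QE : forall z,
  p * Q z + (a + q) * Q (rot c s z) + b * Q (rot c (- s) z) =
            Q z + w * (z.1 ^+ 2 - z.2 ^+ 2).
Let k := `|A| + `|B|.
Let D := 2 * k + 3.
Let h z := 1 + Q z.

Lemma corrector_norm_le z : `|Q z| <= k * sqnorm z.
Proof.
rewrite /Q /k [leRHS]mulrDl.
apply: (le_trans (ler_normD _ _)); rewrite !(normrM A) !(normrM B).
apply: lerD; rewrite ler_wpM2l//.
  by rewrite (le_trans (ler_normB _ _))// !ger0_norm ?sqr_ge0.
rewrite /sqnorm ler_norml; apply/andP; split.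
  by have := sqr_ge0 (z.1 + z.2); rewrite sqrrD; lra.
by have := sqr_ge0 (z.1 - z.2); rewrite sqrrB; lra.
Qed.

Lemma transfer_approximate_eigenfunction z :
  sqnorm z <= 1 -> k * sqnorm z <= 2^-1 ->
  `|T h z - expR (- (w * sqnorm z)) * h z| <= D * sqnorm z ^+ 2.
Proof.
set r := sqnorm z => r1 kr.
have r0 : 0 <= r := sqnorm_ge0 z.
have [w0 w4] := w_bounds.
have k0 : 0 <= k by rewrite addr_ge0.
have Qz := corrector_norm_le z; rewrite -/r in Qz.
have Qr : `|Q (rot c s z)| <= k * r.
  by have := corrector_norm_le (rot c s z); rewrite sqnorm_rot.
have [E0 E1] := expRN_quadratic (mulr_ge0 (ltW w0) r0).
set E := expR _ in E0 E1 *.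
pose C := cos z.1.
have x2 : z.1 ^+ 2 <= r by rewrite /r /sqnorm lerDl sqr_ge0.
have x1 : `|z.1| <= 1.
  by rewrite -(@expr_le1 _ 2)// real_normK ?num_real// (le_trans x2).
have C1 := cos_le1 z.1; have C2 := cos_ge_quadratic z.1.
have C4 := cos_le_quartic x1.
have x4 : z.1 ^+ 4 <= r ^+ 2.
  by rewrite (exprM _ 2 2) lerXn2r ?nnegrE ?sqr_ge0.
rewrite -/C in C1 C2 C4.
(* The second-order terms cancel by [QE]. The four terms left are of fourth order in the frequency,
   and their bounds [1], [k], [2], [k] times [r ^ 2] add up to [D]. *)
have -> : T h z - E * h z =
  (p + q) * (C - (1 - z.1 ^+ 2 / 2)) + (C - 1) * (p * Q z + q * Q (rot c s z)) -
  (E - (1 - w * r)) * h z + w * r * Q z.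
  rewrite /transfer -/C /h.
  have -> : p * C * (1 + Q z) + (a + q * C) * (1 + Q (rot c s z)) +
     b * (1 + Q (rot c (- s) z)) = (p + q + a + b) + (p + q) * (C - 1) +
     (C - 1) * (p * Q z + q * Q (rot c s z)) +
     (p * Q z + (a + q) * Q (rot c s z) + b * Q (rot c (- s) z)) by ring.
  rewrite QE pqab /w.
  by rewrite /r /sqnorm; field.
have b1 : `|(p + q) * (C - (1 - z.1 ^+ 2 / 2))| <= r ^+ 2.
  have p1 : p + q <= 1 by move: a0 b0 pqab; lra.
  rewrite normrM (gtr0_norm pq0) ger0_norm ?subr_ge0//.
  rewrite -[leRHS]mul1r ler_pM ?(ltW pq0)//; last by lra.
  by rewrite subr_ge0.
have b2 : `|(C - 1) * (p * Q z + q * Q (rot c s z))| <= k * r ^+ 2.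
  rewrite normrM expr2 mulrA (mulrC _ r).
  apply: ler_pM => //; first by rewrite ler_norml; lra.
  rewrite (le_trans (ler_normD _ _))// !normrM (ger0_norm p0) (ger0_norm q0).
  apply: (@le_trans _ _ (p * (k * r) + q * (k * r))).
    by apply: lerD; apply: ler_wpM2l.
  rewrite -mulrDl -[leRHS]mul1r ler_wpM2r ?mulr_ge0//.
  by move: a0 b0 pqab; lra.
have Qh : `|Q z| <= 2^-1 by apply: le_trans Qz _.
have b3 : `|(E - (1 - w * r)) * h z| <= 2 * r ^+ 2.
  rewrite normrM ger0_norm// [leRHS]mulrC ler_pM//.
    rewrite (le_trans E1)// exprMn ler_piMl ?sqr_ge0//.
    by rewrite expr_le1// ?ltW//; lra.
  by rewrite /h (le_trans (ler_normD _ _))// normr1; lra.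
have b4 : `|w * r * Q z| <= k * r ^+ 2.
  rewrite (normrM (w * r)) (normrM w) (gtr0_norm w0) (ger0_norm r0) -mulrA.
  apply: (@le_trans _ _ (1 * (r * (k * r)))).
    apply: ler_pM => //; rewrite ?mulr_ge0//; [exact: ltW|lra|].
    by rewrite ler_wpM2l.
  by rewrite mul1r expr2 mulrCA.
rewrite /D.
apply: (le_trans (ler_normD _ _)).
have := ler_normB ((p + q) * (C - (1 - z.1 ^+ 2 / 2)) +
  (C - 1) * (p * Q z + q * Q (rot c s z))) ((E - (1 - w * r)) * h z).
have := ler_normD ((p + q) * (C - (1 - z.1 ^+ 2 / 2)))
  ((C - 1) * (p * Q z + q * Q (rot c s z))).
lra.
Qed.

(** [1 + Q] lies in [[1 / 2, 3 / 2]] and is both an approximate eigenfunction for the Gaussian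
    factor and a supersolution for the factor [1 - w r / 2]. So the [n] errors of size [D r ^ 2] add
    up without growing, and the initial mismatch is [Q] itself. The last hypothesis keeps the error
    terms below half of the damping. *)
Lemma char_walk_near_gaussian n z :
  sqnorm z <= 1 -> k * sqnorm z <= 2^-1 -> (1 + 2 * D) * sqnorm z <= w / 2 ->
  `|phi n z - expR (- (w * sqnorm z)) ^+ n| <=
    (4 * k * sqnorm z + 6 * D * n%:R * sqnorm z ^+ 2) *
      (1 - w * sqnorm z / 2) ^+ n.
Proof.
set r := sqnorm z => r1 kr Dr.
have r0 : 0 <= r := sqnorm_ge0 z.
have [w0 w4] := w_bounds.
have k0 : 0 <= k by rewrite addr_ge0.
have D0 : 0 <= D by rewrite /D; lra.
have wr0 : 0 <= w * r by rewrite mulr_ge0// ltW.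
have wr1 : w * r <= 4^-1.
  by rewrite -[leRHS]mulr1 ler_pM// ltW.
have [E0 E1] := expRN_quadratic wr0.
set E := expR _ in E0 E1 *; set m := 1 - w * r / 2.
have m12 : 2^-1 <= m by rewrite /m; lra.
have Em : E <= m.
  have : (w * r) ^+ 2 <= w * r * 4^-1 by rewrite expr2 ler_wpM2l.
  rewrite /m; lra.
have Ege0 : 0 <= E by exact: expR_ge0.
have hb z' : sqnorm z' = r -> 2^-1 <= h z' /\ h z' <= 3 / 2.
  move=> zr; have := corrector_norm_le z'; rewrite zr => H.
  have := le_trans H kr; rewrite ler_norml /h; lra.
have hT z' : sqnorm z' = r -> `|T h z' - E * h z'| <= D * r ^+ 2.
  move=> zr; have := @transfer_approximate_eigenfunction z'.
  by rewrite zr; apply.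
have hTm z' : sqnorm z' = r -> T h z' <= m * h z'.
  move=> zr; have := hT z' zr; rewrite ler_norml => /andP[_].
  have [h1 h2] := hb z' zr => H.
  have e2 : E * h z' <= (1 - w * r + (w * r) ^+ 2) * h z'.
    by rewrite ler_wpM2r//; lra.
  have e3 : D * r ^+ 2 <= 2 * D * r ^+ 2 * h z'.
    have : 0 <= D * r ^+ 2 by rewrite mulr_ge0// sqr_ge0.
    have -> : 2 * D * r ^+ 2 * h z' = D * r ^+ 2 * (2 * h z') by ring.
    by move=> u0; rewrite ler_peMr//; lra.
  have e4 : (1 - w * r + (w * r) ^+ 2 + 2 * D * r ^+ 2) * h z' <= m * h z'.
    rewrite ler_wpM2r//; first lra.
    rewrite /m.
    have : (w * r) ^+ 2 <= r ^+ 2.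
      by rewrite lerXn2r ?nnegrE// -[leRHS]mul1r ler_wpM2r//; lra.
    have := ler_wpM2r r0 Dr; lra.
  lra.
(* The factors 2 and 4 pay for writing the errors as multiples of [h] and of [m * h], where [m] and
   [h] are at least 1/2. *)
have He n' : forall z', sqnorm z' = r -> `|phi n' z' - E ^+ n' * h z'| <=
    (2 * k * r + n'%:R * (4 * D * r ^+ 2)) * m ^+ n' * h z'.
  elim: n' => [|n' IH] z' zr; have [h1 h2] := hb z' zr.
    rewrite /= !expr0 mul1r mul0r addr0 mulr1 /h opprD addrA subrr add0r normrN.
    have := corrector_norm_le z'; rewrite zr => /le_trans; apply.
    have kr0 : 0 <= k * r by rewrite mulr_ge0.
    rewrite -/(h z'); have := ler_wpM2l kr0 h1; lra.
  have -> : phi n'.+1 z' - E ^+ n'.+1 * h z' =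
     T (fun z => phi n' z - E ^+ n' * h z) z' + E ^+ n' * (T h z' - E * h z').
    by rewrite [phi _]/= /transfer exprS; ring.
  pose K := (2 * k * r + n'%:R * (4 * D * r ^+ 2)) * m ^+ n'.
  have K0 : 0 <= K.
    by rewrite mulr_ge0 ?addr_ge0 ?exprn_ge0 ?mulr_ge0 ?sqr_ge0//; lra.
  have t1 : `|T (fun z => phi n' z - E ^+ n' * h z) z'| <= K * (m * h z').
    have := @transfer_norm_le _ p q a b c s p0 q0 a0 b0
      (fun z => phi n' z - E ^+ n' * h z) (fun z => K * h z) z'.
    have z1 : sqnorm (rot c s z') = r by rewrite sqnorm_rot.
    have z2 : sqnorm (rot c (- s) z') = r by rewrite sqnorm_rot ?sqrrN.
    move=> /(_ (IH _ zr) (IH _ z1) (IH _ z2)) /le_trans; apply.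
    have c0 : 0 <= cos z'.1.
      have := cos_ge_quadratic z'.1.
      have : z'.1 ^+ 2 <= r by rewrite -zr lerDl sqr_ge0.
      lra.
    rewrite ger0_norm//.
    apply: le_trans (ler_wpM2l K0 (hTm _ zr)).
    by rewrite /transfer le_eqVlt; apply/orP; left; apply/eqP; ring.
  have t2 : `|E ^+ n' * (T h z' - E * h z')| <= m ^+ n' * (m * h z' * (4 * D * r ^+ 2)).
    rewrite normrM ger0_norm ?exprn_ge0//; apply: ler_pM => //.
    - exact: exprn_ge0.
    - by rewrite lerXn2r ?nnegrE//; lra.
    apply: (le_trans (hT _ zr)).
    have u0 : 0 <= D * r ^+ 2 by rewrite mulr_ge0// sqr_ge0.
    have : 2^-1 * 2^-1 <= m * h z' by apply: ler_pM.
    by move=> /(ler_wpM2l u0); lra.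
  apply: (le_trans (ler_normD _ _)).
  apply: (le_trans (lerD t1 t2)).
  rewrite /K (exprSr m n') -[n'.+1%:R]natr1.
  by rewrite le_eqVlt; apply/orP; left; apply/eqP; ring.
have -> : phi n z - E ^+ n = (phi n z - E ^+ n * h z) + E ^+ n * Q z.
  by rewrite /h; ring.
apply: (le_trans (ler_normD _ _)).
have [h1 h2] := hb z erefl.
have q1 : `|E ^+ n * Q z| <= m ^+ n * (k * r).
  rewrite normrM ger0_norm ?exprn_ge0//; apply: ler_pM => //.
  - exact: exprn_ge0.
  - by rewrite lerXn2r ?nnegrE//; lra.
  exact: corrector_norm_le.
apply: (le_trans (lerD (He n z erefl) q1)).
have m0 : 0 <= m ^+ n by rewrite exprn_ge0//; lra.
have K0 : 0 <= (2 * k * r + n%:R * (4 * D * r ^+ 2)) * m ^+ n.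
  by rewrite mulr_ge0 ?addr_ge0 ?mulr_ge0 ?sqr_ge0//; lra.
apply: (le_trans (lerD (ler_wpM2l K0 h2) (lexx _))).
by rewrite le_eqVlt; apply/orP; left; apply/eqP; field.
Qed.

End approximate_eigenfunction.

(** In the variable [v = n * sqnorm z] the previous error is [O(v + v ^ 2) / n] times
    [exp(- w v / 2)]; half of the exponent absorbs the powers of [v]. *)
Lemma char_walk_low_frequency : exists xi K : R, [/\ 0 < xi, 0 < K &
  forall n z, (0 < n)%N -> sqnorm z <= xi ->
  `|phi n z - expR (- (w * n%:R * sqnorm z))| <=
    K / n%:R * expR (- (w / 4 * n%:R * sqnorm z))].
Proof.
have [A [B QE]] := exists_corrector.
have [w0 w4] := w_bounds.
pose k := `|A| + `|B|; pose D := 2 * k + 3.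
have k0 : 0 <= k by rewrite addr_ge0.
have D0 : 0 < D by rewrite /D; lra.
pose xi := Num.min 1 (Num.min ((2 * (1 + k))^-1) (w / (2 * (1 + 2 * D)))).
have xi0 : 0 < xi.
  rewrite !lt_min ltr01 invr_gt0 divr_gt0//=; last by lra.
  by rewrite andbT; lra.
exists xi, (16 * k / w + 6 * D * (8 / w) ^+ 2); split => //.
  apply: ltr_wpDl; last by rewrite mulr_gt0 ?exprn_gt0 ?divr_gt0// mulr_gt0.
  by apply: divr_ge0; [rewrite mulr_ge0|exact: ltW].
move=> n z n0; rewrite !le_min => /and3P[z1 z2 z3].
set r := sqnorm z in z1 z2 z3 *.
have r0 : 0 <= r := sqnorm_ge0 z.
have nn0 : 0 < n%:R :> R by rewrite ltr0n.
have := @char_walk_near_gaussian A B QE n z z1.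
rewrite -/k -/D -/r.
have c1 : k * r <= 2^-1.
  apply: (@le_trans _ _ ((1 + k) * (2 * (1 + k))^-1)).
    by apply: ler_pM => //; lra.
  by rewrite invfM mulrCA divff ?mulr1// gt_eqF//; lra.
have c2 : (1 + 2 * D) * r <= w / 2.
  move: z3; rewrite invfM mulrA ler_pdivlMr; last by lra.
  by rewrite mulrC.
move=> /(_ c1 c2).
have -> : expR (- (w * r)) ^+ n = expR (- (w * n%:R * r)).
  by rewrite -expRM_natl mulrN mulrCA mulrA.
move=> /le_trans; apply.
set v := n%:R * r.
have v0 : 0 <= v by rewrite mulr_ge0// ltW.
have e1 : (1 - w * r / 2) ^+ n <= expR (- (w / 2 * v)).
  have -> : - (w / 2 * v) = n%:R * - (w * r / 2) by rewrite /v; field.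
  rewrite expRM_natl lerXn2r ?nnegrE ?expR_ge0 ?expR_ge1Dx//.
  have : w * r <= 4^-1 * 1 by rewrite ler_pM// ltW.
  lra.
have e2 : expR (- (w / 2 * v)) = expR (- (w / 8 * v)) ^+ 2 * expR (- (w / 4 * v)).
  by rewrite -expRM_natl -expRD; congr expR; field.
have f1 : v * expR (- (w / 8 * v)) <= 8 / w.
  by have := @mulr_expRN_le _ v (w / 8) v0; rewrite invf_div; apply; lra.
have g0 := expR_ge0 (- (w / 8 * v)).
have g1 : expR (- (w / 8 * v)) <= 1.
  by rewrite expR_le1 oppr_le0 mulr_ge0//; lra.
have f2 : v * expR (- (w / 4 * v)) <= 4 / w.
  by have := @mulr_expRN_le _ v (w / 4) v0; rewrite invf_div; apply; lra.
set g := expR (- (w / 8 * v)) in e2 f1 g0 g1.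
have -> : expR (- (w / 4 * n%:R * r)) = expR (- (w / 4 * v)).
  by rewrite /v mulrA.
set G := expR (- (w / 4 * v)) in e2 f2 *.
have G0 : 0 <= G := expR_ge0 _.
have gG : g ^+ 2 = G.
  by rewrite /g /G -expRM_natl; congr expR; field.
have rE : r = v / n%:R by rewrite /v mulrAC divff ?mul1r ?gt_eqF.
have -> : 4 * k * r + 6 * D * n%:R * r ^+ 2 = (4 * k * v + 6 * D * v ^+ 2) / n%:R.
  by rewrite rE; field; rewrite gt_eqF.
apply: (@le_trans _ _ ((4 * k * v + 6 * D * v ^+ 2) / n%:R * (g ^+ 2 * G))).
  rewrite -e2 ler_wpM2l//; apply: divr_ge0; last exact: ltW.
  apply: addr_ge0; apply: mulr_ge0; rewrite ?sqr_ge0 ?mulr_ge0//.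
  by rewrite ltW.
rewrite [leLHS](_ : _ = (4 * k * (v * g ^+ 2) + 6 * D * (v * g) ^+ 2) / n%:R * G); last by ring.
rewrite ler_wpM2r// ler_wpM2r ?invr_ge0 ?(ltW nn0)//.
apply: lerD.
  rewrite gG.
  have -> : 16 * k / w = 4 * k * (4 / w) by ring.
  by rewrite ler_wpM2l ?mulr_ge0.
have vg0 : 0 <= v * g by rewrite mulr_ge0.
rewrite ler_wpM2l//; first by rewrite mulr_ge0// ltW.
by rewrite lerXn2r// nnegrE (le_trans vg0).
Qed.

End low_frequency.

(** * Rotations of high frequencies *)

Section near_multiples_of_pi.
Variable R : realType.
Implicit Types x y : R.

Lemma norm_cosDpi_int (n : int) x : `|cos (x + n%:~R * pi)| = `|cos x|.
Proof.
have nat_case (k : nat) y : `|cos (y + k%:R * pi)| = `|cos y|.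
  by rewrite mulr_natl (alternatingn (@cosDpi R)) normrM normrX normrN1 expr1n mul1r.
case: n => k; first exact: nat_case.
rewrite NegzE mulrNz mulNr; apply/esym.
by have := nat_case k.+1 (x - k.+1%:R * pi); rewrite subrK.
Qed.

Lemma norm_cos_gt_near_pi (e : R) : 0 < e ->
  exists eps : R, [/\ 0 < eps, eps <= 1 &
    forall x, 1 - eps < `|cos x| -> exists n : int, `|x - n%:~R * pi| <= e].
Proof.
(* Below [pi / 2] the cosine is nonnegative, so that [eps <= 1], and it is decreasing, so that it
   can be inverted. *)
move=> e0; pose e1 := Num.min e (pi / 2).
have p2 := pi_gt0 R.
have e10 : 0 < e1 by rewrite lt_min e0 divr_gt0.
have e1p : e1 <= pi / 2 by rewrite ge_min lexx orbT.
have c0 : 0 <= cos e1 by apply: cos_ge0_pihalf; rewrite e1p andbT; lra.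
have c1 : cos e1 < 1.
  by rewrite -cos0 ltr_cos// in_itv/=; lra.
exists (1 - cos e1); split; [lra|lra|] => x.
rewrite subKr => cx.
pose n := Num.floor (x / pi + 2^-1); exists n.
have /andP[n1 n2] := floor_itv (x / pi + 2^-1).
rewrite -/n in n1 n2.
have xE : x = x / pi * pi by rewrite divfK// gt_eqF.
have m1 := ler_wpM2r (ltW p2) n1.
have m2 : (x / pi + 2^-1) * pi <= (n + 1)%:~R * pi by rewrite ler_wpM2r// ltW.
rewrite intrD mulrDl in m2.
rewrite mulrDl -xE in m1 m2.
set y := x - n%:~R * pi.
have yp : `|y| <= pi / 2 by rewrite ler_norml /y; lra.
have cy : `|cos x| = cos `|y|.
  have -> : x = y + n%:~R * pi by rewrite subrK.
  rewrite norm_cosDpi_int ger0_norm ?cos_norm//.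
  by apply: cos_ge0_pihalf; rewrite -ler_norml.
rewrite cy in cx.
apply: (@le_trans _ _ e1); last by rewrite ge_min lexx.
rewrite leNgt; apply/negP => ye.
have i1 : e1 \in `[0, pi] by rewrite in_itv/=; lra.
have i2 : `|y| \in `[0, pi] by rewrite in_itv/= normr_ge0/=; lra.
by move: cx; rewrite -(ltr_cos i1 i2) in ye; lra.
Qed.

End near_multiples_of_pi.

Section arithmetic_of_rotation.
Variable R : realType.
Variables (c s : R).
Hypothesis cs : c ^+ 2 + s ^+ 2 = 1.
Hypothesis cQ : exists r : rat, c = ratr r.
Hypothesis c2 : forall k : int, c <> k%:~R / 2.
Implicit Types z : plane R.

Lemma sin_neq0_of_cos : s != 0.
Proof.
apply/eqP => s0; move: cs; rewrite s0 expr0n addr0 => /eqP.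
rewrite sqrf_eq1 => /orP[/eqP c1|/eqP c1].
  by apply: (c2 (k := 2)); rewrite c1 divff.
by apply: (c2 (k := -2)); rewrite c1 mulrNz mulNr divff.
Qed.

Lemma sqnorm_iter_rot n z : sqnorm (iter n (rot c s) z) = sqnorm z.
Proof. by elim: n => //= n IH; rewrite sqnorm_rot. Qed.

(** Cayley-Hamilton for a matrix of trace [2 c] and determinant 1. *)
Lemma iter_rot_recurrence n z :
  (iter n.+2 (rot c s) z).1 + (iter n (rot c s) z).1 =
  2 * c * (iter n.+1 (rot c s) z).1.
Proof.
rewrite !iterS; move: (iter n _ z) => [x y]; rewrite /rot /=.
by apply/eqP; rewrite -subr_eq0 [X in X == 0](_ : _ = (1 - (c ^+ 2 + s ^+ 2)) * x);
  [rewrite cs subrr mul0r|ring].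
Qed.

(* Descent: the nearest integers to [x_j / pi] satisfy the recurrence of the
   [x_j] exactly, so on a long window they are divisible by a high power of the
   denominator of [2 c], hence vanish. *)
Lemma exists_rotation_small_cos (xi : R) : 0 < xi ->
  exists eps : R, [/\ 0 < eps, eps <= 1 &
    forall (m : nat) z, xi <= sqnorm z -> sqnorm z <= (2 ^+ m) ^+ 2 ->
    exists j, (j < m.*2.+2)%N /\ `|cos (iter j (rot c s) z).1| <= 1 - eps].
Proof.
move=> xi0; have s0 := sin_neq0_of_cos.
have [r cr] := cQ.
pose A := numq (2 * r); pose B := denq (2 * r).
have B0 : 0 < B := denq_gt0 _.
have cAB : 2 * c * B%:~R = A%:~R.
  have := congr1 (ratr : rat -> R) (numqE (2 * r)).
  by rewrite -/A -/B !rmorphM/= !ratr_int -cr rmorph_nat => <-.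
have B2 : (2 <= B)%R.
  rewrite -[2]/(1 + 1)%R lezD1 lt_neqAle -gtz0_ge1 B0 andbT; apply/eqP => B1.
  apply: (c2 (k := A)); rewrite -cAB -B1 mulr1z mulr1 mulrC mulKf//.
have s20 : 0 < s ^+ 2 by rewrite exprn_even_gt0.
pose N : R := 2 * B%:~R + `|A%:~R|.
have N0 : 0 < N by rewrite ltr_pwDl// mulr_gt0// ltr0z.
pose W := 1 + 4 / s ^+ 2.
have W0 : 0 < W by rewrite ltr_pwDl// divr_ge0// ltW.
(* With [e * N <= 1 < pi], the integer defect of the recurrence is less than 1 in modulus, hence
   zero. With [e * W < xi], two consecutive coordinates below [e] contradict [xi <= sqnorm z]. The
   bound 1/2 serves the size estimates. *)
pose e := Num.min (2^-1) (Num.min N^-1 (xi / (2 * W))).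
have e0 : 0 < e by rewrite !lt_min !invr_gt0 N0 divr_gt0 ?mulr_gt0// ltr0n.
have e1 : e <= 2^-1 by rewrite ge_min lexx.
have eN : e * N <= 1.
  by rewrite -ler_pdivlMr// div1r !ge_min lexx orbT.
have eW : e * W < xi.
  rewrite -ltr_pdivlMr//; apply: (@le_lt_trans _ _ (xi / (2 * W))).
    by rewrite !ge_min lexx !orbT.
  rewrite ltr_pM2l// ltf_pV2 ?posrE ?mulr_gt0//; lra.
have [eps [eps0 eps1 epsP]] := norm_cos_gt_near_pi e0.
exists eps; split => // m z zxi zm.
apply: contrapT => /forallNP nex.
pose x j := (iter j (rot c s) z).1.
have [n nP] : {n : nat -> int & forall j, (j < m.*2.+2)%N ->
    `|x j - (n j)%:~R * pi| <= e}.
  apply: (@choice _ _ (fun j n => (j < m.*2.+2)%N -> `|x j - n%:~R * pi| <= e)).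
  move=> j; have [jm|jm] := boolP (j < m.*2.+2)%N; last by exists 0.
  have [|k kP] := epsP (x j); last by exists k.
  by rewrite ltNge; apply/negP => H; apply: (nex j).
have p2 := pi_ge2 R.
have rec j : (j.+2 < m.*2.+2)%N -> B * (n j.+2 + n j) = A * n j.+1.
  move=> jm; apply/eqP; rewrite -subr_eq0 -normr_le0 -ltzD1 add0r -(ltr_int R).
  have d2 := nP _ jm; have d1 := nP _ (ltnW jm).
  have d0 := nP _ (ltnW (ltnW jm)).
  rewrite intr_norm -(@ltr_pM2r _ pi) ?pi_gt0// mul1r.
  rewrite -[X in _ * X](@ger0_norm _ pi) ?pi_ge0// -normrM.
  have xr : B%:~R * (x j.+2 + x j) = A%:~R * x j.+1.
    by rewrite -cAB /x iter_rot_recurrence; ring.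
  have -> : (B * (n j.+2 + n j) - A * n j.+1)%:~R * pi =
     A%:~R * (x j.+1 - (n j.+1)%:~R * pi) -
     (B%:~R * (x j.+2 - (n j.+2)%:~R * pi) + B%:~R * (x j - (n j)%:~R * pi)).
    by rewrite !(intrB, intrM, intrD) [in RHS]mulrBr -xr; ring.
  apply: (@le_lt_trans _ _ (e * N)); last by lra.
  rewrite (le_trans (ler_normB _ _))//.
  rewrite (le_trans (lerD (lexx _) (ler_normD _ _)))// !normrM.
  have BR : 0 < (B%:~R : R) by rewrite ltr0z.
  rewrite (gtr0_norm BR) /N.
  have := ler_wpM2l (normr_ge0 (A%:~R : R)) d1.
  have := ler_wpM2l (ltW BR) d2; have := ler_wpM2l (ltW BR) d0.
  lra.
have cop : coprimez B A by rewrite coprimez_sym coprimezE coprime_num_den.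
(* Each further factor [B] costs one index at either end of the window, as [B] is coprime to [A]. Of
   the [2 m + 2] indices, [m] and [m + 1] are left after [m] rounds. *)
have dvd i : forall j, (i <= j)%N -> (j + i < m.*2.+2)%N -> (B ^+ i %| n j)%Z.
  elim: i => [|i IH] j ij jm; first by rewrite expr0 dvd1z.
  case: j => // j in ij jm *.
  have d1 : (B ^+ i %| n j)%Z.
    by apply: IH; clear - ij jm; lia.
  have d2 : (B ^+ i %| n j.+2)%Z.
    by apply: IH; clear - ij jm; lia.
  have rj : B * (n j.+2 + n j) = A * n j.+1.
    by apply: rec; clear - ij jm; lia.
  have : (B ^+ i.+1 %| A * n j.+1)%Z.
    by rewrite -rj exprS dvdz_mul// rpredD.
  by rewrite Gauss_dvdzr// coprimezXl.
(* A nonzero [n j] would have modulus at least [B ^ m >= 2 ^ m], which forces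
   [|x j| >= 2 * 2 ^ m - e] against [|x j| <= 2 ^ m]. *)
have small j : (m <= j)%N -> (j + m < m.*2.+2)%N -> `|x j| <= e.
  move=> mj jm.
  have dj := dvd m j mj jm.
  have jm2 : (j < m.*2.+2)%N by clear - mj jm; lia.
  have nj := nP j jm2.
  suff nj0 : n j = 0 by move: nj; rewrite nj0 mul0r subr0.
  apply/eqP; rewrite -normr_le0 leNgt; apply/negP => nj1.
  have xj : `|x j| <= 2 ^+ m.
    rewrite -(@ler_pXn2r _ 2) ?nnegrE ?exprn_ge0// real_normK ?num_real//.
    by rewrite (le_trans _ zm)// -(sqnorm_iter_rot j) lerDl sqr_ge0.
  have Bm : B ^+ m <= `|n j|.
    move: dj; rewrite dvdzE => /dvdn_leq; rewrite absz_gt0 -normr_gt0 nj1.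
    by move=> /(_ isT); rewrite -lez_nat !abszE normrX (gtr0_norm B0).
  have m2 : (2 : R) ^+ m <= `|n j|%:~R.
    apply: (@le_trans _ _ (B ^+ m)%:~R); last by rewrite ler_int.
    by rewrite rmorphXn/= lerXn2r ?nnegrE// ?ler0z ?(ltW B0)// -[2]/(2%:~R) ler_int.
  have : `|n j|%:~R * pi <= `|x j| + e.
    rewrite intr_norm -[X in _ * X](@ger0_norm _ pi) ?pi_ge0// -normrM.
    have -> : (n j)%:~R * pi = x j - (x j - (n j)%:~R * pi) by rewrite subKr.
    by rewrite (le_trans (ler_normB _ _))// lerD2l.
  have : 1 <= (2 : R) ^+ m by rewrite exprn_ege1// ler1n.
  have : (2 : R) ^+ m * 2 <= `|n j|%:~R * pi by apply: ler_pM.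
  lra.
(* Two consecutive small first coordinates [u] and [c * u + s * v] bound the whole vector [(u, v)],
   because [s] is nonzero. *)
have xm : `|x m| <= e by apply: small; clear; lia.
have xm1 : `|x m.+1| <= e by apply: small; clear; lia.
move: zxi; rewrite -(sqnorm_iter_rot m) leNgt => /negP; apply.
move: xm xm1; rewrite /x iterS; move: (iter m _ z) => [u v]; rewrite /rot /sqnorm /=.
move=> u1 v1.
have c1 : `|c| <= 1.
  by rewrite -(@expr_le1 _ 2)// real_normK ?num_real// -cs lerDl sqr_ge0.
have sv : `|s * v| <= 2 * e.
  have -> : s * v = (c * u + s * v) - c * u by ring.
  rewrite (le_trans (ler_normB _ _))// normrM.
  have := ler_pM (normr_ge0 c) (normr_ge0 u) c1 u1; lra.
have e2 : e ^+ 2 <= e by rewrite expr2 ler_piMl// ltW//; lra.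
have u2 : u ^+ 2 <= e.
  apply: le_trans e2.
  by rewrite -(real_normK (num_real u)) lerXn2r ?nnegrE// ltW.
have v2 : v ^+ 2 <= 4 / s ^+ 2 * e.
  rewrite mulrAC ler_pdivlMr// mulrC -exprMn -(real_normK (num_real (s * v))).
  apply: (@le_trans _ _ ((2 * e) ^+ 2)); first by rewrite lerXn2r ?nnegrE//; lra.
  rewrite exprMn; lra.
apply: le_lt_trans eW; rewrite /W; lra.
Qed.

End arithmetic_of_rotation.

(** * Gaussian integrals *)

Section integral_normal_prob.
Context {R : realType}.
Variables m s : R.
Local Notation mu := (@lebesgue_measure R).
Local Notation P := (normal_prob m s).

(** The Radon-Nikodym derivative agrees almost everywhere with the explicit density, since both have
    the same integral over every measurable set. *)
Lemma integral_normal_prob_integrable (f : measurableTypeR R -> \bar R) :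
  P.-integrable setT f ->
  (\int[P]_x f x = \int[mu]_x (f x * (normal_pdf m s x)%:E))%E.
Proof.
move=> intf.
rewrite -(Radon_Nikodym_change_of_variables (normal_prob_dominates m s))//=.
apply: ae_eq_integral => //.
- apply: emeasurable_funM => //; first exact: measurable_int intf.
  apply: (measurable_int mu).
  by apply: Radon_Nikodym_integrable; exact: normal_prob_dominates.
- apply: emeasurable_funM => //=; first exact: measurable_int intf.
  by apply/measurable_EFinP; exact: measurable_normal_pdf.
- apply: ae_eqe_mul2l => /=.
  rewrite Radon_NikodymE//=; first exact: normal_prob_dominates.
  move=> dom; case: cid => /= h [h1 h2 h3].
  apply: integral_ae_eq => //=.
  + by apply/measurable_EFinP; exact: measurable_normal_pdf.
  + by move=> E E01 mE; rewrite -h3.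
Qed.

Import HBNNSimple.

(** Monotone approximation by bounded simple functions; both sides may be infinite, so the identity
    can serve to prove integrability. *)
Lemma integral_normal_prob_ge0 (f : measurableTypeR R -> \bar R) :
  measurable_fun setT f -> (forall x, 0 <= f x)%E ->
  (\int[P]_x f x = \int[mu]_x (f x * (normal_pdf m s x)%:E))%E.
Proof.
move=> mf f0.
have pdf0 x : (0 <= (normal_pdf m s x)%:E)%E by rewrite lee_fin normal_pdf_ge0.
have mpdf : measurable_fun setT (fun x => (normal_pdf m s x)%:E).
  by apply/measurable_EFinP; exact: measurable_normal_pdf.
pose f_ := nnsfun_approx measurableT mf.
have mf_ n : measurable_fun setT (f_ n) by exact: measurable_funPT.
transitivity (lim (\int[P]_x (f_ n x)%:E @[n --> \oo])%E).
  rewrite -monotone_convergence//=.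
  - apply: eq_integral => ? /[!inE] xD; apply/esym/cvg_lim => //=.
    exact: cvg_nnsfun_approx.
  - by move=> n; apply/measurable_EFinP; exact: mf_.
  - by move=> n ? _; rewrite lee_fin.
  - by move=> ? _ ? ? mn; rewrite lee_fin; exact/lefP/nd_nnsfun_approx.
transitivity (lim (\int[mu]_x ((f_ n x)%:E * (normal_pdf m s x)%:E) @[n --> \oo])%E).
  apply: congr_lim; apply/funext => n /=.
  apply: integral_normal_prob_integrable.
  apply: measurable_bounded_integrable => //.
    exact: le_lt_trans (probability_le1 P measurableT) (ltry _).
  exact: simple_bounded.
rewrite -monotone_convergence//=.
- apply: eq_integral => x _; apply/cvg_lim => //; apply: cvgeZr => //.
  exact: cvg_nnsfun_approx.
- by move=> n; apply: emeasurable_funM => //; exact/measurable_EFinP/measurable_funTS.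
- by move=> n x _; rewrite mule_ge0// lee_fin.
- move=> x _ a b ab; rewrite lee_wpmul2r// lee_fin.
  exact/lefP/nd_nnsfun_approx.
Qed.

End integral_normal_prob.

Section integral_of_derivative.
Context {R : realType}.
Local Notation mu := (@lebesgue_measure R).

(** The fundamental theorem of calculus on growing symmetric intervals, and dominated convergence
    with [|f|] as dominating function. *)
Lemma integral_derivative_eq0 (F f : R -> R) :
  (forall x : R, is_derive x 1 F (f x)) -> continuous f ->
  mu.-integrable setT (EFin \o f) ->
  F n%:R @[n --> \oo] --> (0 : R) -> F (- n%:R) @[n --> \oo] --> (0 : R) ->
  (\int[mu]_x (f x)%:E = 0)%E.
Proof.
move=> Ff cf intf F1 F2.
have mf : measurable_fun setT f by exact: continuous_measurable_fun.
pose I n := `[- n.+1%:R, n.+1%:R]%classic : set R.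
pose f_ n : R -> \bar R := (EFin \o f) \_ (I n).
have dF x : derivable F x 1 by apply: ex_derive.
have cF : continuous F.
  by move=> x; apply/differentiable_continuous/derivable1_diffP.
have ftc n : (\int[mu]_x f_ n x = (F n.+1%:R - F (- n.+1%:R))%:E)%E.
  rewrite -integral_mkcond EFinB; apply: continuous_FTC2.
  - by rewrite (@lt_trans _ _ 0) ?oppr_lt0.
  - exact: continuous_subspaceT.
  - split => //.
      by apply: cvg_at_right_filter; exact: cF.
    by apply: cvg_at_left_filter; exact: cF.
  - by move=> x _; rewrite derive1E; apply: derive_val.
have lim0 : (F n.+1%:R - F (- n.+1%:R))%:E @[n --> \oo] --> 0%:E.
  apply: cvg_EFin; first exact: nearW.
  rewrite -[X in _ --> X](subr0 0); apply: cvgB.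
    by rewrite -(cvg_shiftS (fun n => F n%:R)) in F1.
  by rewrite -(cvg_shiftS (fun n => F (- n%:R))) in F2.
have lim1 : [sequence (\int[mu]_x f_ n x)%E]_n @ \oo --> (\int[mu]_x (f x)%:E)%E.
  have [|||||] // := @dominated_convergence _ _ _ mu setT measurableT f_
    (EFin \o f) (abse \o (EFin \o f)).
  - move=> n; apply/(measurable_restrictT _ _).1; first exact: measurable_itv.
    by apply/measurable_EFinP; exact: measurable_funTS.
  - exact/measurable_EFinP.
  - apply: aeW => x _; apply: cvg_near_cst; near=> n.
    suff xI : x \in I n by rewrite /f_ patchE xI.
    rewrite inE /I /= in_itv/= -ler_norml.
    rewrite (@le_trans _ _ n%:R)// ?ler_nat//.
    by near: n; exact: nbhs_infty_ger.
  - exact: integrable_abse.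
  - by apply: aeW => x n _; rewrite /f_ patchE; case: ifP => _; rewrite /= ?normr0 lee_fin.
have fE : [sequence (\int[mu]_x f_ n x)%E]_n = (fun n => (F n.+1%:R - F (- n.+1%:R))%:E).
  by apply/funext => n; exact: ftc.
rewrite fE in lim1.
exact: (cvg_unique _ lim1 lim0).
Unshelve. all: by end_near. Qed.

End integral_of_derivative.

Section normal_integrals.
Context {R : realType}.
Local Notation mu := (@lebesgue_measure R).

(* The factor turns the density of variance [s ^ 2] into a multiple of the
   density of variance [(s * k) ^ 2]. *)
Lemma integral_normal_expR_sqr (m s k : R) : 0 < s -> 0 < k ->
  (\int[normal_prob m s]_x
     (expR ((1 - k ^- 2) / (2 * s ^+ 2) * (x - m) ^+ 2))%:E = k%:E)%E.
Proof.
move=> s0 k0.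
have sk0 : s * k != 0 by rewrite mulf_neq0 ?gt_eqF.
rewrite integral_normal_prob_ge0//; last first.
- apply/measurable_EFinP; apply: measurableT_comp => //.
  apply: measurable_funM => //; apply: measurable_funX.
  exact: measurable_funB.
transitivity (\int[mu]_x (k%:E * (normal_pdf m (s * k) x)%:E))%E.
  apply: eq_integral => x _; rewrite -!EFinM !normal_pdfE ?gt_eqF//; last exact: mulr_gt0.
  congr EFin; rewrite [LHS]mulrCA.
  have -> : normal_peak s = k * normal_peak (s * k).
    rewrite /normal_peak.
    rewrite [in RHS](_ : (s * k) ^+ 2 * pi *+ 2 = k ^+ 2 * (s ^+ 2 * pi *+ 2)); last by ring.
    rewrite sqrtrM ?sqr_ge0// sqrtr_sqr gtr0_norm// invfM.
    by rewrite mulrA divff ?mul1r ?gt_eqF.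
  rewrite -[LHS]mulrA; congr (_ * (_ * _)); rewrite /normal_fun -expRD; congr expR.
  rewrite exprMn; field.
  by rewrite !gt_eqF.
rewrite ge0_integralZl//=.
- by rewrite integral_normal_pdf mule1.
- by apply/measurable_EFinP; exact: measurable_normal_pdf.
- by move=> x _; rewrite lee_fin normal_pdf_ge0.
- by rewrite lee_fin ltW.
Qed.

End normal_integrals.

Lemma bounded_integrable {R : realType} d (T : measurableType d)
    (P : probability T R) (f : T -> R) (M : R) :
  measurable_fun setT f -> (forall x, `|f x| <= M) ->
  P.-integrable setT (fun x => (f x)%:E).
Proof.
move=> mf fM; apply: (measurable_bounded_integrable (f := f)) => //.
  exact: le_lt_trans (probability_le1 P measurableT) (ltry _).
exists M; split; first exact: num_real.
by move=> N MN x _ /=; rewrite (le_trans (fM x))// ltW.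
Qed.

Lemma cvg0_of_le_inv {R : realType} (u : nat -> R) (C : R) :
  (forall n, (0 < n)%N -> `|u n| <= C / n%:R) -> u @ \oo --> (0 : R).
Proof.
move=> uC; apply/cvgr0Pnorm_le => e e0; near=> n.
have n0 : (0 < n)%N by near: n; exact: nbhs_infty_gt.
apply: (le_trans (uC n n0)); rewrite ler_pdivrMr ?ltr0n//.
rewrite -ler_pdivrMl// mulrC.
by near: n; exact: nbhs_infty_ger.
Unshelve. all: by end_near. Qed.

Section normal_characteristic_function.
Context {R : realType}.
Variable s : R.
Hypothesis s0 : 0 < s.
Local Notation mR := (measurableTypeR R).
Local Notation mu := (@lebesgue_measure R).
Local Notation P := (normal_prob (0 : R) s).
Local Notation g := (normal_pdf (0 : R) s).
Implicit Types t b : R.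

Let measurable_cos t b : measurable_fun setT (fun x : mR => cos (t * x + b)).
Proof.
apply: measurableT_comp; first by apply: continuous_measurable_fun; exact: continuous_cos.
by apply: measurable_funD => //; apply: measurable_funM.
Qed.

Let measurable_sin t b : measurable_fun setT (fun x : mR => sin (t * x + b)).
Proof.
apply: measurableT_comp; first by apply: continuous_measurable_fun; exact: continuous_sin.
by apply: measurable_funD => //; apply: measurable_funM.
Qed.

Let integrable_cos t b : P.-integrable setT (fun x : mR => (cos (t * x + b))%:E).
Proof.
by apply: (@bounded_integrable _ _ _ _ _ 1) => // x; exact: cos_max.
Qed.

(** [|x|] is at most [s * exp(3 x ^ 2 / (8 s ^ 2))], whose integral is the case [k = 2] of
    [integral_normal_expR_sqr]. *)
Lemma integrable_norm_normal : P.-integrable setT (fun x : mR => `|x|%:E).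
Proof.
apply/integrableP; split.
  by apply/measurable_EFinP; exact: normr_measurable.
have := @integral_normal_expR_sqr R 0 s 2 s0 (ltr0Sn _ _) => H.
apply: (@le_lt_trans _ _ (\int[P]_x (s%:E * (expR ((1 - 2 ^- 2) / (2 * s ^+ 2) * (x - 0) ^+ 2))%:E))%E); last first.
  rewrite ge0_integralZl//=.
  - by rewrite H -EFinM ltry.
  - apply/measurable_EFinP; apply: measurableT_comp => //.
    by apply: measurable_funM => //; apply: measurable_funX; exact: measurable_funB.
  - by rewrite lee_fin ltW.
apply: ge0_le_integral => //=.
- apply/measurable_EFinP; apply: (measurableT_comp (@normr_measurable R setT)).
  exact: normr_measurable.
- apply: emeasurable_funM => //.
  apply/measurable_EFinP; apply: measurableT_comp => //.
  by apply: measurable_funM => //; apply: measurable_funX; exact: measurable_funB.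
move=> x _; rewrite -EFinM lee_fin normr_id subr0.
have -> : (1 - 2 ^- 2) / (2 * s ^+ 2) * x ^+ 2 = 3 / 8 * (`|x| / s) ^+ 2.
  by rewrite exprMn real_normK ?num_real//; field; rewrite gt_eqF.
have -> : `|x| = s * (`|x| / s) by rewrite mulrCA divff ?mulr1// gt_eqF.
rewrite ler_pM2l//.
have -> : s * (`|x| / s) / s = `|x| / s by field; rewrite gt_eqF.
set u := `|x| / s.
have := expR_ge1Dx (3 / 8 * u ^+ 2); have := sqr_ge0 (u / 2 - 1).
have -> : (u / 2 - 1) ^+ 2 = u ^+ 2 / 4 - u + 1 by field.
have := sqr_ge0 u; lra.
Qed.

Let integrable_stein t b : P.-integrable setT
  (fun x : mR => (t * cos (t * x + b) - s ^- 2 * (x * sin (t * x + b)))%:E).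
Proof.
have h1 : P.-integrable setT (fun x : mR => (t * cos (t * x + b))%:E).
  apply: (@bounded_integrable _ _ _ _ _ `|t|) => [|x].
    exact: measurable_funM.
  by rewrite normrM ler_piMr// cos_max.
have h2 : P.-integrable setT (fun x : mR => (x * sin (t * x + b))%:E).
  apply: le_integrable integrable_norm_normal => //.
    by apply/measurable_EFinP; apply: measurable_funM.
  move=> x _ /=; rewrite lee_fin normr_id normrM.
  by rewrite ler_piMr// sin_max.
exact: (integrableB measurableT h1 (integrableZl measurableT (s ^- 2) h2)).
Qed.

Let integrable_normal_mul (w : R -> R) :
  P.-integrable setT (EFin \o w) -> mu.-integrable setT (EFin \o (w \* g)).
Proof.
move=> /integrableP[mw fw].
have {}mw : measurable_fun setT w by exact/measurable_EFinP.
apply/integrableP; split.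
  apply/measurable_EFinP; apply: measurable_funM => //.
  exact: measurable_normal_pdf.
move: fw; rewrite integral_normal_prob_ge0//; last first.
  by apply/measurable_EFinP; exact: measurableT_comp.
congr (_ < _)%E; apply: eq_integral => x _ /=.
by rewrite normrM (ger0_norm (normal_pdf_ge0 _ _ _)).
Qed.

Lemma is_derive_normal_pdf (x : R) : is_derive x 1 g (- (s ^- 2 * x) * g x).
Proof.
have s1 : s != 0 by rewrite gt_eqF.
rewrite normal_pdfE//; rewrite /normal_fun.
apply: is_derive_eq.
rewrite /GRing.scale /=; field.
by rewrite gt_eqF.
Qed.

(* Stein's identity turns the derivative of the characteristic function in [t]
   into a multiple of the characteristic function. *)
Let stein t b :
  (\int[P]_x (t * cos (t * x + b) - s ^- 2 * (x * sin (t * x + b)))%:E = 0)%E.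
Proof.
rewrite integral_normal_prob_integrable//.
pose w x := t * cos (t * x + b) - s ^- 2 * (x * sin (t * x + b)).
have dF (x : R) : is_derive x 1 (fun x => sin (t * x + b) * g x) ((w \* g) x).
  have dg := is_derive_normal_pdf x.
  apply: is_derive_eq; rewrite /GRing.scale /= /w; ring.
have gle (x : R) : `|x| >= 1 -> `|sin (t * x + b) * g x| <= normal_peak s * (2 * s ^+ 2) / `|x|.
  move=> x1; rewrite normrM normal_pdfE ?gt_eqF//.
  rewrite (@ger0_norm _ (_ * _)); last by rewrite mulr_ge0 ?normal_peak_ge0 ?normal_fun_ge0.
  rewrite -[leRHS]mul1r ler_pM ?sin_max ?mulr_ge0 ?normal_peak_ge0 ?normal_fun_ge0//.
  rewrite -mulrA ler_wpM2l ?normal_peak_ge0//.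
  rewrite /normal_fun subr0 mulNr expRN.
  rewrite -[leRHS]invrK lef_pV2 ?posrE ?expR_gt0 ?invr_gt0 ?divr_gt0 ?mulr_gt0 ?exprn_gt0//; last by lra.
  rewrite invf_div.
  apply: (@le_trans _ _ (x ^+ 2 / (s ^+ 2 *+ 2))); last first.
    by apply: le_trans (expR_ge1Dx _); rewrite lerDr.
  rewrite mulr_natl ler_wpM2r//; first by rewrite invr_ge0 mulrn_wge0// sqr_ge0.
  by rewrite -real_normK ?num_real// expr2 ler_peMl//; lra.
have cg : continuous g by apply: continuous_normal_pdf; rewrite gt_eqF.
have cl : continuous (fun x : R => t * x + b).
  by move=> x; apply: continuousD; [apply: mulrl_continuous|exact: cst_continuous].
apply: (integral_derivative_eq0 dF).
- move=> x; apply: (continuousM _ (cg x)).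
  apply: continuousB.
    by apply: continuousM; [exact: cst_continuous|
      apply: continuous_comp; [exact: cl|exact: continuous_cos]].
  apply: continuousM; first exact: cst_continuous.
  by apply: continuousM => //; apply: continuous_comp; [exact: cl|exact: continuous_sin].
- by apply: integrable_normal_mul; exact: integrable_stein.
- apply: (@cvg0_of_le_inv _ _ (normal_peak s * (2 * s ^+ 2))) => n n0.
  have n1 : 1 <= `|n%:R| :> R by rewrite normr_nat ler1n.
  by have := gle _ n1; rewrite normr_nat.
- apply: (@cvg0_of_le_inv _ _ (normal_peak s * (2 * s ^+ 2))) => n n0.
  have n1 : 1 <= `|- n%:R| :> R by rewrite normrN normr_nat ler1n.
  by have := gle _ n1; rewrite normrN normr_nat.
Qed.

Lemma integral_normal_cos t b :
  (\int[P]_x (cos (t * x + b))%:E = (expR (- (s ^+ 2 * t ^+ 2 / 2)) * cos b)%:E)%E.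
Proof.
pose F t := (\int[P]_x cos (t * x + b))%R.
have FE u : (\int[P]_x (cos (u * x + b))%:E = (F u)%:E)%E.
  by rewrite /F /Rintegral fineK//; apply: integrable_fin_num.
rewrite FE; congr EFin.
have F0 : F 0 = cos b.
  apply: EFin_inj; rewrite -FE.
  under eq_integral do rewrite mul0r add0r.
  by rewrite integral_cst// -[RHS]mule1; congr (_ * _)%E; exact: (probability_setT P).
have d1 (u y : R) : is_derive u 1 (fun v : R => cos (v * y + b)) (- (y * sin (u * y + b))).
  by apply: is_derive_eq; rewrite /GRing.scale /=; ring.
have partialE (u : R) (y : mR) : partial1of2 (fun u (y : mR) => cos (u * y + b)) u y = - (y * sin (u * y + b)).
  rewrite partial1of2E; apply: derive_val.
have int_xsin (u : R) : P.-integrable setT (fun x : mR => (x * sin (u * x + b))%:E).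
  apply: le_integrable integrable_norm_normal => //.
    by apply/measurable_EFinP; apply: measurable_funM.
  move=> x _ /=; rewrite lee_fin normr_id normrM.
  by rewrite ler_piMr// sin_max.
have dF (u : R) : is_derive u 1 F (- (s ^+ 2 * u) * F u).
  have Iu : `]u - 1, u + 1[%classic u by rewrite /= in_itv/=; lra.
  have H1 (x : R) : `]u - 1, u + 1[%classic x ->
    P.-integrable setT (EFin \o (fun y : mR => cos (x * y + b))).
    by move=> _; exact: integrable_cos.
  have H2 (x : R) (y : mR) : `]u - 1, u + 1[%classic x -> setT y ->
      derivable (fun v : R => cos (v * y + b)) x 1.
    by move=> _ _; apply: ex_derive.
  have H3 (x : R) (y : mR) : `]u - 1, u + 1[%classic x -> setT y ->
     `|partial1of2 (fun u (y : mR) => cos (u * y + b)) x y| <= `|y|.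
    by move=> _ _; rewrite partialE normrN normrM ler_piMr// sin_max.
  have dd := derivable_under_integral measurableT Iu H1 H2 (fun y => normr_ge0 y)
    integrable_norm_normal H3.
  have := differentiation_under_integral measurableT Iu H1 H2 (fun y => normr_ge0 y)
    integrable_norm_normal H3.
  have -> : (\int[P]_y (partial1of2 (fun u (y : mR) => cos (u * y + b)))^~ y u)%R =
     - (s ^+ 2 * u) * F u.
    pose J := (\int[P]_y (y * sin (u * y + b)))%R.
    have st : u * F u - s ^- 2 * J = 0.
      have icos := integrable_cos u b; have isin := int_xsin u.
      rewrite /F /J -!RintegralZl// -RintegralB//; last 2 first.
      - exact: (integrableZl measurableT u icos).
      - exact: (integrableZl measurableT (s ^- 2) isin).
      by rewrite /Rintegral stein.
    have -> : (\int[P]_y (partial1of2 (fun u (y : mR) => cos (u * y + b)))^~ y u)%R =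
       (\int[P]_y (-1 * (y * sin (u * y + b))))%R.
      by apply: eq_Rintegral => y _; rewrite partialE mulN1r.
    rewrite RintegralZl//; last exact: int_xsin.
    rewrite -/J.
    have -> : J = s ^+ 2 * (u * F u).
      have : s ^+ 2 * (u * F u - s ^- 2 * J) = 0 by rewrite st mulr0.
      rewrite mulrBr mulVKf ?expf_neq0 ?gt_eqF// => /eqP.
      by rewrite subr_eq0 => /eqP.
    by rewrite mulN1r mulNr mulrA.
  rewrite derive1E => <-.
  exact: DeriveDef.
(* Integrating factor for the linear equation [F' = - s ^ 2 u F]. *)
have dG (u : R) : is_derive u 1 (fun v => F v * expR (s ^+ 2 * v ^+ 2 / 2)) 0.
  have dFu := dF u.
  by apply: is_derive_eq; rewrite /GRing.scale /=; field.
have := is_derive_0_is_cst t 0 dG.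
rewrite expr0n /= mulr0 mul0r expR0 mulr1 F0 => <-.
by rewrite mulrCA -expRD addNr expR0 mulr1.
Qed.

End normal_characteristic_function.

(** * Measures on the plane *)

(* [lebesgue_measure] and [normal_prob] live on [measurableTypeR R], whose
   display differs from the default one of [R]. *)
Notation mplane R := (measurableTypeR R * measurableTypeR R)%type.

Section area.
Context {R : realType}.
Local Notation mR := (measurableTypeR R).
Local Notation mu := (@lebesgue_measure R).

Local Notation unit_ball := (eball (0 : plane R) (1 : R)).

Definition area : set (mplane R) -> \bar R := (mu \x mu)%E.

HB.instance Definition _ := Measure.on area.

Lemma areaX (A B : set mR) : measurable A -> measurable B ->
  (area (A `*` B) = mu A * mu B)%E.
Proof. by move=> mA mB; rewrite /area product_measure1E. Qed.

Lemma area_sigma_finite : sigma_finite setT area.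
Proof.
have /sigma_finiteP[F [TF ndF Foo]] := sigma_finiteT mu.
exists (fun n => F n `*` F n).
  rewrite -setXTT TF predeqE => -[x y]; split.
    move=> [/= [n _ Fnx] [k _ Gky]]; exists (maxn n k) => //; split.
    - by move: x Fnx; exact/subsetPset/ndF/leq_maxl.
    - by move: y Gky; exact/subsetPset/ndF/leq_maxr.
  by move=> [n _ []/= ? ?]; split; exists n.
move=> k; have [mF Fk] := Foo k; split; first exact: measurableX.
by rewrite areaX// lte_mul_pinfty// ge0_fin_numE.
Qed.

HB.instance Definition _ := Measure_isSigmaFinite.Build _ _ _ area
  area_sigma_finite.

(** Uniqueness of Lebesgue measure reduces the change of variables to half-open intervals; in the
    plane, uniqueness of the product measure reduces it to rectangles. *)
Lemma lebesgue_measure_affine (m r : R) (A : set mR) : 0 < r -> measurable A ->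
  (mu A = r%:E * mu ((fun x : mR => (m + r * x)%R : mR) @^-1` A))%E.
Proof.
move=> r0 mA.
pose f : mR -> mR := fun x => m + r * x.
have mf : measurable_fun setT f.
  by apply: measurable_funD => //; apply: measurable_funM.
pose M : {measure set mR -> \bar R} := mscale (NngNum (ltW r0))
  (measure_function_pushforward__canonical__measure_function_Measure mu mf).
rewrite (@lebesgue_measure_unique R M)// => _ [[a b] _ <-].
rewrite /M /= /mscale /= /pushforward.
have -> : f @^-1` `]a, b] = `](a - m) / r, (b - m) / r]%classic.
  apply/seteqP; split => x; rewrite /f /= !in_itv /= ltr_pdivrMr// ler_pdivlMr//;
    rewrite ltrBlDl lerBrDl [x * r]mulrC //.
rewrite !lebesgue_measure_itv /= !lte_fin ltr_pM2r ?invr_gt0// ltrD2r.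
case: ifP => _; last by rewrite mule0.
by rewrite -!EFinD -EFinM -mulrBl mulrC divfK ?gt_eqF// opprB addrA subrK.
Qed.

Lemma area_affine (m : plane R) (r : R) (A : set (mplane R)) :
  0 < r -> measurable A ->
  (area A = (r ^+ 2)%:E *
     area ((fun x : mplane R => (m.1 + r * x.1, m.2 + r * x.2)%R : mplane R) @^-1` A))%E.
Proof.
move=> r0 mA.
pose f : mplane R -> mplane R := fun x => (m.1 + r * x.1, m.2 + r * x.2).
have mf : measurable_fun setT f.
  apply/measurable_fun_pairP; split.
    by apply: measurable_funD => //; apply: measurable_funM => //; exact: measurable_fst.
  by apply: measurable_funD => //; apply: measurable_funM => //; exact: measurable_snd.
pose M : {measure set (mplane R) -> \bar R} := mscale (NngNum (sqr_ge0 r))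
  (measure_function_pushforward__canonical__measure_function_Measure area mf).
rewrite [LHS](@product_measure_unique _ _ _ _ _ mu mu M)//= => B C mB mC.
have mg (a : R) : measurable_fun setT (fun x : mR => a + r * x : mR).
  by apply: measurable_funD => //; apply: measurable_funM.
rewrite /M /= /mscale /= /pushforward.
have -> : f @^-1` (B `*` C) = ((fun x : mR => (m.1 + r * x)%R : mR) @^-1` B) `*`
   ((fun x : mR => (m.2 + r * x)%R : mR) @^-1` C) by [].
rewrite areaX; last 2 first.
- by rewrite -[X in measurable X]setTI; exact: mg.
- by rewrite -[X in measurable X]setTI; exact: mg.
rewrite (lebesgue_measure_affine m.1 r0 mB) (lebesgue_measure_affine m.2 r0 mC).
by rewrite muleACA -EFinM.
Qed.

Lemma measurable_sqnorm_sub (x0 : plane R) :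
  measurable_fun setT (fun x : mplane R => sqnorm (x - x0)).
Proof.
apply: measurable_funD; apply: measurable_funX.
  by apply: measurable_funB => //; exact: measurable_fst.
by apply: measurable_funB => //; exact: measurable_snd.
Qed.

Lemma eballE (x0 : plane R) (r : R) : 0 <= r ->
  eball x0 r = [set x | sqnorm (x - x0) < r ^+ 2].
Proof.
move=> r0; apply/seteqP; split => x /=; rewrite /eball /= /sqnorm -enorm_sqr.
  by move=> h; rewrite ltrXn2r// ?nnegrE// ?sqrtr_ge0//; apply/andP.
by rewrite ltr_pXn2r// ?nnegrE// sqrtr_ge0.
Qed.

Lemma measurable_eball (x0 : plane R) (r : R) :
  measurable (eball x0 r : set (mplane R)).
Proof.
have [r0|r0] := leP 0 r; last first.
  rewrite (_ : eball x0 r = set0)//; apply/seteqP; split => x //=.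
  by rewrite /eball /= => /lt_trans /(_ r0); rewrite ltNge sqrtr_ge0.
rewrite eballE// -[X in measurable X]setTI.
have := measurable_sqnorm_sub x0 measurableT (measurable_itv `]-oo, (r ^+ 2)[).
by congr measurable; congr setI; apply/seteqP; split => x /=; rewrite in_itv.
Qed.

Lemma area_eball (x0 : plane R) (r : R) : 0 < r ->
  area (eball x0 r) = ((r ^+ 2)%:E * area (unit_ball))%E.
Proof.
move=> r0; rewrite (area_affine x0 r0); last exact: measurable_eball.
congr (_ * area _)%E; rewrite !eballE// ?ltW//.
apply/seteqP; split => -[x y] /=; rewrite /sqnorm /= !subr0 expr1n;
  have -> : (x0.1 + r * x - x0.1) ^+ 2 + (x0.2 + r * y - x0.2) ^+ 2 =
    r ^+ 2 * (x ^+ 2 + y ^+ 2) by ring.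
  by rewrite gtr_pMr// exprn_gt0.
by rewrite gtr_pMr// exprn_gt0.
Qed.

Lemma area_unit_ball_le : (area (unit_ball) <= 4%:E)%E.
Proof.
apply: (@le_trans _ _ (area (`[-1, 1]%classic `*` `[-1, 1]%classic))).
  apply: le_measure; rewrite ?inE; [exact: measurable_eball|exact: measurableX|].
  move=> [x y]; rewrite eballE//= /sqnorm /= !subr0 expr1n => xy.
  have h (z : R) : z ^+ 2 < 1 -> - 1 <= z <= 1.
    by move=> z1; rewrite -ler_norml -(@expr_le1 _ 2)// real_normK ?num_real// ltW.
  split; rewrite /= in_itv/=; apply: h; apply: le_lt_trans xy.
    by rewrite lerDl sqr_ge0.
  by rewrite lerDr sqr_ge0.
rewrite areaX// !lebesgue_measure_itv /= lte_fin.
have -> : (-1 < 1 :> R) by lra.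
by rewrite -!EFinD -EFinM lee_fin; lra.
Qed.

Lemma area_unit_ball_fin : area (unit_ball) \is a fin_num.
Proof.
rewrite ge0_fin_numE ?measure_ge0//.
exact: le_lt_trans area_unit_ball_le (ltry _).
Qed.

End area.

Section planar_gaussian.
Context {R : realType}.
Local Notation mR := (measurableTypeR R).
Local Notation mu := (@lebesgue_measure R).
Implicit Types (m xi : plane R) (s : R).

Definition gauss2 m s : probability (mplane R) R :=
  (normal_prob m.1 s \x normal_prob m.2 s)%E.

Lemma measurable_affine xi (b : R) :
  measurable_fun setT (fun x : mplane R => xi.1 * x.1 + xi.2 * x.2 + b).
Proof.
by apply: measurable_funD => //; apply: measurable_funD; apply: measurable_funM.
Qed.

Lemma measurable_cos_affine xi (b : R) :
  measurable_fun setT (fun x : mplane R => cos (xi.1 * x.1 + xi.2 * x.2 + b)).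
Proof.
apply: measurableT_comp; last exact: measurable_affine.
by apply: continuous_measurable_fun; exact: continuous_cos.
Qed.

Lemma measurable_expR_sqnorm_sub m (k : R) :
  measurable_fun setT (fun x : mplane R => expR (k * sqnorm (x - m))).
Proof.
apply: measurableT_comp => //; apply: measurable_funM => //.
exact: measurable_sqnorm_sub.
Qed.

(** While the second coordinate is integrated, the first one is absorbed by the phase. *)
Lemma integral_gauss2_cos xi s (b : R) : 0 < s ->
  (\int[gauss2 0%R s]_x (cos (xi.1 * x.1 + xi.2 * x.2 + b))%:E =
  (expR (- (s ^+ 2 * sqnorm xi / 2)) * cos b)%:E)%E.
Proof.
move=> s0; rewrite -integral12_prod_meas1; last first.
  apply: (@bounded_integrable _ _ _ (gauss2 0%R s) _ 1) => [|x]; last exact: cos_max.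
  exact: measurable_cos_affine.
rewrite /fubini_F /=.
under eq_integral => x _.
  under eq_integral => y _ do rewrite addrAC addrC.
  rewrite integral_normal_cos// EFinM.
  over.
rewrite /= integralZl//; last first.
  apply: (@bounded_integrable _ _ _ _ _ 1) => [|x]; last exact: cos_max.
  apply: measurableT_comp; last by apply: measurable_funD => //; exact: measurable_funM.
  by apply: continuous_measurable_fun; exact: continuous_cos.
rewrite integral_normal_cos// -EFinM mulrA -expRD; congr (expR _ * _)%:E.
by rewrite /sqnorm; field.
Qed.

(** Used in both directions: [k > 1] gives growing weights, for tails and very high frequencies, and
    [k < 1] gives decaying ones. *)
Lemma integral_gauss2_expR_sqnorm m s (k : R) : 0 < s -> 0 < k ->
  (\int[gauss2 m s]_x
     (expR ((1 - k ^- 2) / (2 * s ^+ 2) * sqnorm (x - m)))%:E = (k ^+ 2)%:E)%E.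
Proof.
move=> s0 k0; rewrite fubini_tonelli1//=; last first.
  by apply/measurable_EFinP; exact: measurable_expR_sqnorm_sub.
rewrite /fubini_F /=.
have ms (n : R) : measurable_fun setT
   (fun x : mR => (expR ((1 - k ^- 2) / (2 * s ^+ 2) * (x - n) ^+ 2))%:E).
  apply/measurable_EFinP; apply: measurableT_comp => //.
  by apply: measurable_funM => //; apply: measurable_funX; exact: measurable_funB.
under eq_integral => x _.
  under eq_integral => y _ do rewrite /sqnorm /= mulrDr expRD EFinM.
  rewrite ge0_integralZl//=.
  rewrite integral_normal_expR_sqr//.
  over.
rewrite /= ge0_integralZr//=.
  by rewrite integral_normal_expR_sqr.
by rewrite lee_fin ltW.
Qed.

Lemma gauss2E m s (A : set (mplane R)) : 0 < s -> measurable A ->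
  (gauss2 m s A = \int[area]_(x in A)
     (normal_peak s ^+ 2 * expR (- (2 * s ^+ 2)^-1 * sqnorm (x - m)))%:E)%E.
Proof.
move=> s0 mA.
have mk : measurable_fun setT (fun x : mplane R =>
    (normal_peak s ^+ 2 * expR (- (2 * s ^+ 2)^-1 * sqnorm (x - m)))%:E).
  by apply/measurable_EFinP; apply: measurable_funM => //; exact: measurable_expR_sqnorm_sub.
have kE (x y : R) : normal_peak s ^+ 2 * expR (- (2 * s ^+ 2)^-1 * sqnorm ((x, y) - m)) =
    normal_pdf m.1 s x * normal_pdf m.2 s y.
  rewrite !normal_pdfE ?gt_eqF// mulrACA -expr2; congr (_ * _).
  rewrite /normal_fun -expRD /sqnorm /=; congr expR; field.
  by rewrite gt_eqF.
rewrite integral_mkcond fubini_tonelli1//=; last 2 first.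
- by apply/(measurable_restrictT _ _).1 => //; exact: measurable_funTS.
- move=> x; rewrite patchE; case: ifP => // _.
  by rewrite lee_fin mulr_ge0 ?expR_ge0 ?sqr_ge0.
rewrite /gauss2 /= /product_measure1 /fubini_F integral_normal_prob_ge0//; last first.
  exact: measurable_fun_xsection.
apply: eq_integral => x _.
rewrite [LHS]muleC.
transitivity ((normal_pdf m.1 s x)%:E *
   \int[mu]_(y in xsection A x) (normal_pdf m.2 s y)%:E)%E; first by [].
rewrite -ge0_integralZl//=.
- rewrite integral_mkcond; apply: eq_integral => y _.
  rewrite !patchE mem_xsection.
  by case: ifP => // _; rewrite kE -EFinM.
- exact: measurable_xsection.
- by apply/measurable_EFinP/measurable_funTS; exact: measurable_normal_pdf.
- by move=> y _; rewrite lee_fin normal_pdf_ge0.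
- by rewrite lee_fin normal_pdf_ge0.
Qed.

Lemma gauss2_le_area m s (A : set (mplane R)) : 0 < s -> measurable A ->
  (gauss2 m s A <= (normal_peak s ^+ 2)%:E * area A)%E.
Proof.
move=> s0 mA; rewrite gauss2E// -integral_cst//.
apply: ge0_le_integral => //=.
- by move=> x _; rewrite lee_fin mulr_ge0 ?expR_ge0 ?sqr_ge0.
- apply/measurable_EFinP/measurable_funTS; apply: measurable_funM => //.
  exact: measurable_expR_sqnorm_sub.
- move=> x _; rewrite lee_fin ler_piMr ?sqr_ge0// expR_le1 mulNr oppr_le0.
  by rewrite mulr_ge0 ?sqnorm_ge0// invr_ge0 mulr_ge0 ?sqr_ge0.
Qed.

(** Markov's inequality for the exponential moment above with [k ^ 2 = 2], the source of both the
    factor 2 and the exponent. *)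
Lemma gauss2_tail m s (u : R) : 0 < s ->
  (gauss2 m s [set x : plane R | (u ^+ 2 <= sqnorm (x - m))%R] <=
   (2 * expR (- (u ^+ 2 / (4 * s ^+ 2))))%:E)%E.
Proof.
move=> s0; set A := [set x | _].
have mA : measurable (A : set (mplane R)).
  rewrite -[X in measurable X]setTI.
  have := measurable_sqnorm_sub m measurableT (measurable_itv `[u ^+ 2, +oo[).
  by congr measurable; congr setI; apply/seteqP; split => x /=; rewrite in_itv/= andbT.
pose k : R := Num.sqrt 2.
have k0 : 0 < k by rewrite sqrtr_gt0.
have k2 : k ^+ 2 = 2 by rewrite sqr_sqrtr.
have H := integral_gauss2_expR_sqnorm m s0 k0; rewrite k2 in H.
have eE : (1 - 2^-1) / (2 * s ^+ 2) = (4 * s ^+ 2)^-1 by field; rewrite gt_eqF.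
rewrite eE in H.
have -> : gauss2 m s A = (\int[gauss2 m s]_x (\1_A x)%:E)%E.
  by rewrite (integral_indic _ measurableT mA) setIT.
rewrite mulrC EFinM -H -ge0_integralZl//=; last first.
  by apply/measurable_EFinP; exact: measurable_expR_sqnorm_sub.
apply: ge0_le_integral => //=.
- exact/measurable_EFinP/measurable_indic.
- by apply: emeasurable_funM => //; apply/measurable_EFinP; exact: measurable_expR_sqnorm_sub.
move=> x _; rewrite -EFinM lee_fin indicE.
case: (boolP (x \in A)) => /=; last by rewrite mulr_ge0 ?expR_ge0.
rewrite inE /A /= => ux; rewrite -expRD.
apply: le_trans (expR_ge1Dx _); rewrite lerDl addrC subr_ge0 mulrC.
by rewrite ler_pM2l ?invr_gt0 ?mulr_gt0 ?exprn_gt0.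
Qed.

End planar_gaussian.

(** * Smoothing *)

Section euclidean_norm.
Context {R : realType}.
Implicit Types x y : plane R.

Lemma enorm_ge0 x : 0 <= enorm x.
Proof. exact: sqrtr_ge0. Qed.

Lemma enorm_triangle x y : enorm (x + y) <= enorm x + enorm y.
Proof.
rewrite -(@ler_pXn2r _ 2) ?nnegrE ?addr_ge0 ?enorm_ge0//.
rewrite sqrrD !enorm_sqr /=.
suff : x.1 * y.1 + x.2 * y.2 <= enorm x * enorm y.
  rewrite !sqrrD; lra.
apply: (le_trans (ler_norm _)).
rewrite -(@ler_pXn2r _ 2) ?nnegrE ?mulr_ge0 ?enorm_ge0//.
rewrite exprMn !enorm_sqr real_normK ?num_real//.
have := sqr_ge0 (x.1 * y.2 - x.2 * y.1).
move: (x.1) (x.2) (y.1) (y.2) => a b c d; rewrite -subr_ge0.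
by congr (0 <= _); ring.
Qed.

Lemma enormN x : enorm (- x) = enorm x.
Proof. by rewrite /enorm /= !sqrrN. Qed.

Lemma sqnorm_ge_enorm x (t : R) : 0 <= t -> t <= enorm x -> t ^+ 2 <= sqnorm x.
Proof.
by move=> t0 tx; rewrite /sqnorm -enorm_sqr lerXn2r// nnegrE enorm_ge0.
Qed.

End euclidean_norm.

Lemma integral_cst_probability {R : realType} d (T : measurableType d)
    (P : probability T R) (c : \bar R) : (\int[P]_x c = c)%E.
Proof.
rewrite integral_cst// -[RHS]mule1; congr (_ * _)%E.
exact: probability_setT.
Qed.

Section gaussian_smoothing.
Context {R : realType}.
Variable delta : R.
Hypothesis delta0 : 0 < delta.

(** Left unnormalised, with value 1 at the origin, so that it is itself a characteristic
    function. *)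
Definition gauss_kernel (x : plane R) : R :=
  expR (- (2 * delta ^+ 2)^-1 * sqnorm x).

Lemma gauss_kernel_ge0 x : 0 <= gauss_kernel x.
Proof. exact: expR_ge0. Qed.

Let K2 : R := normal_peak delta ^+ 2.

Let K20 : 0 <= K2.
Proof. exact: sqr_ge0. Qed.

Lemma measurable_gauss_kernel_sub :
  measurable_fun setT (fun z : mplane R * mplane R => gauss_kernel (z.2 - z.1)).
Proof.
rewrite /gauss_kernel; apply: measurableT_comp => //.
apply: measurable_funM => //.
by apply: measurable_funD; apply: measurable_funX; apply: measurable_funB;
  do 2 ?apply: measurableT_comp.
Qed.

Let h (A : set (mplane R)) (z : mplane R * mplane R) : \bar R :=
  ((\1_A z.2)%:E * (K2 * gauss_kernel (z.2 - z.1))%:E)%E.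

Let h_ge0 A z : (0 <= h A z)%E.
Proof. by rewrite /h mule_ge0// lee_fin mulr_ge0 ?gauss_kernel_ge0. Qed.

Let measurable_h A : measurable A -> measurable_fun setT (h A).
Proof.
move=> mA; apply: emeasurable_funM.
  by apply/measurable_EFinP; apply: measurableT_comp => //; exact: measurable_indic.
by apply/measurable_EFinP; apply: measurable_funM => //; exact: measurable_gauss_kernel_sub.
Qed.

Let gauss2_h A y : measurable A -> (gauss2 y delta A = \int[area]_x h A (y, x))%E.
Proof.
move=> mA; rewrite gauss2E// integral_mkcond; apply: eq_integral => x _.
rewrite patchE /h /= indicE; case: (x \in A); last by rewrite mul0e.
by rewrite mul1e.
Qed.

Lemma measurable_gauss2_center A : measurable A ->
  measurable_fun setT (fun y : mplane R => gauss2 y delta A).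
Proof.
move=> mA.
have -> : (fun y : mplane R => gauss2 y delta A) = fubini_F area (h A).
  by apply/funext => y; rewrite gauss2_h.
exact: measurable_fun_fubini_tonelli_F (measurable_h mA) (h_ge0 A).
Qed.

(** By Tonelli, the convolution of [nu] with the Gaussian has a density with respect to area, and it
    is this density that Fourier analysis controls. *)
Lemma integral_gauss2_center (nu : probability (mplane R) R) A : measurable A ->
  (\int[nu]_y gauss2 y delta A =
   \int[area]_(x in A) (K2%:E * \int[nu]_y (gauss_kernel (x - y))%:E))%E.
Proof.
move=> mA; under eq_integral do rewrite gauss2_h//.
rewrite (fubini_tonelli (h A))//; last exact: measurable_h.
rewrite [RHS]integral_mkcond; apply: eq_integral => x _.
rewrite patchE /h /= indicE; case: (x \in A).
  under eq_integral do rewrite mul1e EFinM.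
  rewrite ge0_integralZl//=; last first.
  - by move=> y _; rewrite lee_fin gauss_kernel_ge0.
  - apply/measurable_EFinP.
    exact: (measurableT_comp measurable_gauss_kernel_sub (measurable_pair2 x)).
by under eq_integral do rewrite mul0e; rewrite integral0.
Qed.

(* Up to the tail of a Gaussian of standard deviation [delta] beyond [t], the
   function [y |-> gauss2 y delta (eball x0 (r + t))] lies between the
   indicators of the balls of radii [r] and [r + 2 t]. *)
Lemma gaussian_smoothing (nu nu' : probability (mplane R) R) (t r E : R)
    (x0 : plane R) : 0 < t -> 0 < r -> 0 <= E ->
  (forall x : plane R, (\int[nu]_y (gauss_kernel (x - y))%:E <=
     \int[nu']_y (gauss_kernel (x - y))%:E + E%:E)%E) ->
  (nu (eball x0 r) <= nu' (eball x0 (r + 2 * t)) +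
     (4 * expR (- (t ^+ 2 / (4 * delta ^+ 2))) +
      normal_peak delta ^+ 2 * E * (4 * (r + t) ^+ 2))%:E)%E.
Proof.
move=> t0 r0 E0 H.
pose B := eball x0 (r + t); have mB : measurable (B : set (mplane R)) by exact: measurable_eball.
set tl := expR _.
have tail y : (gauss2 y delta [set x : plane R | (t ^+ 2 <= sqnorm (x - y))%R] <= (2 * tl)%:E)%E.
  exact: gauss2_tail.
have mtail y : measurable ([set x : plane R | (t ^+ 2 <= sqnorm (x - y))%R] : set (mplane R)).
  rewrite -[X in measurable X]setTI.
  have := measurable_sqnorm_sub y measurableT (measurable_itv `[t ^+ 2, +oo[).
  by congr measurable; congr setI; apply/seteqP; split => x /=; rewrite in_itv/= andbT.
pose F (y : mplane R) := gauss2 y delta B.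
have mF : measurable_fun setT F by exact: measurable_gauss2_center.
have F0 y : (0 <= F y)%E by exact: measure_ge0.
have tl0 : 0 <= tl := expR_ge0 _.
have lowF y : ((\1_(eball x0 r) y)%:E <= F y + (2 * tl)%:E)%E.
  rewrite indicE; case: (boolP (y \in _)) => [|_]; last first.
    by rewrite adde_ge0// lee_fin mulr_ge0.
  rewrite inE /eball /= => yr.
  have -> : 1%:E = (gauss2 y delta B + gauss2 y delta (~` B))%E.
    rewrite -measureU//.
    - by rewrite setUv; apply/esym; exact: (probability_setT (gauss2 y delta)).
    - exact: measurableC.
    - by rewrite setICr.
  rewrite leeD2l//; apply: le_trans (tail y); apply: le_measure; rewrite ?inE//.
    exact: measurableC.
  move=> x; rewrite /B /eball /= => /negP; rewrite -leNgt => xr.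
  apply: sqnorm_ge_enorm; first exact: ltW.
  have := enorm_triangle (x - y) (y - x0); rewrite addrA subrK; lra.
have upF y : (F y <= (\1_(eball x0 (r + 2 * t)) y)%:E + (2 * tl)%:E)%E.
  rewrite indicE; case: (boolP (y \in _)) => [_|].
    apply: (le_trans (probability_le1 _ _)) => //.
    by rewrite -EFinD lee_fin lerDl mulr_ge0.
  rewrite notin_setE /eball /= => /negP; rewrite -leNgt => yr.
  rewrite add0e; apply: le_trans (tail y); apply: le_measure; rewrite ?inE//.
  move=> x; rewrite /B /eball /= => xr.
  apply: sqnorm_ge_enorm; first exact: ltW.
  have := enorm_triangle (- (x - y)) (x - x0).
  by rewrite opprB addrA subrK -(enormN (y - x)) opprB; lra.
have s1 : (nu (eball x0 r) <= \int[nu]_y F y + (2 * tl)%:E)%E.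
  have -> : nu (eball x0 r) = (\int[nu]_y (\1_(eball x0 r) y)%:E)%E.
    by rewrite (integral_indic _ measurableT (measurable_eball x0 r)) setIT.
  apply: (@le_trans _ _ (\int[nu]_y (F y + (2 * tl)%:E))%E).
    apply: ge0_le_integral => //=.
    - by apply/measurable_EFinP; apply: measurable_indic; exact: measurable_eball.
    - exact: emeasurable_funD.
  rewrite ge0_integralD//; last by move=> y _; rewrite lee_fin mulr_ge0.
  by rewrite integral_cst_probability.
have s2 : (\int[nu']_y F y <= nu' (eball x0 (r + 2 * t)) + (2 * tl)%:E)%E.
  have -> : nu' (eball x0 (r + 2 * t)) = (\int[nu']_y (\1_(eball x0 (r + 2 * t)) y)%:E)%E.
    by rewrite (integral_indic _ measurableT (measurable_eball _ _)) setIT.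
  have mi : measurable_fun setT (fun y : mplane R => (\1_(eball x0 (r + 2 * t)) y : R)%:E).
    by apply/measurable_EFinP; apply: measurable_indic; exact: measurable_eball.
  apply: (@le_trans _ _ (\int[nu']_y ((\1_(eball x0 (r + 2 * t)) y)%:E + (2 * tl)%:E))%E).
    apply: ge0_le_integral => //=.
    exact: emeasurable_funD.
  rewrite ge0_integralD//; last by move=> y _; rewrite lee_fin mulr_ge0.
  by rewrite integral_cst_probability.
have mint (n : probability (mplane R) R) :
    measurable_fun setT (fun x : mplane R => (\int[n]_y (gauss_kernel (x - y))%:E)%E).
  have := @measurable_fun_fubini_tonelli_G _ _ _ _ R n
    (fun z : mplane R * mplane R => (gauss_kernel (z.2 - z.1))%:E).
  apply; first by apply/measurable_EFinP; exact: measurable_gauss_kernel_sub.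
  by move=> z; rewrite lee_fin gauss_kernel_ge0.
have int0 (n : probability (mplane R) R) (x : plane R) : (0 <= \int[n]_y (gauss_kernel (x - y))%:E)%E.
  by apply: integral_ge0 => y _; rewrite lee_fin gauss_kernel_ge0.
have s3 : (\int[nu]_y F y <= \int[nu']_y F y + (K2 * E * (4 * (r + t) ^+ 2))%:E)%E.
  rewrite /F !integral_gauss2_center//.
  apply: (@le_trans _ _ (\int[area]_(x in B) (K2%:E * \int[nu']_y (gauss_kernel (x - y))%:E + (K2 * E)%:E))%E).
    apply: ge0_le_integral => //=.
    - by move=> x _; rewrite mule_ge0// lee_fin.
    - by apply: measurable_funTS; apply: emeasurable_funM => //; exact: mint.
    - apply: measurable_funTS; apply: emeasurable_funD => //.
      by apply: emeasurable_funM => //; exact: mint.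
    - move=> x _; rewrite (EFinM K2 E) -ge0_muleDr// ?lee_fin//.
      by rewrite lee_wpmul2l// lee_fin.
  rewrite ge0_integralD//; last 3 first.
  - by move=> x _; rewrite mule_ge0// lee_fin.
  - by apply: measurable_funTS; apply: emeasurable_funM => //; exact: mint.
  - by move=> x _; rewrite lee_fin mulr_ge0.
  rewrite leeD2l// integral_cst// (EFinM (K2 * E)).
  have aB : (area B <= (4 * (r + t) ^+ 2)%:E)%E.
    rewrite /B area_eball ?addr_gt0// (EFinM 4) muleC.
    by apply: lee_wpmul2r area_unit_ball_le; rewrite lee_fin sqr_ge0.
  by apply: lee_wpmul2l aB; rewrite lee_fin mulr_ge0.
apply: (le_trans s1).
have -> : ((4 * tl + normal_peak delta ^+ 2 * E * (4 * (r + t) ^+ 2))%:E =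
   (2 * tl)%:E + (K2 * E * (4 * (r + t) ^+ 2))%:E + (2 * tl)%:E)%E.
  by rewrite -!EFinD; congr EFin; rewrite /K2; ring.
rewrite !addeA leeD2r//.
by apply: (le_trans s3); rewrite leeD2r.
Qed.

End gaussian_smoothing.

(* Quantifying over the phase [b] encodes a real characteristic function without
   complex numbers. *)
Definition has_char {R : realType} (nu : probability (mplane R) R)
    (phi : plane R -> R) :=
  forall (xi : plane R) (b : R),
    (\int[nu]_y (cos (xi.1 * y.1 + xi.2 * y.2 + b))%:E = (phi xi * cos b)%:E)%E.

(** * Fourier representation of the Gaussian kernel *)

Section kernel_comparison.
Context {R : realType}.
Variable delta : R.
Hypothesis delta0 : 0 < delta.
Local Notation gam := (gauss2 (0 : plane R)%R delta^-1).
Implicit Types (nu : probability (mplane R) R) (phi : plane R -> R).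

Let d0 : 0 < delta^-1.
Proof. by rewrite invr_gt0. Qed.

Lemma gauss_kernel_cos (z : plane R) :
  ((gauss_kernel delta z)%:E = \int[gam]_eta (cos (z.1 * eta.1 + z.2 * eta.2))%:E)%E.
Proof.
have := integral_gauss2_cos z 0 d0.
under eq_integral do rewrite addr0.
rewrite cos0 mulr1 => ->; congr (expR _)%:E.
by field; rewrite gt_eqF.
Qed.

(** Fubini, with the phase of [has_char] taken to be minus the inner product of [x] and [eta]. *)
Lemma integral_gauss_kernel nu phi (x : plane R) : has_char nu phi ->
  (\int[nu]_y (gauss_kernel delta (x - y))%:E =
   \int[gam]_eta (phi eta * cos (x.1 * eta.1 + x.2 * eta.2))%:E)%E.
Proof.
move=> nuphi.
under eq_integral do rewrite gauss_kernel_cos.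
pose f (z : mplane R * mplane R) : \bar R :=
  (cos ((x.1 - z.1.1) * z.2.1 + (x.2 - z.1.2) * z.2.2))%:E.
have intf : (nu \x gam)%E.-integrable setT f.
  apply: (@bounded_integrable _ _ _ (nu \x gam)%E _ 1) => [|z]; last exact: cos_max.
  apply: measurableT_comp.
    by apply: continuous_measurable_fun; exact: continuous_cos.
  by apply: measurable_funD; apply: measurable_funM; try apply: measurable_funB => //;
    do 2 ?apply: measurableT_comp.
transitivity (\int[nu]_y \int[gam]_eta f (y, eta))%E; first by [].
rewrite (Fubini intf); apply: eq_integral => eta _.
have := nuphi eta (- (x.1 * eta.1 + x.2 * eta.2)).
rewrite cosN => <-; apply: eq_integral => y _; congr EFin.
by rewrite -cosN; congr cos; rewrite /=; ring.
Qed.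

Lemma integral_gauss2_decay (u : R) : 0 < u ->
  (\int[gam]_eta (expR (- u * sqnorm eta))%:E <= (delta ^+ 2 / (2 * u))%:E)%E.
Proof.
(* The integral equals [v^-1]; discarding the 1 in [v] leaves a factor [delta ^ 2] that will cancel
   the normalisation of the kernel. *)
move=> u0; pose v := 1 + 2 * u / delta ^+ 2.
have v0 : 0 < v by rewrite addr_gt0 ?divr_gt0 ?mulr_gt0 ?exprn_gt0.
have k0 : 0 < (Num.sqrt v)^-1 by rewrite invr_gt0 sqrtr_gt0.
have := integral_gauss2_expR_sqnorm 0 d0 k0.
under eq_integral do rewrite subr0.
have k2 : (Num.sqrt v)^-1 ^+ 2 = v^-1 by rewrite exprVn sqr_sqrtr// ltW.
have -> : (1 - (Num.sqrt v)^-1 ^- 2) / (2 * delta^-1 ^+ 2) = - u.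
  by rewrite k2 invrK /v; field; rewrite gt_eqF.
move=> ->; rewrite lee_fin k2 -[leRHS]invrK lef_pV2 ?posrE ?invr_gt0 ?divr_gt0 ?mulr_gt0 ?exprn_gt0//.
by rewrite invf_div /v lerDr.
Qed.

(** This weight carries the trivial bound at very high frequencies; its bounded mean spares a
    truncation of the frequency integral. *)
Lemma integral_gauss2_growth :
  (\int[gam]_eta (expR (delta ^+ 2 / 4 * sqnorm eta))%:E = 2%:E)%E.
Proof.
have k0 : 0 < Num.sqrt (2 : R) by rewrite sqrtr_gt0.
have := integral_gauss2_expR_sqnorm 0 d0 k0.
under eq_integral do rewrite subr0.
rewrite sqr_sqrtr//.
suff -> : (1 - 2^-1) / (2 * delta^-1 ^+ 2) = delta ^+ 2 / 4 by [].
by rewrite exprVn invfM invrK; field.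
Qed.

Lemma measurable_expR_sqnorm (k : R) :
  measurable_fun setT (fun x : mplane R => expR (k * sqnorm x)).
Proof.
have := measurable_expR_sqnorm_sub (0 : plane R) k.
by apply: eq_measurable_fun => x _; rewrite subr0.
Qed.

(* The kernel is the characteristic function of a planar Gaussian of standard
   deviation [1 / delta]: by Fubini the difference of the two sides is the
   integral of [phi - phi'] against that Gaussian. *)
Lemma kernel_comparison nu nu' phi phi' (a u h b : R) (x : plane R) :
  has_char nu phi -> has_char nu' phi' ->
  measurable_fun setT (phi : mplane R -> R) ->
  measurable_fun setT (phi' : mplane R -> R) ->
  (forall eta, `|phi eta| <= 1) -> (forall eta, `|phi' eta| <= 1) ->
  0 <= a -> 0 < u -> 0 <= h -> 0 <= b ->
  (forall eta, `|phi eta - phi' eta| <= a * expR (- u * sqnorm eta) + h +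
     b * expR (delta ^+ 2 / 4 * sqnorm eta)) ->
  (\int[nu]_y (gauss_kernel delta (x - y))%:E <=
   \int[nu']_y (gauss_kernel delta (x - y))%:E +
     (a * (delta ^+ 2 / (2 * u)) + h + 2 * b)%:E)%E.
Proof.
move=> H H' mphi mphi' p1 p1' a0 u0 h0 b0 bound.
rewrite (integral_gauss_kernel x H) (integral_gauss_kernel x H').
pose c (eta : mplane R) := cos (x.1 * eta.1 + x.2 * eta.2).
have mc : measurable_fun setT c.
  apply: measurableT_comp; first by apply: continuous_measurable_fun; exact: continuous_cos.
  by apply: measurable_funD; apply: measurable_funM.
have int (p : plane R -> R) : measurable_fun setT (p : mplane R -> R) ->
    (forall eta, `|p eta| <= 1) -> gam.-integrable setT (fun eta => (p eta * c eta)%:E).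
  move=> mp pp; apply: (@bounded_integrable _ _ _ gam _ 1) => [|eta].
    exact: measurable_funM.
  rewrite normrM -[leRHS]mulr1 ler_pM//; exact: cos_max.
pose Psi (eta : mplane R) := a * expR (- u * sqnorm eta) + h + b * expR (delta ^+ 2 / 4 * sqnorm eta).
have mPsi : measurable_fun setT Psi.
  apply: measurable_funD; first apply: measurable_funD => //.
    by apply: measurable_funM => //; exact: measurable_expR_sqnorm.
  by apply: measurable_funM => //; exact: measurable_expR_sqnorm.
have Psi0 eta : 0 <= Psi eta by rewrite !addr_ge0 ?mulr_ge0 ?expR_ge0.
have IPsi : (\int[gam]_eta (Psi eta)%:E <= (a * (delta ^+ 2 / (2 * u)) + h + 2 * b)%:E)%E.
  rewrite /Psi.
  have m1 : measurable_fun setT (fun eta : mplane R => (a * expR (- u * sqnorm eta))%:E).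
    by apply/measurable_EFinP; apply: measurable_funM => //; exact: measurable_expR_sqnorm.
  have m2 : measurable_fun setT (fun eta : mplane R => (b * expR (delta ^+ 2 / 4 * sqnorm eta))%:E).
    by apply/measurable_EFinP; apply: measurable_funM => //; exact: measurable_expR_sqnorm.
  have m3 k : measurable_fun setT (fun eta : mplane R => (expR (k * sqnorm eta))%:E).
    by apply/measurable_EFinP; exact: measurable_expR_sqnorm.
  under eq_integral do rewrite EFinD EFinD.
  rewrite ge0_integralD//; first last.
  - by move=> eta _; rewrite lee_fin mulr_ge0 ?expR_ge0.
  - exact: emeasurable_funD.
  - by move=> eta _; rewrite -EFinD lee_fin addr_ge0 ?mulr_ge0 ?expR_ge0.
  rewrite ge0_integralD//; last by move=> eta _; rewrite lee_fin mulr_ge0 ?expR_ge0.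
  rewrite integral_cst_probability !EFinD.
  apply: leeD; first (apply: leeD => //).
    under eq_integral do rewrite EFinM.
    rewrite ge0_integralZl//= EFinM.
    by apply: lee_wpmul2l; [rewrite lee_fin|exact: integral_gauss2_decay].
  under eq_integral do rewrite EFinM.
  by rewrite ge0_integralZl//= integral_gauss2_growth EFinM muleC.
have intPsi : gam.-integrable setT (fun eta => (Psi eta)%:E).
  apply/integrableP; split; first exact/measurable_EFinP.
  under eq_integral do rewrite /= ger0_norm//.
  exact: le_lt_trans IPsi (ltry _).
apply: (@le_trans _ _ (\int[gam]_eta ((phi' eta * c eta)%:E + (Psi eta)%:E))%E).
  apply: le_integral => //.
  - exact: int.
  - by apply: integrableD => //; exact: int.
  move=> eta _; rewrite -EFinD lee_fin -lerBlDl -mulrBl.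
  apply: le_trans (bound eta); apply: (le_trans (ler_norm _)).
  by rewrite normrM ler_piMr// cos_max.
rewrite integralD//; last exact: int.
by rewrite leeD2l.
Qed.

End kernel_comparison.

(** * Isometries and the law of the walk *)

Section isometries_of_the_plane.
Context {R : realType}.
Local Notation mR := (measurableTypeR R).
Implicit Types (f g : Isom R) (x y : plane R).

Definition e1 : plane R := (1, 0).
Definition e2 : plane R := (0, 1).

(* The affine map sending 0, [e1], [e2] to the three components of [p]. *)
Definition affine_interp (p : plane R * plane R * plane R) x : plane R :=
  (p.1.1.1 + x.1 * (p.1.2.1 - p.1.1.1) + x.2 * (p.2.1 - p.1.1.1),
   p.1.1.2 + x.1 * (p.1.2.2 - p.1.1.2) + x.2 * (p.2.2 - p.1.1.2)).

Definition isom_frame f : plane R * plane R * plane R := (f 0, f e1, f e2).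

Lemma isom_sqnorm f x y : sqnorm (f x - f y) = sqnorm (x - y).
Proof. by rewrite /sqnorm -!enorm_sqr isom_dist. Qed.

(** Polarization: the distances to the images of 0, [e1], [e2] determine the inner products, so
    [f x - f 0] has the coordinates of [x] in the orthonormal frame of [f]. *)
Lemma isom_affine f x : f x = affine_interp (isom_frame f) x.
Proof.
apply/subr0_eq/enorm_eq0.
suff : sqnorm (f x - affine_interp (isom_frame f) x) = 0.
  by rewrite /sqnorm -enorm_sqr => /eqP; rewrite sqrf_eq0 => /eqP.
have := isom_sqnorm f x 0; have := isom_sqnorm f e1 0; have := isom_sqnorm f e2 0.
have := isom_sqnorm f x e1; have := isom_sqnorm f x e2; have := isom_sqnorm f e1 e2.
rewrite /affine_interp /isom_frame /sqnorm /e1 /e2 /=.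
move: (f x) (f 0) (f (1, 0)) (f (0, 1)) => [a b] [a0 b0] [a1 b1] [a2 b2] /=.
case: x => u v /=; rewrite !subr0 !sub0r !sqrrN !expr1n !expr0n /= !addr0 !add0r.
move=> h1 h2 h3 h4 h5 h6.
pose A := a - a0; pose B := b - b0; pose A1 := a1 - a0; pose B1 := b1 - b0.
pose A2 := a2 - a0; pose B2 := b2 - b0.
have n1 : A1 ^+ 2 + B1 ^+ 2 = 1 by rewrite h5.
have n2 : A2 ^+ 2 + B2 ^+ 2 = 1 by rewrite h4.
have n0 : A ^+ 2 + B ^+ 2 = u ^+ 2 + v ^+ 2 by rewrite h6.
have i1 : A * A1 + B * B1 = u.
  have : (A - A1) ^+ 2 + (B - B1) ^+ 2 = (u - 1) ^+ 2 + v ^+ 2.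
    by rewrite -h3 /A /A1 /B /B1; ring.
  rewrite !sqrrB; lra.
have i2 : A * A2 + B * B2 = v.
  have : (A - A2) ^+ 2 + (B - B2) ^+ 2 = u ^+ 2 + (v - 1) ^+ 2.
    by rewrite -h2 /A /A2 /B /B2; ring.
  rewrite !sqrrB; lra.
have i3 : A1 * A2 + B1 * B2 = 0.
  have : (A1 - A2) ^+ 2 + (B1 - B2) ^+ 2 = 1 + 1.
    by rewrite -h1 /A1 /A2 /B1 /B2; ring.
  rewrite !sqrrB; lra.
have -> : a - (a0 + u * (a1 - a0) + v * (a2 - a0)) = A - u * A1 - v * A2.
  by rewrite /A /A1 /A2; ring.
have -> : b - (b0 + u * (b1 - b0) + v * (b2 - b0)) = B - u * B1 - v * B2.
  by rewrite /B /B1 /B2; ring.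
have -> : (A - u * A1 - v * A2) ^+ 2 + (B - u * B1 - v * B2) ^+ 2 =
  (A ^+ 2 + B ^+ 2) + u ^+ 2 * (A1 ^+ 2 + B1 ^+ 2) + v ^+ 2 * (A2 ^+ 2 + B2 ^+ 2)
  - 2 * u * (A * A1 + B * B1) - 2 * v * (A * A2 + B * B2)
  + 2 * u * v * (A1 * A2 + B1 * B2) by ring.
by rewrite n0 n1 n2 i1 i2 i3; ring.
Qed.

Lemma isom_eval_continuous x : continuous (fun f : Isom R => f x).
Proof.
move=> f.
have h1 : {for f, continuous (@isom_fun R : Isom R -> {ptws plane R -> plane R})}.
  exact: (@initial_continuous (Isom R) {ptws plane R -> plane R} (@isom_fun R) f).
exact: (continuous_comp h1 (@proj_continuous (plane R) (fun=> plane R) x (isom_fun f))).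
Qed.

Lemma affine_interp_continuous :
  continuous (affine_interp : _ -> {ptws plane R -> plane R}).
Proof.
move=> p; apply/cvg_sup => x.
rewrite cvg_image; last by rewrite eqEsubset; split=> v // _; exists (cst v).
have H : affine_interp q x @[q --> p] --> affine_interp p x.
  pose T3 := (plane R * plane R * plane R)%type.
  have cf (A B : topologicalType) : continuous (@fst A B) by move=> z; exact: cvg_fst.
  have cs (A B : topologicalType) : continuous (@snd A B) by move=> z; exact: cvg_snd.
  have c11 : continuous (fun q : T3 => q.1.1).
    by move=> q; exact: (continuous_comp (@cf _ _ q) (@cf _ _ q.1)).
  have c12 : continuous (fun q : T3 => q.1.2).
    by move=> q; exact: (continuous_comp (@cf _ _ q) (@cs _ _ q.1)).
  have c1 (h : plane R -> R) : continuous h -> continuous (fun q : T3 => h q.1.1).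
    by move=> ch q; exact: (continuous_comp (c11 q) (ch q.1.1)).
  have c2 (h : plane R -> R) : continuous h -> continuous (fun q : T3 => h q.1.2).
    by move=> ch q; exact: (continuous_comp (c12 q) (ch q.1.2)).
  have c3 (h : plane R -> R) : continuous h -> continuous (fun q : T3 => h q.2).
    by move=> ch q; exact: (continuous_comp (@cs _ _ q) (ch q.2)).
  have cD (u v : T3 -> R) : continuous u -> continuous v -> continuous (fun q => u q + v q).
    by move=> cu cv q; exact: (continuousD (cu q) (cv q)).
  have cB (u v : T3 -> R) : continuous u -> continuous v -> continuous (fun q => u q - v q).
    by move=> cu cv q; exact: (continuousB (cu q) (cv q)).
  have cM (k : R) (u : T3 -> R) : continuous u -> continuous (fun q => k * u q).
    by move=> cu q; exact: (continuousM (@cst_continuous _ _ k q) (cu q)).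
  have c4 (h : plane R -> R) : continuous h -> continuous (fun q : T3 =>
      h q.1.1 + x.1 * (h q.1.2 - h q.1.1) + x.2 * (h q.2 - h q.1.1)).
    move=> ch; have h1 := c1 _ ch; have h2 := c2 _ ch; have h3 := c3 _ ch.
    by apply: (cD _ _ (cD _ _ h1 (cM _ _ (cB _ _ h2 h1))) (cM _ _ (cB _ _ h3 h1))).
  exact: (cvg_pair (c4 _ (@cf R R) p) (c4 _ (@cs R R) p)).
apply: cvg_trans H => W /= HW; exists ((@^~ x) @^-1` W) => //.
by rewrite image_preimage // eqEsubset; split=> // j _; exists (fun _ => j).
Qed.

(** The six real coordinates are indexed by a finite type, so that their rational approximations are
    finite functions and form a countable type. *)
Definition frame_coord f (i : 'I_3 * bool) : R :=
  let z := f (nth 0 [:: 0; e1; e2] i.1) in if i.2 then z.1 else z.2.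

(** Continuity of the interpolation in its frame turns a neighbourhood for pointwise convergence
    into one that is cut out by six real numbers. *)
Lemma frame_coord_nbhs (U : set (Isom R)) f : open U -> U f ->
  exists2 e : R, 0 < e &
    forall g, (forall i, `|frame_coord f i - frame_coord g i| < e) -> U g.
Proof.
move=> [V oV <-] Vf.
have : nbhs (isom_frame f) ((affine_interp : _ -> {ptws plane R -> plane R}) @^-1` V).
  apply: affine_interp_continuous; apply: open_nbhs_nbhs; split => //.
  have -> : affine_interp (isom_frame f) = f by apply/funext => x; rewrite -isom_affine.
  exact: Vf.
move=> /nbhs_ballP[e /= e0 eV]; exists e => // g fg.
have : affine_interp (isom_frame g) = g by apply/funext => x; rewrite -isom_affine.
rewrite /= => <-; apply: eV; rewrite /isom_frame.
have h0 := fg (inord 0, true); have h1 := fg (inord 0, false).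
have h2 := fg (inord 1, true); have h3 := fg (inord 1, false).
have h4 := fg (inord 2, true); have h5 := fg (inord 2, false).
move: h0 h1 h2 h3 h4 h5; by rewrite /frame_coord /= !inordK.
Qed.

Lemma measurable_isom_eval x :
  measurable_fun setT (fun f : Isom R => (f x : mplane R)).
Proof.
have main (h : plane R -> R) : continuous h ->
    measurable_fun setT (fun f : Isom R => h (f x) : mR).
  move=> ch.
  refine (@measurability _ _ (Isom R) mR setT (fun f => h (f x)) _ (RGenOInfty.measurableE R) _).
  move=> _ [_ [y ->] <-]; rewrite setTI; apply: sub_sigma_algebra.
  have : continuous (fun f : Isom R => h (f x)).
    by move=> f; exact: (continuous_comp (@isom_eval_continuous x f) (ch (f x))).
  move=> /continuousP; apply; exact: interval_open.
apply/measurable_fun_pairP; split; apply: main => z; [exact: cvg_fst|exact: cvg_snd].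
Qed.

Lemma measurable_isom_set1 f : measurable [set f].
Proof.
have m x : measurable [set g : Isom R | g x = f x].
  have mx : measurable ([set f x] : set (mplane R)).
    rewrite (_ : [set f x] = [set (f x).1] `*` [set (f x).2]).
      exact: measurableX.
    by apply/seteqP; split => -[a b] /=; case: (f x) => c d /= [-> ->].
  rewrite -[X in measurable X]setTI.
  exact: (measurable_isom_eval x measurableT mx).
rewrite (_ : [set f] = [set g | g 0 = f 0] `&` [set g | g e1 = f e1] `&` [set g | g e2 = f e2]).
  by apply: measurableI; [apply: measurableI|]; exact: m.
apply/seteqP; split => g /= [].
  by move=> ->.
move=> [h0 h1] h2; apply: isomP => x.
by rewrite !isom_affine /isom_frame h0 h1 h2.
Qed.

Let rational_nbhd (k : {ffun 'I_3 * bool -> rat} * nat) : set (Isom R) :=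
  [set g | forall i, `|ratr (k.1 i) - frame_coord g i| < (k.2.+1%:R)^-1].

Lemma measurable_frame_coord i : measurable_fun setT (frame_coord ^~ i).
Proof.
have mx := measurable_isom_eval (nth 0 [:: 0; e1; e2] i.1).
rewrite /frame_coord; case: i.2 in mx *.
  exact: (measurableT_comp measurable_fst mx).
exact: (measurableT_comp measurable_snd mx).
Qed.

(* The rational neighbourhoods form a countable basis. *)
Lemma null_compl_topological_support (mu : {measure set (Isom R) -> \bar R}) :
  mu.-negligible (~` topological_support mu).
Proof.
pose F n : set (Isom R) := if (choice.unpickle n : option ({ffun 'I_3 * bool -> rat} * nat)%type) is Some k then
  (if `[< mu (rational_nbhd k) = 0%E >] then rational_nbhd k else set0) else set0.
have mF k : measurable (rational_nbhd k).
  rewrite (_ : rational_nbhd k = \bigcap_(i in [set: 'I_3 * bool])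
     [set g | `|ratr (k.1 i) - frame_coord g i| < (k.2.+1%:R)^-1]); last first.
    by apply/seteqP; split => g /= H i; [move=> _; exact: H|exact: H].
  apply: fin_bigcap_measurable; first exact: finite_finset.
  move=> i _; rewrite -[X in measurable X]setTI.
  have m1 : measurable_fun setT (fun g : Isom R => `|ratr (k.1 i) - frame_coord g i|).
    apply: measurableT_comp => //; apply: measurable_funB => //.
    exact: measurable_frame_coord.
  have := m1 measurableT _ (measurable_itv `]-oo, (k.2.+1%:R)^-1[).
  by congr measurable; congr setI; apply/seteqP; split => x /=; rewrite in_itv.
have Fn n : mu.-negligible (F n).
  rewrite /F; case: choice.unpickle => [k|]; last exact: negligible_set0.
  case: ifPn => [/asboolP k0|_]; last exact: negligible_set0.
  by apply/negligibleP.
apply: negligibleS (negligible_bigcup Fn) => f /= fs.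
have [U [oU Uf U0]] : exists U, [/\ open U, U f & mu U = 0%E].
  apply: contrapT => H; apply: fs => U oU Uf.
  rewrite lt_neqAle measure_ge0 andbT eq_sym; apply/eqP => U0.
  by apply: H; exists U.
have [e e0 eU] := frame_coord_nbhs oU Uf.
(* The radius [1 / (n + 1)] is spent twice, from [f] to the rational point and from there to [g]. *)
pose n := Num.truncn (2 / e).
have ne : 2 * (n.+1%:R)^-1 < e.
  by rewrite ltr_pdivrMr// mulrC -ltr_pdivrMr// truncnS_gt.
have n0 : 0 < (n.+1%:R)^-1 :> R by rewrite invr_gt0.
set d := (n.+1%:R)^-1 in ne n0.
have [q qP] : {q : 'I_3 * bool -> rat & forall i, `|ratr (q i) - frame_coord f i| < d}.
  apply: (@choice _ _ (fun i q => `|ratr q - frame_coord f i| < d)) => i.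
  have : frame_coord f i - d < frame_coord f i + d by lra.
  move=> /rat_in_itvoo[q]; rewrite in_itv /= => /andP[q1 q2]; exists q.
  by rewrite ltr_norml; lra.
pose k : {ffun 'I_3 * bool -> rat} * nat := ([ffun i => q i], n).
exists (choice.pickle k) => //; rewrite /F choice.pickleK.
have kU : rational_nbhd k `<=` U.
  move=> g /= gk; apply: eU => i.
  have h1 : `|ratr (q i) - frame_coord g i| < d by have := gk i; rewrite /k /= ffunE.
  have h2 := qP i.
  have -> : frame_coord f i - frame_coord g i =
    (ratr (q i) - frame_coord g i) - (ratr (q i) - frame_coord f i) by ring.
  by rewrite (le_lt_trans (ler_normB _ _))//; lra.
have -> : mu (rational_nbhd k) = 0%E.
  apply/eqP; rewrite -measure_le0 -U0; apply: le_measure; rewrite ?inE//.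
  exact: sub_sigma_algebra.
rewrite asboolT// => i; rewrite /k /= ffunE; exact: qP.
Qed.

End isometries_of_the_plane.

Lemma set_seq_cons (T : eqType) (x : T) (s : seq T) :
  [set` x :: s] = [set x] `|` [set` s].
Proof.
apply/seteqP; split => y /=; rewrite inE; first by move=> /orP[/eqP|]; [left|right].
by move=> [->|ys]; apply/orP; [left|right].
Qed.

(** * Expectations along the walk as finite sums over words *)

Section law_of_the_walk.
Context {R : realType} d (T : measurableType d) (P : probability T R).
Variables (g : nat -> {RV P >-> Isom R}).
Implicit Types (f : plane R -> R) (w : T).

(** The earliest increment acts last, so the recursion removes it from the outside and shifts the
    starting index. *)
Fixpoint tail_walk (k n : nat) w : plane R :=
  if n is n'.+1 then (g k w : Isom R) (tail_walk k.+1 n' w) else 0.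

Lemma tail_walkE k n w :
  tail_walk k n w = (\prod_(i < n) (g (k + i)%N w : Isom R))%g 0.
Proof.
elim: n k => [|n IH] k /=; first by rewrite big_ord0.
rewrite IH big_ord_recl addn0; congr (isom_fun _ (isom_fun _ _)).
by apply: eq_bigr => i _; rewrite addSnnS.
Qed.

Lemma walkE n w : walk g n w = tail_walk 0 n w.
Proof. by rewrite tail_walkE. Qed.

(** An isometry is affine in its frame, so the value at a random point is a polynomial in finitely
    many measurable real functions. *)
Lemma measurable_isom_app (h : {RV P >-> Isom R}) (y : T -> mplane R) :
  measurable_fun setT y -> measurable_fun setT (fun w => (h w : Isom R) (y w) : mplane R).
Proof.
move=> my.
have mh x : measurable_fun setT (fun w => (h w : Isom R) x : mplane R).
  apply: (measurableT_comp (measurable_isom_eval x)); exact: measurable_funPT.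
have -> : (fun w => (h w : Isom R) (y w) : mplane R) =
    (fun w => affine_interp (isom_frame (h w)) (y w) : mplane R).
  by apply/funext => w; rewrite isom_affine.
have m1 x : measurable_fun setT (fun w => ((h w : Isom R) x).1 : measurableTypeR R).
  exact: measurableT_comp (@measurable_fst _ _ _ _) (mh x).
have m2 x : measurable_fun setT (fun w => ((h w : Isom R) x).2 : measurableTypeR R).
  exact: measurableT_comp (@measurable_snd _ _ _ _) (mh x).
have my1 : measurable_fun setT (fun w => (y w).1 : measurableTypeR R).
  exact: measurableT_comp (@measurable_fst _ _ _ _) my.
have my2 : measurable_fun setT (fun w => (y w).2 : measurableTypeR R).
  exact: measurableT_comp (@measurable_snd _ _ _ _) my.
apply/measurable_fun_pairP; split => /=.
  by do 2 ?apply: measurable_funD; try exact: m1;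
    apply: measurable_funM => //; apply: measurable_funB; exact: m1.
by do 2 ?apply: measurable_funD; try exact: m2;
  apply: measurable_funM => //; apply: measurable_funB; exact: m2.
Qed.

Lemma measurable_tail_walk k n :
  measurable_fun setT (fun w => tail_walk k n w : mplane R).
Proof.
by elim: n k => [|n IH] k //=; apply: measurable_isom_app; exact: IH.
Qed.

Variable mu : probability (Isom R) R.
Hypothesis g_indep : mutually_independent g.
Hypothesis g_law : forall n (A : set (Isom R)), measurable A ->
  distribution P (g n) A = mu A.

Variables (S : seq (Isom R)) (wt : Isom R -> R).
Hypothesis S_uniq : uniq S.
Hypothesis muS : forall s, s \in S -> mu [set s] = (wt s)%:E.
Hypothesis mu_compl : mu.-negligible (~` [set` S]).

(** Weighted sum over words of length [n] in [S]; the first letter is outermost, hence the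
    composition [f \o s]. *)
Fixpoint expect n f : R :=
  if n is n'.+1 then \sum_(s <- S) wt s * expect n' (f \o s) else f 0.

Let event k s := (g k : T -> Isom R) @^-1` [set s].

Let measurable_event k s : measurable (event k s).
Proof.
rewrite -[X in measurable X]setTI; apply: measurable_funPT => //.
exact: measurable_isom_set1.
Qed.

Let P_event k s : s \in S -> P (event k s) = (wt s)%:E.
Proof.
by move=> sS; rewrite -muS// -(g_law k)//; exact: measurable_isom_set1.
Qed.

Let measurable_S : measurable ([set` S] : set (Isom R)).
Proof.
elim: S => [|s S' IH]; first by rewrite set_nil.
by rewrite set_seq_cons; apply: measurableU => //; exact: measurable_isom_set1.
Qed.

Let split_integral k (D : set T) (G : T -> \bar R) : measurable D ->
  measurable_fun setT G -> (forall w, 0 <= G w)%E ->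
  (\int[P]_(w in D) G w = \sum_(s <- S) \int[P]_(w in D `&` event k s) G w)%E.
Proof.
move=> mD mG G0.
pose N := (g k : T -> Isom R) @^-1` (~` [set` S]).
have mN : measurable N.
  rewrite -[X in measurable X]setTI; apply: measurable_funPT => //.
  exact: measurableC.
have PN : P N = 0%E.
  have := g_law k (measurableC measurable_S).
  by rewrite (measure_negligible (measurableC measurable_S) mu_compl).
rewrite (ge0_negligible_integral mN)//; last first.
- exact: measurable_funTS.
have -> : D `\` N = D `&` (g k : T -> Isom R) @^-1` [set` S].
  by rewrite setDE /N preimage_setC setCK.
have sub S' : uniq S' -> (\int[P]_(w in D `&` (g k : T -> Isom R) @^-1` [set` S']) G w =
   \sum_(s <- S') \int[P]_(w in D `&` event k s) G w)%E.
  elim: S' => [|s S' IH] /=.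
    by rewrite set_nil preimage_set0 setI0 integral_set0 big_nil.
  move=> /andP[sS' uS']; rewrite big_cons -IH// set_seq_cons preimage_setU setIUr.
  rewrite ge0_integral_setU//.
  - by apply: measurableI => //; exact: measurable_event.
  - apply: measurableI => //; rewrite -[X in measurable X]setTI.
    apply: measurable_funPT => //; elim: (S') => [|s' S'' IH']; first by rewrite set_nil.
    by rewrite set_seq_cons; apply: measurableU => //; exact: measurable_isom_set1.
  - exact: measurable_funTS.
  - apply/disj_setPS => w /= [[_ gs] [_ gS]].
    by move: gS sS'; rewrite gs /= => ->.
exact: sub.
Qed.

Let prefix k (h : nat -> Isom R) := \bigcap_(j in [set j | (j < k)%N]) event j (h j).

Let P_prefix k h : (forall j, (j < k)%N -> h j \in S) ->
  P (prefix k h) = (\prod_(j < k) wt (h j))%:E.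
Proof.
move=> hS; pose J : {fset nat} := [fset j | j in iota 0 k]%fset.
have := g_indep J (A := fun j => [set h j]) (fun j => measurable_isom_set1 (h j)).
have -> : \bigcap_(j in [set` J]) (g j @^-1` [set h j]) = prefix k h.
  rewrite /prefix; have -> // : [set` J] = [set j | (j < k)%N].
  by apply/seteqP; split => j /=; rewrite /J !inE mem_iota add0n.
move=> ->; rewrite (perm_big (iota 0 k)); last first.
  apply: uniq_perm; [exact: fset_uniq|exact: iota_uniq|move=> j].
  by rewrite !inE.
rewrite -prodEFin -(big_mkord xpredT (fun j => (wt (h j))%:E)) /index_iota subn0.
apply: eq_big_seq => j; rewrite mem_iota add0n => /= jk.
by apply: P_event; exact: hS.
Qed.

(* The restriction to a prescribed prefix is what lets the induction on [n] use
   independence. *)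
Lemma integral_tail_walk n k h f : (forall j, (j < k)%N -> h j \in S) ->
  measurable_fun setT (f : mplane R -> R) -> (forall x, 0 <= f x) ->
  (\int[P]_(w in prefix k h) (f (tail_walk k n w))%:E =
   ((\prod_(j < k) wt (h j)) * expect n f)%:E)%E.
Proof.
have mprefix k' h' : measurable (prefix k' h').
  by apply: bigcap_measurableType => j _; exact: measurable_event.
elim: n k h f => [|n IH] k h f hS mf f0.
  rewrite /= integral_cst// mulrC EFinM; congr (_ * _)%E; exact: P_prefix.
have mF (f' : plane R -> R) k' n' : measurable_fun setT (f' : mplane R -> R) ->
    measurable_fun setT (fun w => (f' (tail_walk k' n' w))%:E).
  move=> mf'; apply/measurable_EFinP.
  exact: (measurableT_comp mf' (measurable_tail_walk k' n')).
rewrite (split_integral k)//; [|exact: mF|by move=> w; rewrite lee_fin].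
rewrite /= big_distrr /= -sumEFin; apply: eq_big_seq => s sS.
pose h' j := if j == k then s else h j.
have -> : prefix k h `&` event k s = prefix k.+1 h'.
  apply/seteqP; split => w /=.
    move=> [hw gs] j /=; rewrite ltnS leq_eqVlt /h' => /orP[/eqP ->|jk].
      by rewrite eqxx.
    by rewrite ltn_eqF//; exact: hw.
  move=> hw; split; last by have := hw k (ltnSn k); rewrite /h' eqxx.
  by move=> j /= jk; have := hw j (ltnW jk); rewrite /h' ltn_eqF.
have h'S j : (j < k.+1)%N -> h' j \in S.
  rewrite ltnS leq_eqVlt /h' => /orP[/eqP ->|jk]; first by rewrite eqxx.
  by rewrite ltn_eqF//; exact: hS.
have ms : measurable_fun setT (f \o s : mplane R -> R).
  apply: (measurableT_comp mf).
  have -> : (s : plane R -> plane R) = affine_interp (isom_frame s).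
    by apply/funext => x; exact: isom_affine.
  apply/measurable_fun_pairP; split => /=;
    by do 2 ?apply: measurable_funD => //; apply: measurable_funM.
transitivity (\int[P]_(w in prefix k.+1 h') ((f \o s) (tail_walk k.+1 n w))%:E)%E.
  apply: eq_integral => w; rewrite inE => hw.
  have := hw k (ltnSn k); rewrite /h' eqxx /event /= => gs.
  by rewrite gs.
rewrite IH//; last by move=> x; exact: f0.
rewrite big_ord_recr /= /h' eqxx -!mulrA; congr (_ * _)%:E.
by apply: eq_bigr => i _; rewrite ltn_eqF.
Qed.

Lemma integral_walk n f :
  measurable_fun setT (f : mplane R -> R) -> (forall x, 0 <= f x) ->
  (\int[P]_w (f (walk g n w))%:E = (expect n f)%:E)%E.
Proof.
move=> mf f0; have := @integral_tail_walk n 0 (fun=> 1%g) f _ mf f0.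
rewrite big_ord0 mul1r => <- //.
have -> : prefix 0 (fun=> 1%g) = setT by apply/seteqP; split => w //= _ j.
by apply: eq_integral => w _; rewrite walkE.
Qed.

End law_of_the_walk.

(** * Characteristic functions and variances of the two types of walk *)

Section characteristic_function_of_the_walk.
Context {R : realType} d (T : measurableType d) (P : probability T R).
Variables (g : nat -> {RV P >-> Isom R}).
Variable mu : probability (Isom R) R.
Hypothesis g_indep : mutually_independent g.
Hypothesis g_law : forall n (A : set (Isom R)), measurable A ->
  distribution P (g n) A = mu A.

Section finite_support.
Variables (S : seq (Isom R)) (wt : Isom R -> R).
Hypothesis S_uniq : uniq S.
Hypothesis muS : forall s, s \in S -> mu [set s] = (wt s)%:E.
Hypothesis mu_compl : mu.-negligible (~` [set` S]).

Local Notation E := (expect S wt).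

Let integral_walkE n (f : plane R -> R) :
  measurable_fun setT (f : mplane R -> R) -> (forall x, 0 <= f x) ->
  (\int[P]_w (f (walk g n w))%:E = (E n f)%:E)%E.
Proof. exact: (integral_walk g_indep g_law S_uniq muS mu_compl). Qed.

Lemma expectD n (f h : plane R -> R) : E n (fun x => f x + h x) = E n f + E n h.
Proof.
elim: n f h => [//|n IH] f h /=; rewrite -big_split; apply: eq_bigr => s _ /=.
by rewrite -mulrDr -IH.
Qed.

Lemma expect1 n : E n (fun=> 1) = 1.
Proof.
have := @integral_walkE n (fun=> 1) (measurable_cst _) (fun=> ler01).
by rewrite integral_cst_probability => -[].
Qed.

Lemma sum_wt : \sum_(s <- S) wt s = 1.
Proof. by rewrite -[RHS](expect1 1) /=; apply: eq_bigr => s _; rewrite mulr1. Qed.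

Lemma exists_walk_law n (phi : plane R -> R) :
  (forall xi b, E n (fun y => cos (xi.1 * y.1 + xi.2 * y.2 + b)) = phi xi * cos b) ->
  exists nu : probability (mplane R) R, has_char nu phi /\
    forall A : set (mplane R), measurable A -> nu A = P [set w | A (walk g n w)].
Proof.
move=> Ephi.
have mX : measurable_fun setT (fun w => walk g n w : mplane R).
  have -> : (fun w => walk g n w : mplane R) = (fun w => tail_walk g 0 n w : mplane R).
    by apply/funext => w; exact: walkE.
  exact: measurable_tail_walk.
pose X : {RV P >-> mplane R} := HB.pack (fun w => walk g n w : mplane R)
  (isMeasurableFun.Build _ _ _ _ _ mX).
exists (distribution P X); split => // xi b.
pose c (y : mplane R) := cos (xi.1 * y.1 + xi.2 * y.2 + b).
have mc : measurable_fun setT c by exact: measurable_cos_affine.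
have intc : (distribution P X).-integrable setT (fun y => (c y)%:E).
  by apply: (@bounded_integrable _ _ _ _ _ 1) => // y; exact: cos_max.
(* [integral_walkE] applies to nonnegative functions, so 1 is added to the cosine and cancelled at
   the end. *)
have c1 y : 0 <= 1 + c y by have := cos_geN1 (xi.1 * y.1 + xi.2 * y.2 + b); rewrite /c; lra.
have m1c : measurable_fun setT (fun y => 1 + c y) by exact: measurable_funD.
have : (\int[distribution P X]_y (1 + c y)%:E = (1 + phi xi * cos b)%:E)%E.
  rewrite ge0_integral_distribution//; last by apply/measurable_EFinP.
  transitivity (\int[P]_w (1 + c (walk g n w))%:E)%E; first by [].
  rewrite (@integral_walkE n (fun y => 1 + c y))//.
  by rewrite (expectD n (fun=> 1) c) expect1 Ephi.
under eq_integral do rewrite EFinD.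
rewrite integralD//; last first.
  by apply: (@bounded_integrable _ _ _ _ _ 1) => // y; rewrite normr1.
rewrite integral_cst_probability EFinD => /eqP; rewrite addeC [eqbRHS]addeC.
have fc : (\int[distribution P X]_y (c y)%:E)%E \is a fin_num by exact: integrable_fin_num.
by rewrite -(fineK fc) -!EFinD eqe => /eqP /addIr ->.
Qed.

Lemma walk_sigmaE : walk_sigma g = Num.sqrt (2^-1 * \sum_(s <- S) wt s * sqnorm (s 0)).
Proof.
rewrite /walk_sigma; congr (Num.sqrt (_ * _)).
have msq : measurable_fun setT (@sqnorm R : mplane R -> R).
  have := measurable_sqnorm_sub (0 : plane R).
  by apply: eq_measurable_fun => x _; rewrite subr0.
have := @integral_walkE 1 (@sqnorm R) msq (@sqnorm_ge0 R).
rewrite /= => H; rewrite unlock.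
transitivity (fine (\int[P]_w (sqnorm (walk g 1 w))%:E)%E); last by rewrite H.
congr fine; apply: eq_integral => w _.
by rewrite walkE /= enorm_sqr.
Qed.

End finite_support.

Variable theta : R.
Let c := cos theta.

(** Common interface of the two types. The sign of [s] is free, so that the more probable rotation
    can always be the one of weight [a]. *)
Definition walk_parameters (p q a b s : R) : Prop :=
  [/\ [/\ 0 <= p, 0 <= q, 0 <= a & 0 <= b], p + q + a + b = 1, 0 < p + q,
      b < a + q & s = sin theta \/ s = - sin theta] /\
  walk_sigma g = Num.sqrt ((p + q) / 2) /\
  forall n, exists nu : probability (mplane R) R,
    has_char nu (char_walk p q a b c s n) /\
    forall A : set (mplane R), measurable A -> nu A = P [set w | A (walk g n w)].

Lemma cos_rho_arg (xi y : plane R) (b : R) :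
  cos (xi.1 * (rho theta y).1 + xi.2 * (rho theta y).2 + b) =
  cos ((rot c (sin theta) xi).1 * y.1 + (rot c (sin theta) xi).2 * y.2 + b).
Proof. by congr cos; rewrite /rot /= /c; ring. Qed.

Lemma littlewood_walk_parameters : littlewood_polynomial theta mu ->
  walk_parameters 0 1 0 0 (sin theta).
Proof.
move=> Hmu.
pose s1 : Isom R := (tau plane_one * rho theta)%g.
pose s2 : Isom R := (tau (- plane_one)%R * rho theta)%g.
have s10 : s1 0 = plane_one.
  by rewrite /s1 /= !mulr0 subr0 addr0 add0r.
have s20 : s2 0 = - plane_one.
  by rewrite /s2 /= !mulr0 subr0 addr0 add0r.
have s12 : s1 <> s2.
  move=> /(congr1 (fun f : Isom R => (f 0).1)); rewrite s10 s20 /=; lra.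
pose S := [:: s1; s2]; pose wt (s : Isom R) : R := 2^-1.
have S_uniq : uniq S by rewrite /= inE andbT; apply/eqP.
have muS s : s \in S -> mu [set s] = (wt s)%:E.
  rewrite !inE => sS; rewrite Hmu; last exact: measurable_isom_set1.
  rewrite -/s1 -/s2 !diracE /wt.
  move: sS => /orP[/eqP ->|/eqP ->].
    rewrite (mem_set (erefl s1 : [set s1] s1)) memNset/= ?adde0 ?mule1//.
    by move=> /esym.
  by rewrite (mem_set (erefl s2 : [set s2] s2)) memNset/= ?add0e ?mule1.
have mS : measurable ([set` S] : set (Isom R)).
  rewrite set_seq_cons set_cons1.
  by apply: measurableU; exact: measurable_isom_set1.
have mu_compl : mu.-negligible (~` [set` S]).
  apply/negligibleP; first exact: measurableC.
  apply: (etrans (Hmu _ (measurableC mS))).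
  rewrite -/s1 -/s2 !diracE !memNset/= ?adde0 ?mule0//.
    by move=> /negP; rewrite !inE eqxx orbT.
  by move=> /negP; rewrite !inE eqxx.
split; first by split; [split|ring|lra|lra|left].
split.
  rewrite (walk_sigmaE S_uniq muS mu_compl) !big_cons big_nil s10 s20 /wt.
  by congr Num.sqrt; rewrite /sqnorm /=; field.
move=> n; apply: (exists_walk_law S_uniq muS mu_compl).
elim: n => [|n IH] xi b.
  by rewrite /= !mulr0 !add0r mul1r.
rewrite /= !big_cons big_nil addr0 /wt /=.
(* A translation after the rotation only shifts the phase by [u * xi.1]; averaging over [u = 1] and
   [u = -1] produces the factor [cos xi.1]. *)
have e1 (v : plane R) (u : R) : v.1 = u -> v.2 = 0 -> expect S wt n
   (fun y => cos (xi.1 * (rho theta y + v).1 + xi.2 * (rho theta y + v).2 + b)) =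
   char_walk 0 1 0 0 c (sin theta) n (rot c (sin theta) xi) * cos (u * xi.1 + b).
  move=> v1 v2; rewrite -IH; congr (expect S wt n); apply/funext => y.
  rewrite -cos_rho_arg /= v1 v2; congr cos; ring.
rewrite (e1 plane_one 1)// (e1 (- plane_one) (-1)) /=; last 2 first.
- by [].
- by rewrite oppr0.
rewrite mul1r mulN1r !cosD cosN sinN /transfer.
by field.
Qed.

Lemma asymmetric_wreath_walk_parameters : sin theta != 0 ->
  asymmetric_wreath_product theta mu ->
  exists p q a b s, walk_parameters p q a b s.
Proof.
move=> sin0 [supp mutau murho].
pose r1 : Isom R := rho theta; pose r2 : Isom R := rho (- theta).
pose t1 : Isom R := tau plane_one; pose t2 : Isom R := tau (- plane_one).
pose S := [:: r1; r2; t1; t2]; pose wt (s : Isom R) : R := fine (mu [set s]).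
have r10 : r1 0 = 0 by rewrite /r1 /= !mulr0 subr0 addr0.
have r20 : r2 0 = 0 by rewrite /r2 /= !mulr0 subr0 addr0.
have t10 : t1 0 = plane_one by rewrite /t1 /= add0r.
have t20 : t2 0 = - plane_one by rewrite /t2 /= add0r.
have r12 : r1 <> r2.
  move=> /(congr1 (fun f : Isom R => (f (1, 0)).2)).
  rewrite /r1 /r2 /= !mulr1 !mulr0 !addr0 sinN => /eqP.
  by rewrite -subr_eq0 opprK -mulr2n mulrn_eq0 (negbTE sin0).
have rt1 : r1 <> t1 by move=> /(congr1 (fun f : Isom R => (f 0).1)); rewrite r10 t10 /=; lra.
have rt2 : r1 <> t2 by move=> /(congr1 (fun f : Isom R => (f 0).1)); rewrite r10 t20 /=; lra.
have rt3 : r2 <> t1 by move=> /(congr1 (fun f : Isom R => (f 0).1)); rewrite r20 t10 /=; lra.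
have rt4 : r2 <> t2 by move=> /(congr1 (fun f : Isom R => (f 0).1)); rewrite r20 t20 /=; lra.
have t12 : t1 <> t2 by move=> /(congr1 (fun f : Isom R => (f 0).1)); rewrite t10 t20 /=; lra.
have S_uniq : uniq S.
  rewrite /S !cons_uniq; apply/and5P; split => //; apply/negP; rewrite !inE.
  - by move=> /or3P[] /eqP.
  - by move=> /orP[] /eqP.
  - by move=> h; case: t12.
have muS s : s \in S -> mu [set s] = (wt s)%:E.
  move=> _; rewrite /wt fineK//; apply: fin_num_measure; exact: measurable_isom_set1.
have SE : [set` S] = topological_support mu.
  by rewrite supp /S !set_seq_cons set_nil setU0 !setUA.
have mu_compl : mu.-negligible (~` [set` S]).
  rewrite SE; exact: null_compl_topological_support.
have mS : measurable ([set` S] : set (Isom R)).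
  rewrite !set_seq_cons set_nil setU0.
  by do 3 (apply: measurableU; first exact: measurable_isom_set1);
    exact: measurable_isom_set1.
pose pt := wt t1; pose A := wt r1; pose B := wt r2.
have tE : wt t2 = pt by rewrite /pt /wt mutau.
have A0 : 0 <= A by rewrite fine_ge0.
have B0 : 0 <= B by rewrite fine_ge0.
have pt0 : 0 < pt.
  (* An open set that meets the support in [t1] alone: the other three isometries send 0 to 0 or to
     [- plane_one]. *)
  pose U := [set f : Isom R | 2^-1 < (f 0).1].
  have oU : open U.
    have cU : continuous (fun f : Isom R => (f 0).1).
      move=> f; apply: (continuous_comp (@isom_eval_continuous R 0 f)); exact: cvg_fst.
    have -> : U = (fun f : Isom R => (f 0).1) @^-1` `]2^-1, +oo[.
      by apply/seteqP; split => f; rewrite /U /= in_itv/= andbT.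
    by move: cU => /continuousP; apply; exact: interval_open.
  have Ut1 : U t1 by rewrite /U /= add0r /=; lra.
  have : topological_support mu t1 by rewrite supp; left; right.
  move=> /(_ U oU Ut1) muU.
  rewrite -lte_fin -muS ?inE ?eqxx ?orbT//.
  apply: (lt_le_trans muU).
  apply: (@le_trans _ _ (mu ([set t1] `|` ~` [set` S])))%E.
    apply: le_measure; rewrite ?inE.
    - exact: sub_sigma_algebra.
    - by apply: measurableU; [exact: measurable_isom_set1|exact: measurableC].
    move=> f /= Uf; have [fS|fS] := boolP (f \in S); last by right; apply/negP.
    left; move: fS Uf; rewrite !inE => /or4P[] /eqP -> //; rewrite /U.
    - by move=> Uf; exfalso; move: (Uf : 2^-1 < (r1 0).1); rewrite r10 /=; lra.
    - by move=> Uf; exfalso; move: (Uf : 2^-1 < (r2 0).1); rewrite r20 /=; lra.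
    - by move=> Uf; exfalso; move: (Uf : 2^-1 < (t2 0).1); rewrite t20 /=; lra.
  apply: (le_trans (measureU2 _ _ _)) => //; first exact: measurable_isom_set1.
    exact: measurableC.
  by rewrite (measure_negligible (measurableC mS) mu_compl) adde0.
have AB : A <> B.
  move=> AB; apply: murho; rewrite -/r1 -/r2 !muS ?inE ?eqxx ?orbT//.
  by rewrite -/A -/B AB.
have sumE : 2 * pt + 0 + A + B = 1.
  have := sum_wt S_uniq muS mu_compl.
  by rewrite !big_cons big_nil tE -/pt -/A -/B; lra.
have sgE : walk_sigma g = Num.sqrt ((2 * pt + 0) / 2).
  rewrite (walk_sigmaE S_uniq muS mu_compl) !big_cons big_nil r10 r20 t10 t20 tE -/pt.
  by congr Num.sqrt; rewrite /sqnorm /=; field.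
have main n xi b : expect S wt n (fun y => cos (xi.1 * y.1 + xi.2 * y.2 + b)) =
   char_walk (2 * pt) 0 A B c (sin theta) n xi * cos b.
  elim: n xi b => [|n IH] xi b.
    by rewrite /= !mulr0 !add0r mul1r.
  rewrite /= !big_cons big_nil addr0 tE -/pt -/A -/B.
  have f1 : (fun y => cos (xi.1 * y.1 + xi.2 * y.2 + b)) \o r1 =
     (fun y => cos ((rot c (sin theta) xi).1 * y.1 + (rot c (sin theta) xi).2 * y.2 + b)).
    by apply/funext => y /=; rewrite -cos_rho_arg.
  have f2 : (fun y => cos (xi.1 * y.1 + xi.2 * y.2 + b)) \o r2 =
     (fun y => cos ((rot c (- sin theta) xi).1 * y.1 + (rot c (- sin theta) xi).2 * y.2 + b)).
    by apply/funext => y /=; rewrite cosN sinN /c; congr cos; ring.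
  have f3 : (fun y => cos (xi.1 * y.1 + xi.2 * y.2 + b)) \o t1 =
     (fun y => cos (xi.1 * y.1 + xi.2 * y.2 + (xi.1 + b))).
    by apply/funext => y /=; congr cos; ring.
  have f4 : (fun y => cos (xi.1 * y.1 + xi.2 * y.2 + b)) \o t2 =
     (fun y => cos (xi.1 * y.1 + xi.2 * y.2 + (- xi.1 + b))).
    by apply/funext => y /=; congr cos; ring.
  by rewrite f1 f2 f3 f4 !IH !cosD cosN sinN /transfer; ring.
(* Exchanging the weights of the two rotations amounts to changing the sign of the sine, which
   reduces the case [A < B] to the other one. *)
have swap n : char_walk (2 * pt) 0 A B c (sin theta) n =
    char_walk (2 * pt) 0 B A c (- sin theta) n.
  elim: n => //= n ->; apply/funext => z; rewrite /transfer opprK; ring.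
have [BA|BA] := ltP B A.
  exists (2 * pt), 0, A, B, (sin theta); split.
    by split; [split=> //; lra|exact: sumE|lra|lra|left].
  split => // n; apply: (exists_walk_law S_uniq muS mu_compl) => xi b.
  exact: main.
have {}BA : A < B by rewrite lt_neqAle BA andbT; apply/eqP.
exists (2 * pt), 0, B, A, (- sin theta); split.
  by split; [split=> //; lra|lra|lra|lra|right].
split => // n; apply: (exists_walk_law S_uniq muS mu_compl) => xi b.
by rewrite -swap; exact: main.
Qed.

End characteristic_function_of_the_walk.

(** * Comparison of the walk with the Gaussian *)

Lemma normal_peak_sqr_le {R : realType} (s : R) : 0 < s ->
  normal_peak s ^+ 2 <= (s ^+ 2)^-1.
Proof.
move=> s0; have s2 : 0 < s ^+ 2 by rewrite exprn_gt0.
have pi2 := @pi_ge2 R.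
have le : s ^+ 2 <= s ^+ 2 * pi *+ 2.
  by rewrite -mulr_natr -mulrA ler_peMr// ?ltW//; lra.
have pos : 0 < s ^+ 2 * pi *+ 2 by exact: lt_le_trans le.
by rewrite /normal_peak exprVn (sqr_sqrtr (ltW pos)) lef_pV2.
Qed.

Section dilated_gaussian.
Context {R : realType}.
Variable k : R.
Hypothesis k0 : 0 < k.

Lemma measurable_dilation : measurable_fun setT (dilation k : mplane R -> mplane R).
Proof. by apply/measurable_fun_pairP; split; apply: measurable_funM. Qed.

Let X : {RV (gauss2 (0 : plane R)%R 1) >-> mplane R} :=
  HB.pack (dilation k : mplane R -> mplane R)
    (isMeasurableFun.Build _ _ _ _ _ measurable_dilation).

Definition dilated_gaussian : probability (mplane R) R :=
  distribution (gauss2 (0 : plane R)%R 1) X.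

Lemma dilated_gaussian_char :
  has_char dilated_gaussian (fun xi => expR (- (k ^+ 2 * sqnorm xi / 2))).
Proof.
move=> xi b; have mc := measurable_cos_affine xi b.
rewrite integral_distribution/=; last 2 first.
- exact/measurable_EFinP.
- apply: (@bounded_integrable _ _ _ _ _ 1) => [|y]; last exact: cos_max.
  exact: (measurableT_comp mc measurable_dilation).
have := @integral_gauss2_cos R (dilation k xi) 1 b ltr01.
rewrite /sqnorm /= expr1n mul1r => H.
transitivity (\int[gauss2 (0 : plane R)%R 1]_x
   (cos (k * xi.1 * x.1 + k * xi.2 * x.2 + b))%:E)%E.
  by apply: eq_integral => x _; congr (cos _)%:E; rewrite /dilation /=; ring.
by rewrite H; congr (expR (- _) * _)%:E; ring.
Qed.

(** The density is at most [1 / k ^ 2], and the unit ball has area at most 4, that of the enclosing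
    square. *)
Lemma dilated_gaussian_annulus (x0 : plane R) (r r' : R) : 0 < r -> r <= r' ->
  (dilated_gaussian (eball x0 r') <=
   dilated_gaussian (eball x0 r) + (4 * (r' ^+ 2 - r ^+ 2) / k ^+ 2)%:E)%E.
Proof.
move=> r0 rr'; have r'0 : 0 < r' by exact: lt_le_trans rr'.
have mB := measurable_eball x0 r; have mB' := measurable_eball x0 r'.
have BB' : eball x0 r `<=` eball x0 r' by move=> x /= /lt_le_trans; apply.
pose A : set (mplane R) := eball x0 r' `\` eball x0 r.
have mA : measurable A by exact: measurableD.
have AE : eball x0 r' = eball x0 r `|` A by rewrite setDUK.
rewrite {1}AE; apply: (le_trans (measureU2 _ _ _)) => //.
apply: leeD2l.
have mpre : measurable ((fun x : mplane R => dilation k x : mplane R) @^-1` A).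
  by rewrite -[X in measurable X]setTI; exact: measurable_dilation.
apply: (le_trans (gauss2_le_area (0 : plane R)%R ltr01 mpre)).
have areaA : area A = ((r' ^+ 2 - r ^+ 2)%:E * area (eball (0 : plane R)%R 1%R))%E.
  have fin_ball (v : R) : 0 < v -> area (eball x0 v) \is a fin_num.
    by move=> v0; rewrite area_eball// fin_numM// area_unit_ball_fin.
  have -> : area A = (area (eball x0 r') - area (eball x0 r' `&` eball x0 r))%E.
    by apply: measureD => //; rewrite ltey_eq fin_ball.
  rewrite (setIidr BB') (area_eball x0 r'0) (area_eball x0 r0).
  by rewrite -(fineK (@area_unit_ball_fin R)) -!EFinM -EFinB mulrBl.
have := area_affine (0 : plane R) k0 mA.
rewrite (_ : (fun x : mplane R => _) = (dilation k : mplane R -> mplane R)); last first.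
  by apply/funext => x /=; rewrite /dilation !add0r.
rewrite areaA => eqA.
have k2 : 0 < k ^+ 2 by rewrite exprn_gt0.
have pk := @normal_peak_sqr_le R 1 ltr01; rewrite expr1n invr1 in pk.
apply: (@le_trans _ _ (area (dilation k @^-1` A))).
  rewrite -[leRHS]mul1e; exact: lee_wpmul2r.
have -> : area (dilation k @^-1` A) =
    ((k ^+ 2)^-1%:E * ((r' ^+ 2 - r ^+ 2)%:E * area (eball (0 : plane R)%R 1%R)))%E.
  by rewrite eqA muleA -EFinM mulVf ?mul1e// gt_eqF.
have d0 : 0 <= r' ^+ 2 - r ^+ 2 by rewrite subr_ge0 lerXn2r ?nnegrE// ltW.
apply: (@le_trans _ _ ((k ^+ 2)^-1%:E * ((r' ^+ 2 - r ^+ 2)%:E * 4%:E))%E).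
  apply: lee_wpmul2l; first by rewrite lee_fin invr_ge0 ltW.
  by apply: lee_wpmul2l; [rewrite lee_fin|exact: area_unit_ball_le].
by rewrite -!EFinM lee_fin mulrC [_ * 4]mulrC.
Qed.

End dilated_gaussian.

Section comparison_with_gaussian.
Context {R : realType}.
Variables p q a b c s : R.
Hypotheses (p0 : 0 <= p) (q0 : 0 <= q) (a0 : 0 <= a) (b0 : 0 <= b).
Hypothesis pqab : p + q + a + b = 1.
Hypothesis cs : c ^+ 2 + s ^+ 2 = 1.

Local Notation phi := (char_walk p q a b c s).

Lemma char_walk_norm_le1 n z : `|phi n z| <= 1.
Proof.
suff H y : sqnorm y = sqnorm z -> p * `|cos y.1| * 1 + (a + q * `|cos y.1|) * 1 + b * 1 <= 1 * 1.
  have := char_walk_le_supersolution (h := fun=> 1) p0 q0 a0 b0 cs (fun _ _ => lexx _) H ler01 n erefl.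
  by rewrite expr1n mulr1.
move=> _; have := @cos_max R y.1.
move=> c1; have := ler_piMr p0 c1; have := ler_piMr q0 c1; move: pqab; rewrite !mulr1; lra.
Qed.

Lemma measurable_rot (v : R) : measurable_fun setT (rot c v : mplane R -> mplane R).
Proof.
apply/measurable_fun_pairP; split.
  by apply: measurable_funD; apply: measurable_funM.
by apply: measurable_funB; apply: measurable_funM.
Qed.

Lemma measurable_char_walk n : measurable_fun setT (phi n : mplane R -> R).
Proof.
elim: n => [|n IH]; first exact: measurable_cst.
have mc : measurable_fun setT (fun z : mplane R => cos z.1).
  have := measurable_cos_affine (1, 0 : R) (0 : R).
  by apply: eq_measurable_fun => z _ /=; rewrite mul1r mul0r !addr0.
rewrite /char_walk iterS -/(phi n) /transfer.
apply: measurable_funD; [apply: measurable_funD|]; apply: measurable_funM => //.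
- by apply: measurable_funM.
- by apply: measurable_funD => //; apply: measurable_funM.
- exact: (measurableT_comp IH (measurable_rot s)).
- exact: (measurableT_comp IH (measurable_rot (- s))).
Qed.

Hypothesis pq0 : 0 < p + q.
Hypothesis baq : b < a + q.
Hypothesis s0 : s != 0.
Hypothesis cQ : exists r : rat, c = ratr r.
Hypothesis c2 : forall k : int, c <> k%:~R / 2.

Let w := (p + q) / 4.

(** Each term is the bound for one range of frequencies: [sqnorm eta <= xi], then up to [4 ^ m],
    then beyond, where the last term is at least the trivial bound 2. The coefficient 3 is 2 for
    [phi] and 1 for the Gaussian. *)
Lemma char_walk_gaussian_comparison : exists kap K : R, [/\ 0 < kap, 0 < K &
  forall N m (delta : R) eta, (0 < N)%N ->
  `|phi N eta - expR (- (w * N%:R * sqnorm eta))| <=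
    K / N%:R * expR (- (w / 4 * N%:R) * sqnorm eta) +
    3 * expR (- (kap * N%:R / m.+1%:R)) +
    2 * expR (- (delta ^+ 2 * (2 ^+ m) ^+ 2 / 4)) *
      expR (delta ^+ 2 / 4 * sqnorm eta)].
Proof.
have w0 : 0 < w by rewrite divr_gt0.
have qab0 : 0 < a + q + b by move: baq b0; lra.
have [xi [K [xi0 K0 low]]] :=
  char_walk_low_frequency p0 q0 a0 b0 pqab cs s0 pq0 qab0.
have [eps [e0 e1 high]] := exists_rotation_small_cos cs cQ c2 xi0.
(* The last division by 2 comes from the window length [m.*2.+2], twice [m.+1]. *)
pose k1 := (a + q - b) * ((p + q) * eps) / 4 / 2.
have k10 : 0 < k1 by rewrite !(divr_gt0, mulr_gt0)// subr_gt0.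
exists (Num.min k1 (w * xi)), K; split => //.
  by rewrite lt_min k10 mulr_gt0.
set kap := Num.min _ _.
have kap1 : kap <= k1 by rewrite ge_min lexx.
have kap2 : kap <= w * xi by rewrite ge_min lexx orbT.
have kap0 : 0 < kap by rewrite lt_min k10 mulr_gt0.
move=> N m delta eta N0.
have N0' : 0 < N%:R :> R by rewrite ltr0n.
set T1 := K / _ * _; set T2 := 3 * _; set T3 := 2 * _ * _.
have T10 : 0 <= T1 by rewrite mulr_ge0 ?expR_ge0// divr_ge0// ltW.
have T20 : 0 <= T2 by rewrite mulr_ge0 ?expR_ge0.
have T30 : 0 <= T3 by rewrite !mulr_ge0 ?expR_ge0.
have [lo|hi] := leP (sqnorm eta) xi.
  apply: (@le_trans _ _ T1); first by rewrite /T1 mulNr; exact: low.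
  by rewrite -addrA lerDl addr_ge0.
have n0 := sqnorm_ge0 eta.
have [md|vh] := leP (sqnorm eta) ((2 ^+ m) ^+ 2).
  have g1 : `|phi N eta| <= 2 * expR (- (kap * N%:R / m.+1%:R)).
    apply: (le_trans (@char_walk_decay R p q a b c s p0 q0 a0 b0 pqab cs
      (sqnorm eta) eps m.*2.+2 baq e0 e1 _ N eta erefl)).
      by move=> z ze; apply: high; rewrite ze// ltW.
    rewrite ler_pM2l// ler_expR lerN2.
    have -> : (a + q - b) * ((p + q) * eps) / 4 * N%:R / m.*2.+2%:R =
        k1 * N%:R / m.+1%:R.
      rewrite -doubleS -mul2n natrM /k1.
      by field; rewrite addrC natr1 pnatr_eq0.
    by rewrite ler_pM2r ?invr_gt0 ?ltr0n// ler_pM2r.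
  have g2 : expR (- (w * N%:R * sqnorm eta)) <= expR (- (kap * N%:R / m.+1%:R)).
    rewrite ler_expR lerN2; apply: (@le_trans _ _ (kap * N%:R)).
      by rewrite ler_pdivrMr ?ltr0n// ler_peMr ?ler1n// mulr_ge0 ?(ltW kap0) ?(ltW N0').
    apply: (@le_trans _ _ (w * xi * N%:R)); first by rewrite ler_pM2r.
    by rewrite mulrAC ler_pM2l ?mulr_gt0// ltW.
  have g3 := expR_ge0 (- (w * N%:R * sqnorm eta)).
  have := ler_normB (phi N eta) (expR (- (w * N%:R * sqnorm eta))).
  rewrite (ger0_norm g3) => H; apply: (le_trans H).
  apply: (@le_trans _ _ T2); first by rewrite /T2; lra.
  by rewrite addrAC lerDr addr_ge0.
have g1 := char_walk_norm_le1 N eta.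
have g2 : expR (- (w * N%:R * sqnorm eta)) <= 1.
  by rewrite expR_le1 oppr_le0 mulr_ge0// mulr_ge0// ltW.
have g3 := expR_ge0 (- (w * N%:R * sqnorm eta)).
have := ler_normB (phi N eta) (expR (- (w * N%:R * sqnorm eta))).
rewrite (ger0_norm g3) => H; apply: (le_trans H).
have : 2 <= T3.
  rewrite /T3 -mulrA -expRD ler_peMr//; apply: le_trans (expR_ge1Dx _).
  rewrite lerDl.
  rewrite (_ : - _ + _ = delta ^+ 2 * (sqnorm eta - (2 ^+ m) ^+ 2) / 4); last by field.
  by rewrite divr_ge0// mulr_ge0 ?sqr_ge0// subr_ge0 ltW.
by move: T10 T20 g1 g2; lra.
Qed.

End comparison_with_gaussian.

(** The differences are [4 r t + 4 t ^ 2] and [4 r t - 4 t ^ 2]; [X] will be [r ^ 2 / N]. *)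
Lemma sqr_annulus_le {R : realType} (r t X : R) : r * t = X -> t ^+ 2 <= X ->
  (r + 2 * t) ^+ 2 - r ^+ 2 <= 8 * X /\ r ^+ 2 - (r - 2 * t) ^+ 2 <= 8 * X.
Proof. by move=> <- tr; have := sqr_ge0 t; split; lra. Qed.

Section ball_estimate.
Context {R : realType}.
Variables p q a b c s : R.
Hypotheses (p0 : 0 <= p) (q0 : 0 <= q) (a0 : 0 <= a) (b0 : 0 <= b).
Hypothesis pqab : p + q + a + b = 1.
Hypothesis cs : c ^+ 2 + s ^+ 2 = 1.
Hypothesis pq0 : 0 < p + q.
Hypothesis baq : b < a + q.
Hypothesis s0 : s != 0.
Hypothesis cQ : exists r : rat, c = ratr r.
Hypothesis c2 : forall k : int, c <> k%:~R / 2.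

Local Notation phi := (char_walk p q a b c s).

Let w := (p + q) / 4.

(* The ball is enlarged by [2 r / N] and smoothed at scale [delta = r / N ^ 2];
   frequencies beyond [N / delta = N ^ 3 / r] are negligible. *)
Lemma char_walk_ball_estimate : exists kap C : R, [/\ 0 < kap, 0 < C &
  forall (nu : probability (mplane R) R) N m (r : R) (x0 : plane R),
  has_char nu (phi N) -> (3 <= N)%N -> 0 < r -> N%:R ^+ 3 / r <= 2 ^+ m ->
  expR (- (kap * N%:R / m.+1%:R)) <= r ^+ 2 / N%:R ^+ 6 ->
  expR (- (N%:R ^+ 2 / 4)) <= r ^+ 2 / N%:R ^+ 6 ->
  let nu' := dilated_gaussian (Num.sqrt ((p + q) / 2) * Num.sqrt N%:R) in
  (nu (eball x0 r) <= nu' (eball x0 r) + (C * (r ^+ 2 / N%:R ^+ 2))%:E)%E /\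
  (nu' (eball x0 r) <= nu (eball x0 r) + (C * (r ^+ 2 / N%:R ^+ 2))%:E)%E].
Proof.
have w0 : 0 < w by rewrite divr_gt0.
have [kap [K [kap0 K0 cmp]]] :=
  char_walk_gaussian_comparison p0 q0 a0 b0 pqab cs pq0 baq s0 cQ c2.
(* In units of [delta ^ 2 / N ^ 2 = r ^ 2 / N ^ 6], low frequencies contribute [2 K / w], middle
   ones 3, and the growing weight, of mean 2, contributes 4. *)
pose K1 := 2 * K / w + 7.
have K10 : 0 < K1 by rewrite addr_gt0// divr_gt0// mulr_gt0.
(* The smoothing tails give 4, the kernel error [16 * K1], and the Gaussian mass of the annulus
   [16 / w]. *)
exists kap, (4 + 16 * K1 + 16 / w); split => //.
  by rewrite addr_gt0 ?(divr_gt0 _ w0)// addr_gt0// mulr_gt0.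
move=> nu N m r x0 nuphi N3 r0 Nm e1 e2.
have n3 : 3 <= N%:R :> R by rewrite ler_nat.
set n : R := N%:R in n3 Nm e1 e2 *.
have n0 : 0 < n by lra.
have n1 : 1 <= n by lra.
set k := _ * _.
have k0 : 0 < k by rewrite mulr_gt0// sqrtr_gt0// divr_gt0.
have k2 : k ^+ 2 = 2 * w * n.
  by rewrite exprMn !sqr_sqrtr ?divr_ge0 ?ltW// /w; field.
set nu' := dilated_gaussian k => /=.
pose phi' (xi : plane R) := expR (- (k ^+ 2 * sqnorm xi / 2)).
have phi'E xi : phi' xi = expR (- (w * n * sqnorm xi)).
  by rewrite /phi' k2; congr (expR (- _)); field.
have nu'phi : has_char nu' phi' by exact: dilated_gaussian_char.
have mphi := measurable_char_walk p q a b c s N.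
have mphi' : measurable_fun setT (phi' : mplane R -> R).
  rewrite (_ : phi' = (fun xi => expR (- (w * n) * sqnorm (xi - 0)))).
    exact: measurable_expR_sqnorm_sub.
  by apply/funext => xi; rewrite phi'E subr0 mulNr.
have phi1 eta : `|phi N eta| <= 1 by exact: char_walk_norm_le1.
have phi'1 eta : `|phi' eta| <= 1.
  by rewrite phi'E ger0_norm ?expR_ge0// expR_le1 oppr_le0 mulr_ge0 ?sqnorm_ge0// mulr_ge0// ltW.
pose delta := r / n ^+ 2; pose t := r / n; pose e := r ^+ 2 / n ^+ 6.
have delta0 : 0 < delta by rewrite divr_gt0// exprn_gt0.
have t0 : 0 < t by rewrite divr_gt0.
have e0 : 0 < e by rewrite divr_gt0// exprn_gt0.
have nn0 : n != 0 by rewrite gt_eqF.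
have rn0 : r != 0 by rewrite gt_eqF.
have wn0 : w != 0 by rewrite gt_eqF.
have eE : e = delta ^+ 2 / n ^+ 2 by rewrite /e /delta; field.
have tail1 : expR (- (t ^+ 2 / (4 * delta ^+ 2))) <= e.
  rewrite (_ : _ / _ = n ^+ 2 / 4)//; rewrite /t /delta; field.
  by rewrite nn0 rn0.
have tail2 : expR (- (delta ^+ 2 * (2 ^+ m) ^+ 2 / 4)) <= e.
  apply: le_trans e2; rewrite ler_expR lerN2 ler_pM2r ?invr_gt0// -exprMn.
  suff nd : n <= delta * 2 ^+ m by rewrite !expr2 ler_pM// ltW.
  rewrite -(ler_pdivrMl _ _ delta0) (le_trans _ Nm)// /delta.
  by rewrite (_ : _^-1 * n = n ^+ 3 / r)//; field; rewrite rn0.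
pose h := 3 * e; pose bb := 2 * e.
pose aa := K / n; pose u := w / 4 * n.
have u0 : 0 < u by rewrite mulr_gt0// divr_gt0.
have aa0 : 0 <= aa by rewrite divr_ge0// ltW.
have h0 : 0 <= h by rewrite mulr_ge0// ltW.
have bb0 : 0 <= bb by rewrite mulr_ge0// ltW.
have bound eta : `|phi N eta - phi' eta| <= aa * expR (- u * sqnorm eta) + h +
    bb * expR (delta ^+ 2 / 4 * sqnorm eta).
  rewrite phi'E; apply: (le_trans (cmp N m delta eta _)); first by apply: leq_trans N3.
  rewrite lerD ?lerD// ?ler_pM2l//.
  by rewrite ler_wpM2r ?expR_ge0// ler_pM2l.
have bound' eta : `|phi' eta - phi N eta| <= aa * expR (- u * sqnorm eta) + h +
    bb * expR (delta ^+ 2 / 4 * sqnorm eta) by rewrite distrC.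
pose E := aa * (delta ^+ 2 / (2 * u)) + h + 2 * bb.
have EE : E = K1 * (delta ^+ 2 / n ^+ 2).
  by rewrite /E /h /bb eE /aa /u /K1; field; rewrite nn0 wn0.
have E0 : 0 <= E by rewrite EE mulr_ge0 ?(ltW K10)// divr_ge0 ?sqr_ge0.
have rest (r1 : R) : 0 < r1 -> r1 <= r ->
  4 * expR (- (t ^+ 2 / (4 * delta ^+ 2))) +
  normal_peak delta ^+ 2 * E * (4 * (r1 + t) ^+ 2) <= (4 + 16 * K1) * (r ^+ 2 / n ^+ 2).
  move=> r10 r1r; rewrite [leRHS]mulrDl; apply: lerD.
    rewrite ler_pM2l// (le_trans tail1)// /e ler_pM2l ?exprn_gt0//.
    by rewrite lef_pV2 ?posrE ?exprn_gt0// ler_weXn2l.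
  have tr : t <= r by rewrite ler_pdivrMr// ler_peMr// ltW.
  have sq : 4 * (r1 + t) ^+ 2 <= 16 * r ^+ 2.
    have r1t0 : 0 <= r1 + t by rewrite ltW// addr_gt0.
    have r1t : r1 + t <= 2 * r by rewrite mulr2n mulrDl !mul1r lerD.
    rewrite (_ : 16 * r ^+ 2 = 4 * (2 * r) ^+ 2); last by ring.
    by rewrite ler_pM2l// !expr2 ler_pM.
  have d2 : 0 < delta ^+ 2 by rewrite exprn_gt0.
  have pkE : normal_peak delta ^+ 2 * E <= K1 / n ^+ 2.
    apply: (@le_trans _ _ ((delta ^+ 2)^-1 * E)).
      by rewrite ler_wpM2r// normal_peak_sqr_le.
    by rewrite EE mulrCA mulKf ?gt_eqF.
  apply: (@le_trans _ _ (K1 / n ^+ 2 * (16 * r ^+ 2))).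
    apply: ler_pM => //; first by rewrite mulr_ge0 ?sqr_ge0.
    by rewrite mulr_ge0 ?sqr_ge0.
  by rewrite (_ : _ * (16 * _) = 16 * K1 * (r ^+ 2 / n ^+ 2))//; field.
have annulus (r1 r2 : R) : 0 < r1 -> r1 <= r2 -> r2 ^+ 2 - r1 ^+ 2 <= 8 * (r ^+ 2 / n) ->
  (nu' (eball x0 r2) <= nu' (eball x0 r1) + (16 / w * (r ^+ 2 / n ^+ 2))%:E)%E.
  move=> r10 r12 rr; apply: (le_trans (dilated_gaussian_annulus k0 x0 r10 r12)).
  rewrite leeD2l// lee_fin k2.
  apply: (@le_trans _ _ (4 * (8 * (r ^+ 2 / n)) / (2 * w * n))).
    by rewrite ler_pM2r ?invr_gt0 ?mulr_gt0// ler_pM2l.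
  rewrite [leLHS](_ : _ = 16 / w * (r ^+ 2 / n ^+ 2))//.
  by field; rewrite nn0 wn0.
have tn : t * n = r by rewrite /t divfK.
have t2 : t ^+ 2 <= r ^+ 2 / n.
  rewrite /t exprMn ler_pM2l ?exprn_gt0// exprVn lef_pV2 ?posrE ?exprn_gt0//.
  by rewrite expr2 ler_peMr// ltW.
have rt : r * t = r ^+ 2 / n by rewrite /t; field.
have r3t : 3 * t <= r by rewrite -tn mulrC ler_pM2l.
have Ck : (4 + 16 * K1 + 16 / w) * (r ^+ 2 / n ^+ 2) =
   16 / w * (r ^+ 2 / n ^+ 2) + (4 + 16 * K1) * (r ^+ 2 / n ^+ 2).
  by rewrite addrC mulrDl addrC.
have C0 : 0 <= 16 / w * (r ^+ 2 / n ^+ 2) by rewrite mulr_ge0 ?divr_ge0 ?sqr_ge0 ?ltW.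
have tt0 : 0 <= 2 * t by rewrite mulr_ge0// ltW.
have r10 : 0 < r - 2 * t.
  by rewrite subr_gt0; apply: lt_le_trans r3t; rewrite ltr_pM2r// ltr_nat.
have r1r : r - 2 * t <= r by rewrite gerBl.
have rr2 : r <= r + 2 * t by rewrite lerDl.
have [ann1 ann2] := sqr_annulus_le rt t2.
rewrite Ck EFinD; split.
  apply: (le_trans (gaussian_smoothing delta0 x0 t0 r0 E0
    (fun x => kernel_comparison delta0 x nuphi nu'phi mphi mphi' phi1 phi'1 aa0 u0 h0 bb0 bound))).
  rewrite addeA; apply: leeD.
    exact: (annulus r (r + 2 * t) r0 rr2 ann1).
  by rewrite lee_fin; apply: rest.
(* The reverse inequality exchanges the two measures and starts from the radius [r - 2 * t],
   positive because [N >= 3]. *)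
have H := gaussian_smoothing delta0 x0 t0 r10 E0
    (fun x => kernel_comparison delta0 x nu'phi nuphi mphi' mphi phi'1 phi1 aa0 u0 h0 bb0 bound').
rewrite subrK in H.
apply: (@le_trans _ _ (nu' (eball x0 (r - 2 * t)) + (16 / w * (r ^+ 2 / n ^+ 2))%:E)%E).
  exact: annulus.
rewrite [X in (_ <= _ + X)%E]addeC addeA; apply: leeD => //; apply: (le_trans H).
by apply: leeD => //; rewrite lee_fin; apply: rest.
Qed.

End ball_estimate.

(** * Choice of the frequency cutoff *)

Section subexponential_scales.
Context {R : realType}.

Lemma expR_half_le2 : expR (2^-1) <= 2 :> R.
Proof.
have h := expR_ge1Dx (- 2^-1 : R); rewrite expRN in h.
rewrite -[leLHS]invrK -[leRHS]invrK lef_pV2 ?posrE ?invr_gt0 ?expR_gt0//.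
by apply: le_trans h; lra.
Qed.

(** The slope [y] can be made arbitrarily small at the price of a constant. *)
Lemma ln_le_affine (y x : R) : 0 < y -> 0 < x -> ln x <= y * x - ln y.
Proof.
move=> y0 x0; rewrite lerBrDl -lnM ?posrE// ltW// ln_sublinear// mulr_gt0//.
Qed.

(* [m] is of order [log (N ^ 3 / r)], at most a small multiple of [sqrt N], so
   that [N / m] exceeds a large multiple of [m]. *)
Lemma exists_frequency_cutoff (kap : R) : 0 < kap -> exists c N0, [/\ 0 < c, (3 <= N0)%N &
  forall N (r : R), (N0 <= N)%N -> expR (- (c * Num.sqrt N%:R)) < r ->
  exists m, [/\ N%:R ^+ 3 / r <= 2 ^+ m,
    expR (- (kap * N%:R / m.+1%:R)) <= r ^+ 2 / N%:R ^+ 6 &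
    expR (- (N%:R ^+ 2 / 4)) <= r ^+ 2 / N%:R ^+ 6]].
Proof.
(* Write [X] for [sqrt N]. From [k ^ 2 <= kap] and [m + 1 <= k X] follows
   [kap * N / (m + 1) >= k X]; the bound [k <= 1 / 2] serves the term [exp(- N ^ 2 / 4)]. *)
move=> kap0; pose k := Num.sqrt (Num.min kap (1 / 4)).
have m0 : 0 < Num.min kap (1 / 4) by rewrite lt_min kap0; lra.
have k0 : 0 < k by rewrite sqrtr_gt0.
have k2 : k ^+ 2 = Num.min kap (1 / 4) by rewrite sqr_sqrtr// ltW.
have kkap : k ^+ 2 <= kap by rewrite k2 ge_min lexx.
have kh : k <= 1 / 2.
  rewrite -(@ler_pXn2r _ 2)// ?nnegrE ?(ltW k0)// k2 ge_min; apply/orP; right.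
  by rewrite (_ : (1 / 2) ^+ 2 = 1 / 4)//; field.
(* The logarithm bound gives [Q + 2 <= 8 c X + K2]: the first term is half of [k X] for
   [c = k / 16], and [N >= N0] puts [K2] below the other half. *)
pose c := k / 16; have c0 : 0 < c by rewrite divr_gt0.
pose K2 := 2 - 12 * ln (c / 2).
pose N0 := maxn 3 (Num.truncn ((2 * K2 / k) ^+ 2)).+1.
exists c, N0; split => //; first by rewrite leq_maxl.
move=> N r N0N; set X := Num.sqrt _ => cr.
have n3 : 3 <= N%:R :> R by rewrite ler_nat (leq_trans (leq_maxl _ _) N0N).
have XK : 2 * K2 / k <= X.
  apply: le_trans (ler_norm _) _; rewrite -sqrtr_sqr ler_wsqrtr//.
  apply: ltW; apply: lt_le_trans (truncnS_gt _) _.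
  by rewrite ler_nat (leq_trans (leq_maxr _ _) N0N).
set n : R := N%:R in X cr n3 XK *.
have n0 : 0 < n by lra.
have X0 : 0 < X by rewrite sqrtr_gt0.
have X2 : X ^+ 2 = n by rewrite sqr_sqrtr// ltW.
have r0 : 0 < r by exact: lt_trans (expR_gt0 _) cr.
pose L := ln n; have nL : n = expR L by rewrite lnK.
have L0 : 0 <= L by rewrite ln_ge0//; lra.
have LX : L <= c * X - 2 * ln (c / 2).
  have := @ln_le_affine (c / 2) X _ X0; rewrite divr_gt0// => /(_ isT).
  by rewrite /L -X2 lnXn// -mulr_natl; lra.
(* [exp(- Q)] is the square of [exp(- c X) / N ^ 3], hence below [r ^ 2 / N ^ 6], and likewise
   [N ^ 3 / r <= exp(Q / 2)]. *)
pose Q := 6 * L + 2 * (c * X).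
have cX0 : 0 < c * X by rewrite mulr_gt0.
have Q0 : 0 <= Q by apply: addr_ge0; apply: mulr_ge0 => //; exact: ltW.
have QX : Q + 2 <= k * X.
  have : K2 <= k * X / 2.
    by move: XK; rewrite ler_pdivrMr// [X * k]mulrC; lra.
  have : 16 * (c * X) = k * X by rewrite /c; field.
  rewrite /Q; move: LX; rewrite /K2; move: (c * X) (k * X) => u v; lra.
pose m := (Num.truncn Q).+1; exists m.
have [mQ Qm] : m%:R <= Q + 1 /\ Q <= m%:R.
  by have /andP[h1 h2] := truncn_itv Q0; rewrite (ltW h2) /m -natr1 lerD2r.
have eQ : expR (- (Q + 2)) <= r ^+ 2 / n ^+ 6.
  apply: (@le_trans _ _ (expR (- Q))); first by rewrite ler_expR; lra.
  have -> : expR (- Q) = expR (- (c * X)) ^+ 2 / n ^+ 6.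
    rewrite [in RHS]nL -!expRM_natl -expRN -expRD /Q; congr expR; ring.
  by rewrite ler_pM2r ?invr_gt0 ?exprn_gt0// !expr2 ler_pM ?expR_ge0// ltW.
have mn0 : 0 < m.+1%:R :> R by rewrite ltr0n.
split.
- have e1 : n ^+ 3 / r <= expR (Q / 2).
    rewrite ler_pdivrMr//.
    rewrite (_ : Q / 2 = 3%:R * L + c * X); last by rewrite /Q; field.
    rewrite expRD expRM_natl -nL -mulrA ler_peMr ?exprn_ge0 ?(ltW n0)//.
    rewrite -ler_pdivrMl ?expR_gt0// mulr1 -expRN ltW//.
  apply: (le_trans e1); apply: (@le_trans _ _ (expR (2^-1) ^+ m)).
    by rewrite -expRM_natl ler_expR ler_pM2r ?invr_gt0.
  by apply: lerXn2r; rewrite ?nnegrE ?expR_ge0// expR_half_le2.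
- apply: le_trans eQ; rewrite ler_expR lerN2 ler_pdivlMr//.
  apply: (@le_trans _ _ ((k * X) * (k * X))).
    apply: ler_pM => //; [lra|rewrite -natr1; lra].
  rewrite -expr2 exprMn X2 ler_pM2r//.
- apply: le_trans eQ; rewrite ler_expR lerN2; apply: (le_trans QX).
  apply: (@le_trans _ _ (X / 2)); first by rewrite mulrC ler_pM2l//; lra.
  have Xn : X <= n.
    rewrite -X2 expr2 ler_peMr ?(ltW X0)// -(@ler_pXn2r _ 2)// ?nnegrE ?(ltW X0)// X2 expr1n; lra.
  apply: (@le_trans _ _ (n / 2)); first by rewrite ler_pM2r.
  have : n * 3 <= n * n by rewrite ler_pM2l.
  rewrite -expr2; lra.
Qed.

Lemma half_le_ln (n : nat) : (2 <= n)%N -> 2^-1 <= ln n%:R :> R.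
Proof.
move=> n2; rewrite -ler_expR lnK ?posrE ?ltr0n ?(ltn_trans _ n2)//.
by apply: le_trans expR_half_le2 _; rewrite ler_nat.
Qed.

Lemma invr_sqr_le_powR (n : nat) : (0 < n)%N ->
  (n%:R ^+ 2)^-1 <= n%:R `^ (- (3 / 2)) :> R.
Proof.
move=> n0; rewrite -powR_mulrn ?ler0n// -powRN ler_powR ?ler1n//; lra.
Qed.

End subexponential_scales.

Theorem theorem1p3 (R : realType) (theta : R) (mu : probability (Isom R) R)
    (d : measure_display) (T : measurableType d) (P : probability T R)
    (g : nat -> {RV P >-> Isom R}) :
  0 <= theta < 2 * pi ->
  (exists q : rat, cos theta = ratr q) ->
  (forall k : int, cos theta <> k%:~R / 2) ->
  littlewood_polynomial theta mu \/ asymmetric_wreath_product theta mu ->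
  mutually_independent g ->
  (forall n (A : set (Isom R)), measurable A -> distribution P (g n) A = mu A) ->
  exists c C : R, [/\ 0 < c, 0 < C &
    forall (N : nat) (x0 : plane R) (r : R), (2 <= N)%N ->
      expR (- c * Num.sqrt N%:R / ln N%:R) < r ->
      (`| P [set w | eball x0 r (walk g N w)] -
          @standard_gaussian_plane R
            [set z | eball x0 r (dilation (walk_sigma g * Num.sqrt N%:R) z)] |
       <= (C * N%:R `^ (- (3 / 2)) * r ^+ 2)%:E)%E].
Proof.
move=> _ cQ c2 types indep law.
have sin0 : sin theta != 0.
  exact: (sin_neq0_of_cos (cos2Dsin2 theta) c2).
have [p [q [a [b [s params]]]]] : exists p q a b s,
    walk_parameters g theta p q a b s.
  case: types => [/(littlewood_walk_parameters indep law)|].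
    by exists 0, 1, 0, 0, (sin theta).
  exact: (asymmetric_wreath_walk_parameters indep law sin0).
have [[[p0 q0 a0 b0] pqab pq0 baq sE] [sigmaE laws]] := params.
have cs : cos theta ^+ 2 + s ^+ 2 = 1.
  by case: sE => ->; rewrite ?sqrrN cos2Dsin2.
have s0 : s != 0 by case: sE => ->; rewrite ?oppr_eq0.
have [kap [C1 [kap0 C10 est]]] :=
  char_walk_ball_estimate p0 q0 a0 b0 pqab cs pq0 baq s0 cQ c2.
have [c [N0 [c0 N03 cutoff]]] := exists_frequency_cutoff kap0.
(* For [N < N0] one has [N ^ 2 <= N0 ^ 2] and [r ^ 2 >= exp(- 2 c N0)], so [C2] makes the claimed
   bound at least 1, the largest possible difference of two probabilities. *)
pose C2 := N0%:R ^+ 2 * expR (2 * c * N0%:R).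
have C20 : 0 < C2 by rewrite mulr_gt0 ?expR_gt0// exprn_gt0// ltr0n (leq_trans _ N03).
(* Since [ln N >= 1 / 2] for [N >= 2], dividing by it at most doubles the exponent. *)
exists (c / 2), (C1 + C2); split; [by rewrite divr_gt0|by rewrite addr_gt0|].
move=> N x0 r N2 cr.
have N1 : (0 < N)%N by exact: leq_trans N2.
have n0 : 0 < N%:R :> R by rewrite ltr0n.
have {}cr : expR (- (c * Num.sqrt N%:R)) < r.
  apply: le_lt_trans cr; rewrite ler_expR !mulNr lerN2.
  have lnN := @half_le_ln R N N2.
  rewrite ler_pdivrMr ?(lt_le_trans _ lnN) ?invr_gt0//.
  by rewrite mulrAC ler_pM2l ?mulr_gt0 ?sqrtr_gt0.
have r0 : 0 < r by exact: lt_trans (expR_gt0 _) cr.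
have [nu [nuphi nuE]] := laws N.
rewrite -(nuE (eball x0 r) (measurable_eball x0 r)).
set k := walk_sigma g * _.
(* Convertible: the dilated law of the ball is the Gaussian mass of its preimage under the
   dilation. *)
rewrite -[@standard_gaussian_plane R _]/(dilated_gaussian k (eball x0 r)).
have fin_ball (P' : probability (mplane R) R) : P' (eball x0 r) \is a fin_num.
  by apply: fin_num_measure; exact: measurable_eball.
have le1 (P' : probability (mplane R) R) : (P' (eball x0 r) <= 1%:E)%E.
  by apply: probability_le1; exact: measurable_eball.
have ge0 (P' : probability (mplane R) R) : (0%:E <= P' (eball x0 r))%E.
  exact: measure_ge0.
set D := N%:R `^ _.
have D0 : (N%:R ^+ 2)^-1 <= D by exact: invr_sqr_le_powR.
have Dpos : 0 < D by apply: lt_le_trans D0; rewrite invr_gt0 exprn_gt0.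
set x := nu _; set y := dilated_gaussian k _.
have xf : x \is a fin_num := fin_ball nu.
have yf : y \is a fin_num := fin_ball (dilated_gaussian k).
rewrite -(fineK xf) -(fineK yf) -EFinB abse_EFin lee_fin ler_norml.
suff [xy yx] : fine x <= fine y + (C1 + C2) * D * r ^+ 2 /\
    fine y <= fine x + (C1 + C2) * D * r ^+ 2.
  by rewrite lerBrDr lerBlDl addrC lerBlDr yx.
have [N0N|NN0] := leqP N0 N.
  have [m [m1 m2 m3]] := cutoff N r N0N cr.
  have N3 := leq_trans N03 N0N.
  have : (x <= y + (C1 * (r ^+ 2 / N%:R ^+ 2))%:E)%E /\
      (y <= x + (C1 * (r ^+ 2 / N%:R ^+ 2))%:E)%E.
    by have := est nu N m r x0 nuphi N3 r0 m1 m2 m3; rewrite -sigmaE.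
  rewrite -(fineK xf) -(fineK yf) -!EFinD !lee_fin.
  have le : C1 * (r ^+ 2 / N%:R ^+ 2) <= (C1 + C2) * D * r ^+ 2.
    rewrite -mulrA; apply: ler_pM => //.
    - exact: ltW.
    - by rewrite divr_ge0 ?exprn_ge0 ?ltW.
    - by rewrite lerDl ltW.
    - by rewrite mulrC ler_pM2r// exprn_gt0.
  by move=> [h1 h2]; split; [apply: le_trans h1 _|apply: le_trans h2 _]; rewrite lerD2l.
have big : 1 <= (C1 + C2) * D * r ^+ 2.
  apply: (@le_trans _ _ (C2 * (N%:R ^+ 2)^-1 * expR (- (c * Num.sqrt N%:R)) ^+ 2)).
    have nN0 : N%:R <= N0%:R :> R by rewrite ler_nat ltnW.
    have sN : Num.sqrt N%:R <= N0%:R :> R.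
      apply: le_trans nN0; rewrite -[leRHS]sqr_sqrtr ?ler0n// expr2 ler_peMr ?sqrtr_ge0//.
      by rewrite -[leLHS]sqrtr1 ler_wsqrtr// ler1n.
    rewrite (_ : C2 * _ * _ = N0%:R ^+ 2 / N%:R ^+ 2 *
        (expR (2 * c * N0%:R) * expR (- (c * Num.sqrt N%:R)) ^+ 2)); last first.
      by rewrite /C2; ring.
    rewrite -[leLHS]mul1r; apply: ler_pM => //.
      by rewrite ler_pdivlMr ?exprn_gt0// mul1r !expr2 ler_pM// ltW.
    rewrite -expRM_natl -expRD; apply: le_trans (expR_ge1Dx _).
    rewrite lerDl mulrN subr_ge0 mulrA ler_pM2l// mulr_gt0//.
  rewrite -mulrA -[leRHS]mulrA; apply: ler_pM; [exact: ltW| |by rewrite lerDr ltW|].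
    by rewrite mulr_ge0 ?sqr_ge0// invr_ge0 sqr_ge0.
  apply: ler_pM => //.
  by rewrite !expr2 ler_pM ?expR_ge0// ltW.
have [x0' x1] : 0 <= fine x /\ fine x <= 1.
  by rewrite -!lee_fin fineK//; split; [exact: ge0|exact: le1].
have [y0' y1] : 0 <= fine y /\ fine y <= 1.
  by rewrite -!lee_fin fineK//; split; [exact: ge0|exact: le1].
by move: x0' x1 y0' y1 big; move: (_ * r ^+ 2) (fine x) (fine y) => u v z; lra.
Qed.
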